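(* Let $w=(w_1,w_2)$ be a pair of real numbers with $w_1>w_2>0$ and $w_1+w_2=1$. Then the Hausdorff dimension of $$\mathcal{D}(\mathcal{L}_3,\mathcal{A}^+)=\{\Lambda\in\mathcal{L}_3:\ \mathcal{A}^+\Lambda\text{ is divergent}\}$$ is at least $8-\frac{1}{1+w_1}$.
   Context: $\mathcal{L}_3\cong SL_3(\mathbb{R})/SL_3(\mathbb{Z})$ is the space of unimodular lattices in $\mathbb{R}^3$, an $8$-dimensional manifold; Hausdorff dimension of its subsets is taken with respect to any Riemannian metric on it. $\mathcal{A}^+=\{a_t=\mathrm{diag}(e^{w_1t},e^{w_2t},e^{-t}):t\ge0\}$ acts by $a_t\Lambda=\{a_t\mathbf{v}:\mathbf{v}\in\Lambda\}$. The trajectory $\mathcal{A}^+\Lambda$ is divergent if for every compact subset $\mathcal{K}$ of $\mathcal{L}_3$ there exists $T_0>0$ such that $a_t\Lambda\notin\mathcal{K}$ for all $t\ge T_0$. *)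

(* Defs.v *)
From HB Require Import structures.
From mathcomp Require Import all_boot all_order all_algebra.
From mathcomp Require Import all_classical all_reals all_analysis.

Set Implicit Arguments.
Unset Strict Implicit.
Unset Printing Implicit Defensive.

Import Order.TTheory GRing.Theory Num.Theory.
Import numFieldNormedType.Exports.

Local Open Scope classical_set_scope.
Local Open Scope ring_scope.

Section hausdorff_dimension.
Variables (R : realType) (T : Type) (d : T -> T -> \bar R).
Local Open Scope ereal_scope.

(* 0 is adjoined so that the empty set has diameter 0 rather than -oo *)
Definition diameter (A : set T) : \bar R :=
  ereal_sup (0 |` [set d x y | x in A & y in A]).

Definition hausdorff_premeasure (s delta : R) (A : set T) : \bar R :=
  ereal_inf [set \sum_(0 <= i <oo) diameter (U i) `^ s |
    U in [set U : nat -> set T |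
      A `<=` \bigcup_i U i /\ forall i, diameter (U i) <= delta%:E]].

Definition hausdorff_measure (s : R) (A : set T) : \bar R :=
  ereal_sup [set hausdorff_premeasure s delta A |
    delta in [set delta : R | (0 < delta)%R]].

Definition hausdorff_dim (A : set T) : \bar R :=
  ereal_inf [set s%:E | s in
    [set s : R | (0 < s)%R /\ hausdorff_measure s A = 0]].

End hausdorff_dimension.

Section smooth_functions.
Variables (R : realType) (V : normedModType R).

Fixpoint is_Ck (k : nat) (f : V -> R) : Prop :=
  if k is k'.+1 then
    (forall x v : V, derivable f x v) /\
    (forall v : V, is_Ck k' (fun x => 'D_v f x))
  else continuous f.

Definition smooth (f : V -> R) : Prop := forall k : nat, is_Ck k f.

End smooth_functions.

Section space_of_lattices.
Variable R : realType.

Definition SL3 : set 'M[R]_3 := [set g | \det g = 1].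

Definition lattice_of (g : 'M[R]_3) : set 'cV[R]_3 :=
  [set g *m map_mx intr z | z in [set: 'cV[int]_3]].

Definition unimodular_lattice : set (set 'cV[R]_3) :=
  [set L | exists2 g, SL3 g & L = lattice_of g].

Definition L3 : Type := set_type unimodular_lattice.

HB.instance Definition _ := Choice.on L3.

Definition L3_val (L : L3) : set 'cV[R]_3 := set_val L.

Lemma lattice_of_unimodular (g : SL3) :
  lattice_of (set_val g) \in unimodular_lattice.
Proof. by apply/mem_set; exists (set_val g) => //; exact: set_valP. Qed.

(* the projection SL_3(R) -> SL_3(R)/SL_3(Z), g |-> g Z^3 *)
Definition L3_proj (g : SL3) : L3 := SigSub (lattice_of_unimodular g).

(* L3 carries the quotient topology, SL3 the one induced from 'M[R]_3 *)
Definition L3_open : set_system L3 := [set U | open (L3_proj @^-1` U)].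

Lemma L3_openT : L3_open setT.
Proof. by rewrite /L3_open /= preimage_setT; exact: openT. Qed.

Lemma L3_openI : setI_closed L3_open.
Proof. by move=> U V oU oV; rewrite /L3_open /= preimage_setI; exact: openI. Qed.

Lemma L3_open_bigU (I : Type) (f : I -> set L3) :
  (forall i, L3_open (f i)) -> L3_open (\bigcup_i f i).
Proof.
move=> of_; rewrite /L3_open /= preimage_bigcup.
by apply: bigcup_open => i _; exact: of_.
Qed.

HB.instance Definition _ :=
  isOpenTopological.Build L3 L3_openT L3_openI L3_open_bigU.

(* The tangent space of L3 at L is identified with sl_3 = {X | \tr X = 0}: if c
   is a curve in SL3, the velocity of t |-> c t Z^3 is c' t * (c t)^-1, which
   does not change when c is replaced by c * gamma with gamma in SL_3(Z). A
   Riemannian metric is thus an inner product Q L on sl_3 for each L, depending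
   smoothly on L. Since SL3 -> L3 is a covering by local diffeomorphisms,
   smoothness is tested on SL3, and since SL3 is a closed submanifold of
   'M[R]_3, a function on it is smooth iff it is the restriction of a smooth
   function on 'M[R]_3. *)
Record riemannian_metric := RiemannianMetric {
  rm_form :> L3 -> 'M[R]_3 -> 'M[R]_3 -> R ;
  rm_linear : forall L (a : R) X Y Z, \tr X = 0 -> \tr Y = 0 -> \tr Z = 0 ->
    rm_form L (a *: X + Y) Z = a * rm_form L X Z + rm_form L Y Z ;
  rm_sym : forall L X Y, \tr X = 0 -> \tr Y = 0 ->
    rm_form L X Y = rm_form L Y X ;
  rm_pos : forall L X, \tr X = 0 -> X != 0 -> 0 < rm_form L X X ;
  rm_smooth : forall X Y, \tr X = 0 -> \tr Y = 0 ->
    exists2 F : 'M[R]_3 -> R, smooth F &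
      forall g : SL3, F (set_val g) = rm_form (L3_proj g) X Y }.

Definition mx_curve (c : R -> SL3) (t : R) : 'M[R]_3 := set_val (c t).

Definition C1_curve (c : R -> SL3) : Prop :=
  (forall t, derivable (mx_curve c) t 1) /\ continuous (derive1 (mx_curve c)).

Definition velocity (c : R -> SL3) (t : R) : 'M[R]_3 :=
  derive1 (mx_curve c) t *m invmx (mx_curve c t).

Definition curve_length (Q : riemannian_metric) (c : R -> SL3) : \bar R :=
  (\int[lebesgue_measure]_(t in `[0%R, 1%R]%classic)
     (Num.sqrt (Q (L3_proj (c t)) (velocity c t) (velocity c t)))%:E)%E.

(* Every C^1 curve in L3 lifts to SL3. Letting curves be C^1 on all of R, or
   piecewise C^1 on [0, 1], gives the same infimum: reparametrize so that the
   curve is at rest at the corners and at the endpoints. *)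
Definition riemannian_dist (Q : riemannian_metric) (L L' : L3) : \bar R :=
  ereal_inf [set curve_length Q c | c in
    [set c : R -> SL3 |
      [/\ C1_curve c, L3_proj (c 0) = L & L3_proj (c 1) = L']]].

Definition flow (w1 w2 t : R) : 'M[R]_3 :=
  \matrix_(i, j) if i == j then [:: expR (w1 * t); expR (w2 * t); expR (- t)]`_i
                 else 0.

(* a bare subset of R^3; it is a unimodular lattice when w1 + w2 = 1 *)
Definition flow_lattice (w1 w2 t : R) (L : L3) : set 'cV[R]_3 :=
  [set flow w1 w2 t *m v | v in L3_val L].

Definition divergent_trajectory (w1 w2 : R) (L : L3) : Prop :=
  forall K : set L3, compact K ->
    exists2 T0 : R, 0 < T0 &
      forall t, T0 <= t -> ~ (L3_val @` K) (flow_lattice w1 w2 t L).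

Definition divergent_set (w1 w2 : R) : set L3 :=
  [set L | divergent_trajectory w1 w2 L].

End space_of_lattices.

(* Main.v *)
Require Import Defs.
From HB Require Import structures.
From mathcomp Require Import all_boot all_order all_algebra.
From mathcomp Require Import all_classical all_reals all_analysis.
From mathcomp Require Import perm measurable_realfun.
From mathcomp Require Import zify ring lra.

(** Write a matrix near the identity as L N with L lower triangular and N unipotent
    upper triangular with rows (1, y, -z), (0, 1, -x), (0, 0, 1). For t >= 0 the
    flow conjugates L into a bounded family, so divergence is a matter of (y, z, x)
    alone: six of the eight coordinates are free, and it remains to find, for each
    small y, enough points (z, x) in the plane.

    Let a lattice vector have the form (X, Y, q), where X = p1 + y p2 and Y = p2. The
    matrix N sends it to (X - q z, Y - q x, q), so it is short during a window of
    times when its position (X / q, Y / q) is close to (z, x) compared with the size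
    of its denominator q. By Mahler's criterion (the direction used is
    [compact_systole]) the trajectory diverges as soon as there are vectors v_k with
    denominators about exp(t_k), t_{k+1} = (1 + e) t_k, whose windows cover a
    half-line ([divergent_chart]). Such sequences are the branches of a tree. A node
    keeps v_k together with its predecessor, and prescribes the sizes of the two wedge
    products of v_k with its predecessor; this is what makes v_{k+1} have a position
    close to that of v_k. [exists_children] counts the children of a node and shows
    that they are well spread: children in one row are further apart in the second
    coordinate than the boxes that hold their descendants are high, and children
    in different rows are further apart than these boxes in one of the two
    coordinates.

    The set of limit points should have dimension 1 + w1 / (1 + w1) in the plane.
    Rather than a measure on it, the proof uses a potential: a function of the level
    and of a radius which does not increase when it is averaged over the children
    that a square of that radius can meet. If countably many squares have total
    potential less than one at the root, this remains true along some branch, and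
    the limit point of that branch lies in none of the squares ([tree_cover]). Hence
    the squares that cover a fibre satisfy a lower bound on the sum of
    rho ^ (1 - d) rho ^ (w1 / (1 + w1)), and integration over the six free
    coordinates ([slices]) adds rho ^ 6.

    Finally a Riemannian distance dominates a multiple of the difference of the
    matrix entries, hence of the chart coordinates, near the identity
    ([dist_lower_bound]). If the s-dimensional Hausdorff measure vanished for some
    s < 8 - 1 / (1 + w1) = 7 + w1 / (1 + w1), there would be covers with arbitrarily
    small sum of the s-th powers of the diameters; each set of such a cover lies in a
    cube of comparable size, and the bound above fails ([hausdorff_measure_neq0]). *)

Set Implicit Arguments.
Unset Strict Implicit.
Unset Printing Implicit Defensive.
Import Order.TTheory GRing.Theory Num.Theory.
Import numFieldNormedType.Exports.
Local Open Scope ring_scope.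

(** * Counting coprime pairs and small cross products *)

Lemma card_le_sum_has (T : finType) (I : Type) (s : seq I) (P : I -> pred T)
    (A : pred T) :
  (forall t, A t -> has (P^~ t) s) -> (#|A| <= \sum_(x <- s) #|P x|)%N.
Proof.
elim: s A => [|x s IH] A hA.
  by rewrite big_nil leqn0; apply/eqP/eq_card0 => t; apply/negP => /hA.
rewrite big_cons -(cardID (P x) A) leq_add //.
  by apply: subset_leq_card; apply/fintype.subsetP => t; rewrite !inE => /andP[].
apply: IH => t /andP[nP At]; have /= := hA t At.
by move: nP; rewrite unfold_in => /negPf ->.
Qed.

Lemma eq_of_divn_dvdz (d m n : nat) :
  (m %/ d = n %/ d)%N -> (d%:Z %| (m%:Z - n%:Z)%R)%Z -> m = n.
Proof.
move=> e /dvdzP [k hk].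
case: (posnP d) hk e => [->|d0] hk e; first by move: hk; rewrite mulr0; lia.
have hm := divn_eq m d; have hn := divn_eq n d.
have lm := ltn_pmod m d0; have ln := ltn_pmod n d0.
rewrite e in hm; move: (_ %/ _)%N (m %% d)%N (n %% d)%N hm hn lm ln => a b c hm hn lm ln.
have hk' : b%:Z - c%:Z = k * d%:Z by lia.
have k0 : k = 0 by nia.
by move: hk'; rewrite k0; lia.
Qed.

Lemma dvdz_diff (d x m n : int) : (d %| (x + m)%R)%Z -> (d %| (x + n)%R)%Z ->
  (d %| (m - n)%R)%Z.
Proof.
move=> hm hn; have -> : m - n = (x + m) - (x + n) by ring.
exact: rpredB.
Qed.

Lemma div_ltS (m n d : nat) : (m < n -> m %/ d < (n %/ d).+1)%N.
Proof. by move=> h; rewrite ltnS leq_div2r // ltnW. Qed.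

Lemma card_common_multiples (nI nJ d : nat) (i0 : int) (j0 : 'I_nI -> int) :
  (#|[pred t : 'I_nI * 'I_nJ | (d%:Z %| (i0 + t.1%:Z)%R)%Z &&
      (d%:Z %| (j0 t.1 + t.2%:Z)%R)%Z]| <= (nI %/ d).+1 * (nJ %/ d).+1)%N.
Proof.
pose f (t : 'I_nI * 'I_nJ) : 'I_(nI %/ d).+1 * 'I_(nJ %/ d).+1 :=
  (Ordinal (div_ltS d (ltn_ord t.1)), Ordinal (div_ltS d (ltn_ord t.2))).
have -> : ((nI %/ d).+1 * (nJ %/ d).+1 =
    #|{: 'I_(nI %/ d).+1 * 'I_(nJ %/ d).+1}|)%N by rewrite card_prod !card_ord.
apply: (@leq_card_in _ _ f) => -[x y] [x' y']; rewrite !inE /=.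
move=> /andP[h1 h2] /andP[h1' h2'] [e1 e2].
have ex : x = x'.
  by apply: val_inj; apply: (eq_of_divn_dvdz e1); exact: (dvdz_diff h1 h1').
subst x'; congr pair; apply: val_inj; apply: (eq_of_divn_dvdz e2).
exact: (dvdz_diff h2 h2').
Qed.

(** A common divisor d > 1 of the pair is at most the first entry, hence less than D;
    common multiples of d are counted by their quotients. *)
Lemma card_not_coprime (nI nJ D i0 : nat) (j0 : 'I_nI -> int) :
  (0 < i0)%N -> (i0 + nI <= D)%N ->
  (#|[pred t : 'I_nI * 'I_nJ | ~~ coprimez (i0%:Z + t.1%:Z) (j0 t.1 + t.2%:Z)]|
   <= \sum_(2 <= d < D) (nI %/ d).+1 * (nJ %/ d).+1)%N.
Proof.
move=> i0_gt0 hD.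
pose P d := [pred t : 'I_nI * 'I_nJ | (d%:Z %| (i0%:Z + t.1%:Z)%R)%Z &&
      (d%:Z %| (j0 t.1 + t.2%:Z)%R)%Z].
apply: (@leq_trans (\sum_(2 <= d < D) #|P d|)); last first.
  by apply: leq_sum => d _; exact: card_common_multiples.
apply: card_le_sum_has => -[x y]; rewrite inE /= => nc.
have hx := ltn_ord x.
pose g := gcdn (i0 + x) (absz (j0 x + y%:Z)%R).
have gg : gcdz (i0%:Z + x%:Z) (j0 x + y%:Z) = g%:Z by [].
have g1 : g != 1%N by move: nc; rewrite /coprimez gg.
have g0 : (0 < g)%N by rewrite gcdn_gt0 addn_gt0 i0_gt0.
have gle : (g <= i0 + x)%N by rewrite dvdn_leq ?addn_gt0 ?i0_gt0 // dvdn_gcdl.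
apply/hasP; exists g; first by rewrite mem_index_iota; lia.
by rewrite /= -gg dvdz_gcdl dvdz_gcdr.
Qed.

Section cross.
Variable R : realType.

(** Encodes an integer that is known to exceed m as a natural number, so that it can
    index a finite type. *)
Definition int_offset (m v : int) : nat := absz (v - m)%R.

Lemma int_offset_near (be l : R) (v : int)
    (m := (Num.floor (be - l) + 1)%R) : `|v%:~R - be| < l ->
  v = m + (int_offset m v)%:Z /\ (int_offset m v < (Num.truncn (2 * l)%R).+1)%N.
Proof.
rewrite ltr_norml => /andP[h1 h2].
have f1 : (Num.floor (be - l))%:~R <= be - l by exact: floor_le.
have f2 : be - l < m%:~R by exact: floorD1_gt.
have hv : Num.floor (be - l) < v by rewrite -(ltr_int R); lra.
have e0 : (int_offset m v)%:Z = v - m by rewrite /int_offset /m; lia.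
split; first by rewrite e0; ring.
rewrite ltnS truncn_ge_nat; last by lra.
have -> : (int_offset m v)%:R = (int_offset m v)%:Z%:~R :> R by [].
rewrite e0 rmorphB /=; lra.
Qed.

(** The form b j - a c takes few integer values near be. Two points with the same
    value and the same quotient j / a coincide, since a divides b (j - j') and is
    prime to b. *)
Lemma card_cross (nJ nC a : nat) (b j0 : int) (c0 : 'I_nJ -> int) (be l : R) :
  (0 < a)%N -> coprimez a%:Z b ->
  (#|[pred t : 'I_nJ * 'I_nC |
      (`|(b * (j0 + t.1%:Z) - a%:Z * (c0 t.1 + t.2%:Z))%:~R - be| < l)%R]|
   <= (nJ %/ a).+1 * (Num.truncn (2 * l)%R).+1)%N.
Proof.
move=> a0 cop.
pose v (t : 'I_nJ * 'I_nC) := b * (j0 + t.1%:Z) - a%:Z * (c0 t.1 + t.2%:Z).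
pose m := Num.floor (be - l) + 1.
pose f (t : 'I_nJ * 'I_nC) : 'I_(nJ %/ a).+1 * 'I_(Num.truncn (2 * l)).+1 :=
  (Ordinal (div_ltS a (ltn_ord t.1)), inord (int_offset m (v t))).
have -> : ((nJ %/ a).+1 * (Num.truncn (2 * l)%R).+1 =
    #|{: 'I_(nJ %/ a).+1 * 'I_(Num.truncn (2 * l)%R).+1}|)%N.
  by rewrite card_prod !card_ord.
apply: (@leq_card_in _ _ f) => t t'; rewrite !inE.
rewrite -/(v t) -/(v t') => /int_offset_near [e h] /int_offset_near [e' h'].
move=> ef; have e1 : (t.1 %/ a = t'.1 %/ a)%N by have := congr1 (fun u => val u.1) ef.
have := congr1 (fun u => val u.2) ef; rewrite /= !inordK // => e2.
have ev : v t = v t' by rewrite e e' -/m e2.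
have e3 : t.1 = t'.1.
  apply: val_inj; apply: (eq_of_divn_dvdz e1).
  have : (a%:Z %| (b * (t.1%:Z - t'.1%:Z))%R)%Z.
    apply/dvdzP; exists (c0 t.1 + t.2%:Z - (c0 t'.1 + t'.2%:Z)).
    move: ev; rewrite /v => ev.
    have -> : b * (t.1%:Z - t'.1%:Z) = b * (j0 + t.1%:Z) - b * (j0 + t'.1%:Z) by ring.
    have -> : b * (j0 + t.1%:Z) = b * (j0 + t'.1%:Z) - a%:Z * (c0 t'.1 + t'.2%:Z) + a%:Z * (c0 t.1 + t.2%:Z) by rewrite -ev; ring.
    ring.
  by rewrite Gauss_dvdzr.
case: t t' e3 ev {e e' h h' e1 e2 ef} => [x y] [x' y'] /= e3; subst x'.
rewrite /v /= => ev; congr pair; apply: val_inj => /=.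
have : a%:Z * (y%:Z - y'%:Z) = 0.
  have -> : a%:Z * (y%:Z - y'%:Z) = (b * (j0 + x%:Z) - a%:Z * (c0 x + y'%:Z)) - (b * (j0 + x%:Z) - a%:Z * (c0 x + y%:Z)) by ring.
  by rewrite ev subrr.
nia.
Qed.
End cross.

Section harmonic.
Variable R : realType.

(** The stronger bound 3/4 - 1/(D-1) is inductive. The value 3/4 matters: it has to be
    less than 1 for coprime pairs to have positive density. *)
Lemma sum_inv_sqr (D : nat) : \sum_(2 <= d < D) (d%:R^-1 : R) ^+ 2 <= 3 / 4.
Proof.
suff h n : \sum_(2 <= d < n.+3) (d%:R^-1 : R) ^+ 2 <= 3 / 4 - n.+2%:R^-1.
  case: D => [|[|[|n]]]; try by rewrite big_geq //; lra.
  by apply: (le_trans (h n)); rewrite gerBl invr_ge0.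
elim: n => [|n IH]; first by rewrite big_nat1 expr2; lra.
rewrite big_nat_recr //=; apply: (le_trans (lerD IH (lexx _))).
have n0 : 0 < n.+2%:R :> R by rewrite ltr0n.
rewrite -[n.+3%:R](natr1) .
move: (n.+2%:R) n0 => x x0.
have x1 : 0 < x + 1 by lra.
rewrite -subr_ge0.
have -> : 3 / 4 - (x + 1)^-1 - (3 / 4 - x^-1 + (x + 1)^-1 ^+ 2) =
  (x * (x + 1) ^+ 2)^-1.
  by field; rewrite ?gt_eqF.
by rewrite invr_ge0 mulr_ge0 ?sqr_ge0 // ltW.
Qed.

Lemma sum_inv_le_ln (D : nat) : \sum_(2 <= d < D.+2) (d%:R^-1 : R) <= ln D.+1%:R.
Proof.
elim: D => [|D IH]; first by rewrite big_geq // ln1.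
rewrite big_nat_recr //=; apply: (le_trans (lerD IH (lexx _))).
have n0 : 0 < D.+1%:R :> R by rewrite ltr0n.
have n1 : 0 < D.+2%:R :> R by rewrite ltr0n.
have e : D.+1%:R = D.+2%:R * (1 - D.+2%:R^-1) :> R.
  by rewrite mulrBr mulr1 divff ?gt_eqF // -[D.+2%:R]natr1 addrK.
have p : 0 < 1 - D.+2%:R^-1 :> R.
  by rewrite subr_gt0 invf_lt1 // ltr1n.
rewrite {1}e lnM ?posrE //.
have := @le_ln1Dx R (- D.+2%:R^-1).
rewrite ltrN2 invf_lt1 // ltr1n => /(_ isT) hl.
by rewrite -addrA gerDl -lerBrDr sub0r.
Qed.

Lemma divn_le_natr (n d : nat) : (n %/ d)%N%:R <= n%:R * d%:R^-1 :> R.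
Proof.
case: (posnP d) => [->|d0]; first by rewrite divn0 invr0 mulr0.
by rewrite ler_pdivlMr ?ltr0n // -natrM ler_nat leq_trunc_div.
Qed.

(** Union bound over the common divisors; the logarithm comes from the linear terms in
    1/d. *)
Lemma card_coprime_ge (nI nJ i0 D : nat) (h : R) (j0 : 'I_nI -> int) :
  (0 < i0)%N -> (i0 + nI <= D)%N -> ln D%:R <= h ->
  16 * h + 256 <= nJ%:R -> 16 * h <= nI%:R -> D%:R <= 16 * nI%:R :> R ->
  nI%:R * nJ%:R / 8 <= #|[pred t : 'I_nI * 'I_nJ |
     coprimez (i0%:Z + t.1%:Z) (j0 t.1 + t.2%:Z)]|%:R :> R.
Proof.
move=> i0_gt0 hD lnD hJ hI D16.
have D0 : (0 < D)%N by lia.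
set A := [pred t | _].
have hc : (#|A| + #|[predC A]| = nI * nJ)%N by rewrite cardC card_prod !card_ord.
have hnc : (#|[predC A]| <= \sum_(2 <= d < D) (nI %/ d).+1 * (nJ %/ d).+1)%N.
  apply: leq_trans (card_not_coprime nJ j0 i0_gt0 hD).
  by apply: subset_leq_card; apply/fintype.subsetP => t.
(* (nI/d + 1)(nJ/d + 1) summed over d: the main term is at most 3/4 of nI nJ, the other
   two are absorbed by the sizes of nI and nJ *)
have hcR : #|A|%:R + #|[predC A]|%:R = nI%:R * nJ%:R :> R by rewrite -natrD hc natrM.
have hncR : #|[predC A]|%:R <= \sum_(2 <= d < D) (nI%:R * nJ%:R * d%:R^-1 ^+ 2
    + (nI%:R + nJ%:R) * d%:R^-1 + 1) :> R.
  move: hnc; rewrite -(ler_nat R) natr_sum => /le_trans; apply.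
  apply: ler_sum => d _; rewrite natrM -!natr1.
  have -> : nI%:R * nJ%:R * d%:R^-1 ^+ 2 + (nI%:R + nJ%:R) * d%:R^-1 + 1 =
    (nI%:R * d%:R^-1 + 1) * (nJ%:R * d%:R^-1 + 1) :> R by ring.
  by apply: ler_pM; rewrite ?lerD2r ?divn_le_natr // addr_ge0.
have s1 : \sum_(2 <= d < D) (d%:R^-1 : R) ^+ 2 <= 3 / 4 by exact: sum_inv_sqr.
have s2 : \sum_(2 <= d < D) (d%:R^-1 : R) <= h.
  apply: le_trans lnD; case: D D0 {hD D16 hnc hncR s1} => // -[|D] _.
    by rewrite big_geq // ln1.
  apply: (le_trans (sum_inv_le_ln D)).
  by rewrite ler_ln ?posrE ?ltr0n // ler_nat.
have s3 : \sum_(2 <= d < D) (1 : R) <= D%:R.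
  by rewrite sumr_const_nat ler_nat leq_subr.
move: hncR; rewrite !big_split -!mulr_sumr /=.
have I0 : 0 <= nI%:R :> R by []. have J0 : 0 <= nJ%:R :> R by [].
have m1 := ler_wpM2l (mulr_ge0 I0 J0) s1.
have m2 := ler_wpM2l (addr_ge0 I0 J0) s2.
move: m1 m2 s3 hcR; move: (\sum_(2 <= d < D) _) (\sum_(2 <= d < D) d%:R^-1) (\sum_(2 <= d < D) 1) => a b c.
move=> m1 m2 s3 hcR hncR.
have t1 : nI%:R * (16 * h + 256) <= nI%:R * nJ%:R by exact: ler_wpM2l.
have t2 : nJ%:R * (16 * h) <= nJ%:R * nI%:R by exact: ler_wpM2l.
lra.
Qed.
End harmonic.

(** * One step of the tree *)

Section states.
Variable R : realType.

Definition vec : Type := (R * R * R)%type.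

(** A node of the tree: the previous vector, an auxiliary vector and the current one,
    which together form a basis of determinant one. *)
Definition state : Type := (vec * vec * vec)%type.

Definition icomb (i j c : int) (u w v : vec) : vec :=
  (i%:~R * u.1.1 + j%:~R * w.1.1 + c%:~R * v.1.1,
   i%:~R * u.1.2 + j%:~R * w.1.2 + c%:~R * v.1.2,
   i%:~R * u.2 + j%:~R * w.2 + c%:~R * v.2).

(** Components of the wedge product of v and w. They are q_v q_w times the difference
    of the positions, and govern how far a child lies from its parent. *)
Definition wedX (v w : vec) : R := v.2 * w.1.1 - w.2 * v.1.1.
Definition wedY (v w : vec) : R := v.2 * w.1.2 - w.2 * v.1.2.

Definition det3 (a b c : vec) : R :=
  a.1.1 * (b.1.2 * c.2 - b.2 * c.1.2) - a.1.2 * (b.1.1 * c.2 - b.2 * c.1.1)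
  + a.2 * (b.1.1 * c.1.2 - b.1.2 * c.1.1).

(** The scales Q, X, Y control the current denominator and the two wedge products of
    the current vector with the previous one. *)
Definition good (Q X Y : R) (st : state) : Prop :=
  [/\ Q <= st.2.2 <= 2 * Q, X <= wedX st.2 st.1.1 <= 2 * X,
      Y <= wedY st.2 st.1.1 <= 2 * Y, `|st.1.1.2| <= 2 * Q &
      det3 st.1.1 st.1.2 st.2 = 1].

Definition posX (st : state) : R := st.2.1.1 / st.2.2.
Definition posY (st : state) : R := st.2.1.2 / st.2.2.

(** Whether the square of radius rho around (xi, eta) meets the box of half-sides a
    and b around the position of the state. For the a and b used below, this box
    contains the positions of all its descendants. *)
Definition hits (a b xi eta rho : R) (st : state) : bool :=
  (`|posX st - xi| <= a + rho) && (`|posY st - eta| <= b + rho).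

(** The previous vector becomes minus the current one, so that the wedge products of
    the child with its predecessor are positive again. *)
Definition child_of (st st' : state) : Prop :=
  exists i j c i' j' : int,
    st' = (icomb 0 0 (-1) st.1.2 st.1.1 st.2, icomb i' j' 0 st.1.2 st.1.1 st.2,
           icomb i j c st.1.2 st.1.1 st.2).

Lemma wedX_icomb i j c u w v :
  wedX v (icomb i j c u w v) = i%:~R * wedX v u + j%:~R * wedX v w.
Proof. by rewrite /wedX /icomb /=; ring. Qed.

Lemma wedY_icomb i j c u w v :
  wedY v (icomb i j c u w v) = i%:~R * wedY v u + j%:~R * wedY v w.
Proof. by rewrite /wedY /icomb /=; ring. Qed.

(** The only relation between the wedge products: it expresses the second one of a
    child through the first one and the row index. *)
Lemma wed_det3 w u v :
  wedX v w * wedY v u - wedY v w * wedX v u = v.2 * det3 w u v.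
Proof. by rewrite /wedX /wedY /det3; ring. Qed.

Lemma wedX_next i j c u w v :
  wedX (icomb i j c u w v) (icomb 0 0 (-1) u w v) =
  i%:~R * wedX v u + j%:~R * wedX v w.
Proof. by rewrite /wedX /icomb /=; ring. Qed.

Lemma wedY_next i j c u w v :
  wedY (icomb i j c u w v) (icomb 0 0 (-1) u w v) =
  i%:~R * wedY v u + j%:~R * wedY v w.
Proof. by rewrite /wedY /icomb /=; ring. Qed.

(** A child keeps determinant one exactly when (i', j') completes (i, j) to a matrix of
    SL_2(Z), which is possible when i and j are coprime. *)
Lemma det3_next i j c i' j' u w v :
  det3 (icomb 0 0 (-1) u w v) (icomb i' j' 0 u w v) (icomb i j c u w v) =
  (i' * j - j' * i)%:~R * det3 w u v.
Proof. by rewrite /det3 /icomb /= rmorphB !rmorphM /=; ring. Qed.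

End states.

Lemma ler_frac (F : realFieldType) (a b c d : F) :
  0 < b -> 0 < d -> a * d <= c * b -> a / b <= c / d.
Proof. by move=> b0 d0 h; rewrite ler_pdivrMr // mulrAC ler_pdivlMr. Qed.

(** The terms for a given first entry a have a factor 1/a from the counting of badab and
    a factor a from the number of second entries; they compensate. *)
Lemma row_term_le (n a B k : nat) : (0 < a)%N -> (a <= n)%N -> (0 < B)%N ->
  ((n %/ a).+1 * k * (2 * (a * B)).+1 <= 3 * B * (2 * n) * k)%N.
Proof.
move=> a0 an B0; have hd : ((n %/ a) * a <= n)%N by exact: leq_trunc_div.
have h1 : ((n %/ a).+1 * a <= 2 * n)%N by rewrite mulSn; lia.
have h2 : ((2 * (a * B)).+1 <= 3 * (a * B))%N by nia.
apply: (@leq_trans ((n %/ a).+1 * k * (3 * (a * B)))).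
  by rewrite leq_mul2l h2 orbT.
have -> : ((n %/ a).+1 * k * (3 * (a * B)) = (n %/ a).+1 * a * (3 * B * k))%N.
  by move: (n %/ a).+1 => m; ring.
have -> : (3 * B * (2 * n) * k = 2 * n * (3 * B * k))%N by ring.
by rewrite leq_mul2r h1 orbT.
Qed.

(** Dividing by the gcd turns the difference of two children into a reduced pair. *)
Lemma reduce_pair (m : nat) (n : int) : (0 < m)%N ->
  exists a b g, [/\ (0 < a)%N, (0 < g)%N, coprimez a%:Z b, m = (a * g)%N &
    n = b * g%:Z].
Proof.
move=> m0; pose g := gcdn m (absz n).
have g0 : (0 < g)%N by rewrite gcdn_gt0 m0.
have hm : (m %/ g * g = m)%N by rewrite divnK // dvdn_gcdl.
have hn : (n %/ g%:Z)%Z * g%:Z = n by rewrite divzK // dvdzE dvdn_gcdr.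
exists (m %/ g)%N, (n %/ g%:Z)%Z, g; split => //.
  by rewrite divn_gt0 // dvdn_leq // dvdn_gcdl.
rewrite coprimezE /= /coprime -(eqn_pmul2r g0) mul1n muln_gcdl hm.
by have := congr1 absz hn; rewrite abszM /= => ->.
Qed.

Lemma coprime_cross (i j i' j' : int) : 0 < i -> 0 < i' ->
  coprimez i j -> coprimez i' j' -> i * j' = i' * j -> i = i' /\ j = j'.
Proof.
move=> i0 i'0 c c' e.
have d1 : (i %| i')%Z by rewrite -(Gauss_dvdzl i' c) -e dvdz_mulr.
have d2 : (i' %| i)%Z by rewrite -(Gauss_dvdzl i c') e dvdz_mulr.
have ei : i = i'.
  move: d1 d2; rewrite !dvdzE => d1 d2.
  have : absz i = absz i' by apply/eqP; rewrite eqn_dvd d1 d2.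
  by move: i0 i'0; clear; lia.
by split => //; apply: (mulfI (x := i)); [rewrite gt_eqF | rewrite e ei].
Qed.

Lemma ler_pM3 (F : numDomainType) (a b c a' b' c' : F) :
  0 < a -> 0 < b -> 0 < c -> a <= a' -> b <= b' -> c <= c' ->
  a * b * c <= a' * b' * c'.
Proof.
by move=> a0 b0 c0 ha hb hc; do ![apply: ler_pM => //]; rewrite ?mulr_ge0 // ltW.
Qed.

Lemma absz_lt (F : numDomainType) (b : int) (n : nat) :
  `|b%:~R| < n%:R :> F -> (absz b < n)%N.
Proof. by rewrite -intr_norm [n%:R]pmulrn ltr_int; lia. Qed.

Lemma absz_ge1 (F : numDomainType) (b : int) : b != 0 -> 1 <= `|b%:~R| :> F.
Proof. by move=> b0; rewrite -intr_norm (ler_int F 1); lia. Qed.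

Lemma offset_range (b : int) (n : nat) : (absz b < n)%N ->
  (absz (b + n%:Z)%R < (2 * n).+1)%N /\ (absz (b + n%:Z)%R)%:Z - n%:Z = b.
Proof. by lia. Qed.

Lemma frac_gt0 (F : numFieldType) (n : nat) (a b : F) :
  (0 < n)%N -> 0 < a -> 0 < b -> 0 < n%:R * a / b.
Proof. by move=> n0 a0 b0; rewrite divr_gt0 // mulr_gt0 // ltr0n. Qed.

Section steps.
Variables (R : realType) (w u v : vec R).
Variables (Q X Y Qp Xp Yp ap bp h : R).
Hypotheses (Q0 : 0 < Q) (X0 : 0 < X) (Y0 : 0 < Y).
Hypotheses (Qp0 : 0 < Qp) (Xp0 : 0 < Xp) (Yp0 : 0 < Yp).
Hypothesis bp0 : 0 < bp.
Hypothesis gst : good Q X Y (w, u, v).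
(* N2 : the slope Y / Q decreases; N3 and N9 : a strip of height bp is thin for the
   vectors of either level; N4 : few children share a strip with another one of their
   row; N5, N6 and Nh : there are many more columns and rows than the logarithm of the
   largest row index; N6' : row indices are at least 8; N7 : denominators grow;
   N8 : children of different rows do not share a box. *)
Hypotheses (N2 : Q * Yp <= Qp * Y) (N3 : 4 * bp * Qp * Q <= Y)
  (N4 : 12288 * (64 * bp * Qp ^+ 2 + Y) * Xp <= Yp * X)
  (N5 : 16 * h + 256 <= Xp / (4 * X)) (N6 : 16 * h <= Yp * X / (16 * Q))
  (N6' : 8 <= Yp * X / (2 * Q)) (N7 : 8 * Q <= Qp)
  (Nh : ln (4 * Yp * X / Q) <= h)
  (N8 : 64 * Qp * (ap * Yp + bp * Xp) < 1) (N9 : 16 * bp * Qp ^+ 2 < Yp).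

Let q := v.2.
Let q' := w.2.
Let qu := u.2.
Let r := wedX v w.
Let s := wedY v w.
Let ru := wedX v u.
Let su := wedY v u.

Let Hq : Q <= q <= 2 * Q. Proof. by case: gst. Qed.
Let Hr : X <= r <= 2 * X. Proof. by case: gst. Qed.
Let Hs : Y <= s <= 2 * Y. Proof. by case: gst. Qed.
Let Hq' : `|q'| <= 2 * Q. Proof. by case: gst. Qed.
Let Hdet : r * su - s * ru = q.
Proof. by rewrite wed_det3; case: gst => _ _ _ _ /= ->; rewrite mulr1. Qed.
Let q0 : 0 < q. Proof. by case/andP: Hq => + _; apply: lt_le_trans. Qed.
Let r0 : 0 < r. Proof. by case/andP: Hr => + _; apply: lt_le_trans. Qed.
Let s0 : 0 < s. Proof. by case/andP: Hs => + _; apply: lt_le_trans. Qed.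

Let xx := Yp * r / q.
Let i0 := (Num.truncn xx).+1.
Let nI := Num.truncn (xx / 4).
Let nJ := Num.truncn (Xp / r).
Let nC := Num.truncn (Qp / q).

Let xx_ge : Yp * X / (2 * Q) <= xx.
Proof.
case/andP: Hq => _ hq; case/andP: Hr => hr _.
apply: ler_frac => //; first by rewrite mulr_gt0.
rewrite -!mulrA; apply: ler_wpM2l; first exact: ltW.
by apply: ler_pM => //; exact: ltW.
Qed.

Let xx_le : xx <= 2 * Yp * X / Q.
Proof.
case/andP: Hq => hq _; case/andP: Hr => _ hr.
apply: ler_frac => //.
have -> : 2 * Yp * X * q = Yp * (2 * X * q) by ring.
rewrite -[leLHS]mulrA; apply: ler_wpM2l; first exact: ltW.
by apply: ler_pM => //; exact: ltW.
Qed.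

Let xx8 : 8 <= xx. Proof. exact: le_trans xx_ge. Qed.
Let xx0 : 0 < xx. Proof. exact: lt_le_trans xx8. Qed.

Lemma truncn_bounds (z : R) : 0 <= z ->
  (Num.truncn z)%:R <= z /\ z < (Num.truncn z)%:R + 1.
Proof. by move=> z0; case/andP: (truncn_itv z0); rewrite -natr1. Qed.

Let nI_bounds : nI%:R <= xx / 4 /\ xx / 4 < nI%:R + 1.
Proof. by apply: truncn_bounds; rewrite divr_ge0 ?ltW. Qed.
Let nJ_bounds : nJ%:R <= Xp / r /\ Xp / r < nJ%:R + 1.
Proof. by apply: truncn_bounds; rewrite divr_ge0 ?ltW. Qed.
Let nC_bounds : nC%:R <= Qp / q /\ Qp / q < nC%:R + 1.
Proof. by apply: truncn_bounds; rewrite divr_ge0 ?ltW. Qed.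
Let i0_bounds : xx < i0%:R /\ i0%:R <= xx + 1.
Proof.
by have [] := truncn_bounds (ltW xx0); rewrite /i0 -natr1; lra.
Qed.

Let nI_ge : Yp * X / (16 * Q) <= nI%:R.
Proof.
have [_ h1] := nI_bounds; have := xx8; have h2 := xx_ge.
have e : Yp * X / (16 * Q) = Yp * X / (2 * Q) / 8 by field; rewrite ?gt_eqF.
rewrite e; lra.
Qed.

Let nJ_ge : Xp / (4 * X) <= nJ%:R.
Proof.
have [_ h1] := nJ_bounds.
case/andP: Hr => hr hr2.
have e : Xp / (4 * X) = Xp / (2 * X) / 2 by field; rewrite ?gt_eqF.
have h2 : Xp / (2 * X) <= Xp / r.
  by rewrite ler_pM2l // lef_pV2 ?posrE // mulr_gt0.
have h0 : 0 <= h.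
  apply: le_trans Nh; apply: ln_ge0.
  have -> : 4 * Yp * X / Q = 8 * (Yp * X / (2 * Q)) by field; rewrite ?gt_eqF.
  move: N6'; lra.
move: N5; rewrite e; lra.
Qed.

Let nC_ge : Qp / (4 * Q) <= nC%:R.
Proof.
have [_ h1] := nC_bounds.
case/andP: Hq => hq hq2.
have e : Qp / (4 * Q) = Qp / (2 * Q) / 2 by field; rewrite ?gt_eqF.
have h2 : Qp / (2 * Q) <= Qp / q.
  by rewrite ler_pM2l // lef_pV2 ?posrE // mulr_gt0.
have h4 : 4 <= Qp / (2 * Q).
  rewrite ler_pdivlMr ?mulr_gt0 //.
  by have -> : 4 * (2 * Q) = 8 * Q by ring.
rewrite e; lra.
Qed.

(* The child with row t, column t' and depth t'' is i u + j w + c v. The row index i is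
   prescribed; j and then c run over the progressions that put the first wedge
   product in [Xp, 2 Xp] and the denominator in [Qp, 2 Qp]. The second wedge product
   is then about Yp because the determinant of the state is one. *)
Let fi (t : 'I_nI) : int := i0%:Z + t%:Z.
Let fj0 (t : 'I_nI) : int :=
  Num.floor ((Xp - (fi t)%:~R * ru) / r) + 1.
Let fj (t : 'I_nI) (t' : 'I_nJ) : int := fj0 t + t'%:Z.
Let fc0 (t : 'I_nI) (t' : 'I_nJ) : int :=
  Num.floor ((Qp - (fi t)%:~R * qu - (fj t t')%:~R * q') / q) + 1.
Let fc (t : 'I_nI) (t' : 'I_nJ) (t'' : 'I_nC) : int := fc0 t t' + t''%:Z.

Let fx t t' : R := (fi t)%:~R * ru + (fj t t')%:~R * r.
Let fy t t' : R := (fi t)%:~R * su + (fj t t')%:~R * s.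
Let fq t t' t'' : R := (fi t)%:~R * qu + (fj t t')%:~R * q' + (fc t t' t'')%:~R * q.

Let fi_bounds t : xx < (fi t)%:~R /\ (fi t)%:~R <= 5 / 4 * xx.
Proof.
have [h1 h2] := i0_bounds; have [h3 _] := nI_bounds.
have ht : (t%:R + 1 : R) <= nI%:R by rewrite natr1 ler_nat ltn_ord.
have t0 : 0 <= t%:R :> R by [].
rewrite /fi rmorphD /= -!pmulrn; lra.
Qed.

(** The n points of an arithmetic progression of step d that follow L stay below 2 L. *)
Lemma progression_bounds (z d L : R) (n m : nat) : 0 < d -> n%:R <= L / d ->
  (m < n)%N -> (Num.floor ((L - z) / d) + 1 + m%:Z)%:~R * d + z <= 2 * L /\
  L < (Num.floor ((L - z) / d) + 1 + m%:Z)%:~R * d + z.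
Proof.
move=> d0 hn hm.
have f1 : (Num.floor ((L - z) / d))%:~R <= (L - z) / d by exact: floor_le.
have f2 : (L - z) / d < (Num.floor ((L - z) / d) + 1)%:~R by exact: floorD1_gt.
have hm' : (m%:R + 1 : R) <= n%:R by rewrite natr1 ler_nat.
have m0 : 0 <= m%:R :> R by [].
move: f1 f2; move: (Num.floor _) => k; rewrite !rmorphD /= -!pmulrn.
rewrite ler_pdivlMr // ltr_pdivrMr // => f1 f2.
have hL : n%:R * d <= L by rewrite -ler_pdivlMr.
have h1 : (m%:R + 1) * d <= n%:R * d by rewrite ler_pM2r.
have h2 : 0 <= m%:R * d by rewrite mulr_ge0 // ltW.
lra.
Qed.

Let fx_bounds t t' : fx t t' <= 2 * Xp /\ Xp < fx t t'.
Proof.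
rewrite /fx addrC; apply: (@progression_bounds _ _ _ nJ) => //.
by have [] := nJ_bounds.
Qed.

Let fq_bounds t t' t'' : fq t t' t'' <= 2 * Qp /\ Qp < fq t t' t''.
Proof.
rewrite /fq addrC /fc /fc0 -[Qp - _ - _]addrA -opprD.
by apply: (@progression_bounds _ _ _ nC) => //; have [] := nC_bounds.
Qed.

Let fy_eq t t' : fy t t' * r = s * fx t t' + (fi t)%:~R * q.
Proof. by rewrite /fy /fx -Hdet; ring. Qed.

Let fy_bounds t t' : fy t t' <= 2 * Yp /\ Yp < fy t t'.
Proof.
have [x2 x1] := fx_bounds t t'; have [i1 i2] := fi_bounds t.
have e := fy_eq t t'.
have hx : xx * q = Yp * r by rewrite /xx; field; rewrite ?gt_eqF.
have j1 : xx * q < (fi t)%:~R * q by rewrite ltr_pM2r.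
have j2 : (fi t)%:~R * q <= 5 / 4 * xx * q by rewrite ler_pM2r.
case/andP: Hs => hs1 hs2; case/andP: Hr => hr1 hr2.
have p1 : 0 < s * fx t t' by rewrite mulr_gt0 //; apply: lt_trans x1.
have p2 : s * fx t t' <= (2 * Y) * (2 * Xp).
  by apply: ler_pM => //; rewrite ltW //; apply: lt_trans x1.
have p3 : (2 * Y) * (2 * Xp) <= Yp * X / 2.
  have p4 : 0 <= 64 * bp * Qp ^+ 2 * Xp by rewrite !mulr_ge0 // ?sqr_ge0 // ltW.
  have p5 : 0 <= Y * Xp by rewrite mulr_ge0 // ltW.
  move: N4; rewrite mulrDr mulrDl; lra.
have p6 : Yp * X <= Yp * r by rewrite ler_pM2l.
split.
  rewrite -(ler_pM2r r0) e; lra.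
rewrite -(ltr_pM2r r0) e; lra.
Qed.

(* If two children of a row have close second coordinates, the difference of their
   integer coordinates is a multiple of a reduced pair ab for which Dab is small.
   A child is bad if Dab is small for one of the finitely many possible pairs. *)
Let B := (Num.truncn (16 * Qp * Y / (Q * Yp))).+1.
Let tau : R := 32 * bp * Q * Qp ^+ 2.
Let nt := (Num.truncn (2 * (32 * bp * Qp ^+ 2 / Y))).+1.
Let seqab : seq (nat * int) :=
  [seq (a, b%:Z - (a * B)%N%:Z) | a <- iota 1 nJ, b <- iota 0 (2 * (a * B)).+1].
Let Dab (t : 'I_nI) (x : 'I_nJ * 'I_nC) (ab : nat * int) : R :=
  q * fy t x.1 * ab.2%:~R - ab.1%:R * (fq t x.1 x.2 * s - q' * fy t x.1).
Let badab (t : 'I_nI) (ab : nat * int) (x : 'I_nJ * 'I_nC) : bool :=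
  coprimez ab.1%:Z ab.2 && (`|Dab t x ab| < tau).
Let bad (t : 'I_nI) (x : 'I_nJ * 'I_nC) : bool := has (badab t ^~ x) seqab.

Let Dab_eq t x ab : Dab t x ab =
  q * s * ((ab.2 * fj t x.1 - ab.1%:Z * fc t x.1 x.2)%:~R
   - - ((fi t)%:~R * (q * ab.2%:~R * su - ab.1%:R * (qu * s - q' * su)) / (q * s))).
Proof.
rewrite /Dab /fy /fq rmorphB !rmorphM /= -pmulrn.
by field; rewrite !gt_eqF.
Qed.

(** Dab is affine in b j - a c, so card_cross applies. *)
Let card_badab t ab : (0 < ab.1)%N -> (#|badab t ab| <= (nJ %/ ab.1).+1 * nt)%N.
Proof.
move=> a0; case: (boolP (coprimez ab.1%:Z ab.2)) => cop; last first.
  rewrite (_ : #|_| = 0%N) //; apply: eq_card0 => x.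
  by rewrite unfold_in /badab (negPf cop).
apply: leq_trans (card_cross nC (fj0 t) (fc0 t)
  (- ((fi t)%:~R * (q * ab.2%:~R * su - ab.1%:R * (qu * s - q' * su)) / (q * s)))
  (32 * bp * Qp ^+ 2 / Y) a0 cop).
apply: subset_leq_card; apply/fintype.subsetP => x.
rewrite unfold_in /badab cop /= Dab_eq normrM inE => hD.
have qs0 : 0 < q * s by rewrite mulr_gt0.
rewrite -(ltr_pM2l qs0); move: hD; rewrite gtr0_norm // => /lt_le_trans; apply.
rewrite /tau; case/andP: Hq => hq _; case/andP: Hs => hs _.
have -> : 32 * bp * Q * Qp ^+ 2 = (32 * bp * Qp ^+ 2) * Q by ring.
have -> : q * s * (32 * bp * Qp ^+ 2 / Y) = (32 * bp * Qp ^+ 2) * (q * s / Y) by ring.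
apply: ler_wpM2l; first by rewrite !mulr_ge0 // ?sqr_ge0 // ltW.
by rewrite ler_pdivlMr //; apply: ler_pM => //; exact: ltW.
Qed.

Let card_bad t : (#|bad t| <= nJ * (3 * B * (2 * nJ) * nt))%N.
Proof.
apply: (@leq_trans (\sum_(ab <- seqab) #|badab t ab|)).
  exact: card_le_sum_has.
rewrite big_allpairs_dep /=.
have -> : (nJ * (3 * B * (2 * nJ) * nt) = \sum_(a <- iota 1 nJ) 3 * B * (2 * nJ) * nt)%N.
  by rewrite big_const_seq count_predT size_iota iter_addn_0 mulnC.
rewrite big_seq [leqRHS]big_seq; apply: leq_sum => a.
rewrite mem_iota add1n ltnS => /andP[a0 aJ].
apply: (@leq_trans (\sum_(b <- iota 0 (2 * (a * B)).+1) (nJ %/ a).+1 * nt)).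
  by apply: leq_sum => b _; exact: card_badab.
rewrite big_const_seq count_predT size_iota iter_addn_0.
exact: row_term_le.
Qed.

(** With the bound of card_bad, at most 1/16 of the children are bad, against a density
    1/8 of coprime pairs. *)
Let bad_density : (96 * nt * B * nJ)%N%:R <= nC%:R :> R.
Proof.
have hnt : nt%:R <= (64 * bp * Qp ^+ 2 + Y) / Y.
  rewrite /nt -natr1.
  have c0 : 0 <= 2 * (32 * bp * Qp ^+ 2 / Y).
    by rewrite mulr_ge0 // divr_ge0 ?ltW // !mulr_gt0 // exprn_gt0.
  have [+ _] := truncn_bounds c0.
  have -> : (64 * bp * Qp ^+ 2 + Y) / Y = 2 * (32 * bp * Qp ^+ 2 / Y) + 1.
    by field; rewrite gt_eqF.
  lra.
have hB : B%:R <= 32 * Qp * Y / (Q * Yp).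
  rewrite /B -natr1.
  have c0 : 0 <= 16 * Qp * Y / (Q * Yp) by rewrite divr_ge0 ?mulr_ge0 // ltW.
  have [h1 _] := truncn_bounds c0.
  have h2 : 1 <= 16 * Qp * Y / (Q * Yp).
    rewrite ler_pdivlMr ?mulr_gt0 // mul1r -mulrA.
    have : 0 < Qp * Y by rewrite mulr_gt0.
    by move: N2; move: (Q * Yp) (Qp * Y) => a b; lra.
  have -> : 32 * Qp * Y / (Q * Yp) = 2 * (16 * Qp * Y / (Q * Yp)) by ring.
  lra.
have hJ : nJ%:R <= Xp / X.
  have [h1 _] := nJ_bounds; apply: (le_trans h1).
  by case/andP: Hr => hr _; rewrite ler_pM2l // lef_pV2 ?posrE.
apply: le_trans nC_ge; rewrite !natrM.
apply: (@le_trans _ _ (96 * ((64 * bp * Qp ^+ 2 + Y) / Y) * (32 * Qp * Y / (Q * Yp)) * (Xp / X))).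
  do 3 (apply: ler_pM; rewrite ?mulr_ge0 //).
have -> : 96 * ((64 * bp * Qp ^+ 2 + Y) / Y) * (32 * Qp * Y / (Q * Yp)) * (Xp / X)
  = (12288 * (64 * bp * Qp ^+ 2 + Y) * Xp) * (Qp / (4 * Q * Yp * X)).
  by field; rewrite !gt_eqF.
have -> : Qp / (4 * Q) = Yp * X * (Qp / (4 * Q * Yp * X)) by field; rewrite !gt_eqF.
by apply: ler_wpM2r => //; rewrite divr_ge0 ?mulr_ge0 // ltW.
Qed.

Let idx : Type := ('I_nI * 'I_nJ * 'I_nC)%type.
Let ok (t : idx) : bool :=
  coprimez (fi t.1.1) (fj t.1.1 t.1.2) && ~~ bad t.1.1 (t.1.2, t.2).

Let card_ok : nI%:R * nJ%:R * nC%:R / 16 <= #|ok|%:R :> R.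
Proof.
pose cop (p : 'I_nI * 'I_nJ) := coprimez (fi p.1) (fj p.1 p.2).
pose C : {pred idx} := fun t => cop t.1.
pose D : {pred idx} := fun t => bad t.1.1 (t.1.2, t.2).
have hC : nI%:R * nJ%:R / 8 * nC%:R <= #|C|%:R :> R.
  have -> : #|C| = (#|cop| * nC)%N.
    rewrite -[nC in RHS]card_ord -cardX; apply: eq_card => t.
    by rewrite !unfold_in /= andbT.
  rewrite natrM; apply: ler_wpM2r => //.
  apply: (@card_coprime_ge R nI nJ i0 (i0 + nI)%N h fj0) => //.
  - apply: le_trans Nh.
    have h3 : (i0 + nI)%N%:R <= 2 * xx.
      by rewrite natrD; have [_ ?] := i0_bounds; have [? _] := nI_bounds; move: xx8; lra.
    have h4 : 0 < (i0 + nI)%N%:R :> R by rewrite ltr0n addn_gt0.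
    have h5 : (i0 + nI)%N%:R <= 4 * Yp * X / Q.
      apply: (le_trans h3); have -> : 4 * Yp * X / Q = 2 * (2 * Yp * X / Q) by ring.
      by rewrite ler_pM2l.
    by rewrite ler_ln ?posrE //; apply: lt_le_trans h5.
  - exact: le_trans nJ_ge.
  - exact: le_trans nI_ge.
  - rewrite natrD; have [_ h1] := i0_bounds; have [h2 h3] := nI_bounds; move: xx8; lra.
have hD : #|D|%:R <= nI%:R * nJ%:R * nC%:R / 16 :> R.
  have h1 : (#|D| <= nI * (nJ * (3 * B * (2 * nJ) * nt)))%N.
    pose P (t : 'I_nI) : pred idx := fun x => (x.1.1 == t) && D x.
    apply: (@leq_trans (\sum_(t <- enum 'I_nI) #|P t|)%N).
      apply: card_le_sum_has => x Dx; apply/hasP; exists x.1.1; first by rewrite mem_enum.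
      by rewrite /P eqxx.
    have -> : (nI * (nJ * (3 * B * (2 * nJ) * nt)) = \sum_(t <- enum 'I_nI) nJ * (3 * B * (2 * nJ) * nt))%N.
      by rewrite big_const_seq count_predT size_enum_ord iter_addn_0 mulnC.
    apply: leq_sum => t _; apply: leq_trans (card_bad t).
    pose f (x : idx) := (x.1.2, x.2).
    rewrite -(@card_in_imset _ _ f (P t)); last first.
      move=> [[x1 x2] x3] [[y1 y2] y3]; rewrite !unfold_in /P /f /=.
      by move=> /andP[/eqP -> _] /andP[/eqP -> _] [-> ->].
    apply: subset_leq_card; apply/fintype.subsetP => y /imsetP[x + ->].
    by rewrite !unfold_in /P /D /f => /andP[/eqP <-].
  have h2 : #|D|%:R <= (nI * (nJ * (3 * B * (2 * nJ) * nt)))%N%:R :> R by rewrite ler_nat.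
  apply: (le_trans h2).
  have -> : (nI * (nJ * (3 * B * (2 * nJ) * nt)))%N%:R = nI%:R * nJ%:R * ((96 * nt * B * nJ)%N%:R / 16) :> R.
    by rewrite !natrM; field.
  rewrite -[leRHS]mulrA; apply: ler_wpM2l; first by rewrite mulr_ge0.
  by rewrite ler_pM2r.
have hCD : (#|C| <= #|ok| + #|D|)%N.
  rewrite -(cardID D C) addnC leq_add //; apply: subset_leq_card; apply/fintype.subsetP => t.
    by rewrite !inE !unfold_in => /andP[? ?]; apply/andP.
  by rewrite !inE => /andP[].
have : #|C|%:R <= #|ok|%:R + #|D|%:R :> R by rewrite -natrD ler_nat.
lra.
Qed.

(** The auxiliary vector comes from a Bezout relation between the row and column. *)
Let mk (t : idx) : state R :=
  let e := egcdz (fi t.1.1) (fj t.1.1 t.1.2) in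
  (icomb 0 0 (-1) u w v, icomb e.2 (- e.1) 0 u w v,
   icomb (fi t.1.1) (fj t.1.1 t.1.2) (fc t.1.1 t.1.2 t.2) u w v).

Let tX (t : idx) : R := fx t.1.1 t.1.2 / (q * fq t.1.1 t.1.2 t.2).
Let tY (t : idx) : R := fy t.1.1 t.1.2 / (q * fq t.1.1 t.1.2 t.2).

Let fq0 t t' t'' : 0 < fq t t' t''.
Proof. by have [_] := fq_bounds t t' t''; apply: lt_trans. Qed.

Let posX_mk t : posX (mk t) = posX (w, u, v) + tX t.
Proof.
have n1 := fq0 t.1.1 t.1.2 t.2; rewrite /posX /tX /=.
have -> : fx t.1.1 t.1.2 = wedX v (mk t).2 by rewrite wedX_icomb.
rewrite /wedX /= -/(fq t.1.1 t.1.2 t.2) -/q.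
by field; rewrite !gt_eqF.
Qed.

Let posY_mk t : posY (mk t) = posY (w, u, v) + tY t.
Proof.
have n1 := fq0 t.1.1 t.1.2 t.2; rewrite /posY /tY /=.
have -> : fy t.1.1 t.1.2 = wedY v (mk t).2 by rewrite wedY_icomb.
rewrite /wedY /= -/(fq t.1.1 t.1.2 t.2) -/q.
by field; rewrite !gt_eqF.
Qed.

Let qfq_bounds (t : idx) : Q * Qp <= q * fq t.1.1 t.1.2 t.2.
Proof.
have [_ h1] := fq_bounds t.1.1 t.1.2 t.2; case/andP: Hq => hq _.
by apply: ler_pM => //; exact: ltW.
Qed.

Let tX_bounds t : 0 <= tX t <= 2 * Xp / (Q * Qp).
Proof.
have [x2 x1] := fx_bounds t.1.1 t.1.2; have := qfq_bounds t => hq.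
have QQ : 0 < Q * Qp by rewrite mulr_gt0.
have x0 : 0 <= fx t.1.1 t.1.2 by apply: ltW; apply: lt_trans x1.
rewrite /tX divr_ge0 //=; last by rewrite ltW // mulr_gt0.
apply: ler_pM => //; first by rewrite invr_ge0 ltW // mulr_gt0.
by rewrite lef_pV2 ?posrE // mulr_gt0.
Qed.

Let tY_bounds t : 0 <= tY t <= 2 * Yp / (Q * Qp).
Proof.
have [x2 x1] := fy_bounds t.1.1 t.1.2; have := qfq_bounds t => hq.
have QQ : 0 < Q * Qp by rewrite mulr_gt0.
have x0 : 0 <= fy t.1.1 t.1.2 by apply: ltW; apply: lt_trans x1.
rewrite /tY divr_ge0 //=; last by rewrite ltW // mulr_gt0.
apply: ler_pM => //; first by rewrite invr_ge0 ltW // mulr_gt0.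
by rewrite lef_pV2 ?posrE // mulr_gt0.
Qed.

Let good_mk t : ok t -> good Qp Xp Yp (mk t).
Proof.
case/andP => cop _; split => /=.
- by have [h1 /ltW ->] := fq_bounds t.1.1 t.1.2 t.2.
- by rewrite wedX_next; have [h1 /ltW h2] := fx_bounds t.1.1 t.1.2; apply/andP.
- by rewrite wedY_next; have [h1 /ltW h2] := fy_bounds t.1.1 t.1.2; apply/andP.
- have -> : 0%:~R * u.2 + 0%:~R * w.2 + (-1)%:~R * v.2 = - q by rewrite /q; ring.
  rewrite normrN gtr0_norm //; case/andP: Hq => _ /le_trans; apply.
  by rewrite ler_pM2l //; apply: le_trans N7; rewrite ler_peMl ?ler1n // ltW.
- rewrite det3_next; have [_ _ _ _ /= ->] := gst; rewrite mulr1.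
  case: egcdzP => x y /= e _; move/eqP: cop => e1.
  have -> : y * fj t.1.1 t.1.2 - - x * fi t.1.1 = 1 by rewrite -[RHS]e1 -e; ring.
  by [].
Qed.

Let tau_ge z z' : z <= 2 * Qp -> z' <= 2 * Qp -> 0 < z -> 0 < z' ->
  4 * bp * (q * z * z') <= tau.
Proof.
move=> h1 h2 z0 z'0; rewrite /tau.
have -> : 32 * bp * Q * Qp ^+ 2 = 4 * bp * (2 * Q * (2 * Qp) * (2 * Qp)) by ring.
apply: ler_wpM2l; first by rewrite mulr_ge0 // ltW.
case/andP: Hq => _ hq.
exact: ler_pM3.
Qed.

(** A difference of positions, multiplied by the denominators, is a cross product. *)
Let cross_small (t t' : idx) : `|tY t - tY t'| < 4 * bp ->
  `|fy t.1.1 t.1.2 * fq t'.1.1 t'.1.2 t'.2 -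
    fy t'.1.1 t'.1.2 * fq t.1.1 t.1.2 t.2| < tau.
Proof.
have [h1 _] := fq_bounds t.1.1 t.1.2 t.2; have p1 := fq0 t.1.1 t.1.2 t.2.
have [h2 _] := fq_bounds t'.1.1 t'.1.2 t'.2; have p2 := fq0 t'.1.1 t'.1.2 t'.2.
rewrite /tY => hh; apply: lt_le_trans (tau_ge h1 h2 p1 p2).
move: hh h1 p1 h2 p2.
move: (fy t.1.1 t.1.2) (fy t'.1.1 t'.1.2) (fq t.1.1 t.1.2 t.2)
  (fq t'.1.1 t'.1.2 t'.2) => y y' z z' hh h1 p1 h2 p2.
have -> : y * z' - y' * z = (y / (q * z) - y' / (q * z')) * (q * z * z').
  by field; rewrite !gt_eqF.
have p : 0 < q * z * z' by rewrite !mulr_gt0.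
by rewrite normrM [X in _ * X]gtr0_norm // ltr_pM2r.
Qed.

(** The cross product of two children of a row is g times Dab for the reduced pair
    ab of their difference, so Dab is small as well; smallness of Dab also bounds b
    by a B, which puts ab in the finite list. *)
Let bad_of_close t (x x' : 'I_nJ * 'I_nC) : (x.1 < x'.1)%N ->
  `|fy t x.1 * fq t x'.1 x'.2 - fy t x'.1 * fq t x.1 x.2| < tau -> bad t x.
Proof.
move=> lt hD.
pose dj := (x'.1 - x.1)%N; pose dc := fc t x'.1 x'.2 - fc t x.1 x.2.
have dj0 : (0 < dj)%N by rewrite subn_gt0.
have hdj : (fj t x'.1) = fj t x.1 + dj%:Z.
  by rewrite /fj /dj -subzn ?(ltnW lt) //; ring.
have hdc : fc t x'.1 x'.2 = fc t x.1 x.2 + dc by rewrite /dc; ring.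
have [a [b [g [a0 g0 cop ea eb]]]] := reduce_pair dc dj0.
have eD : fy t x.1 * fq t x'.1 x'.2 - fy t x'.1 * fq t x.1 x.2 = Dab t x (a, b) * g%:R.
  have dj_R : (dj%:Z)%:~R = a%:R * g%:R :> R by rewrite -pmulrn ea natrM.
  have dc_R : dc%:~R = b%:~R * g%:R :> R by rewrite eb rmorphM.
  rewrite /Dab /= /fq /fy hdj hdc !(intrD _ (fj t x.1)) !(intrD _ (fc t x.1 x.2)).
  by rewrite dj_R dc_R; ring.
have g1 : 1 <= g%:R :> R by rewrite ler1n.
have hab : `|Dab t x (a, b)| < tau.
  apply: le_lt_trans hD; rewrite eD normrM (@ger0_norm _ g%:R) // ler_peMr //.
have [y2 y1] := fy_bounds t x.1; have [z2 z1] := fq_bounds t x.1 x.2.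
have a1 : 1 <= a%:R :> R by rewrite ler1n.
have tau8 : tau <= 8 * Qp * Y.
  rewrite /tau; have -> : 32 * bp * Q * Qp ^+ 2 = 8 * Qp * (4 * bp * Qp * Q) by ring.
  by apply: ler_wpM2l => //; rewrite mulr_ge0 // ltW.
have hz : `|fq t x.1 x.2 * s - q' * fy t x.1| <= 8 * Qp * Y.
  apply: (le_trans (ler_normB _ _)); rewrite !normrM.
  have h1 : `|fq t x.1 x.2| * `|s| <= (2 * Qp) * (2 * Y).
    rewrite !gtr0_norm //; case/andP: Hs => _ hs; apply: ler_pM => //; exact: ltW.
  have h2 : `|q'| * `|fy t x.1| <= (2 * Q) * (2 * Yp).
    have y0 : 0 < fy t x.1 by apply: lt_trans y1.
    by rewrite (gtr0_norm y0); apply: ler_pM => //; exact: ltW.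
  have e1 : 2 * Qp * (2 * Y) = 4 * (Qp * Y) by ring.
  have e2 : 2 * Q * (2 * Yp) = 4 * (Q * Yp) by ring.
  have e3 : 8 * Qp * Y = 8 * (Qp * Y) by ring.
  by move: N2 h1 h2; rewrite e1 e2 e3; lra.
have hb : `|b%:~R| < (a * B)%N%:R :> R.
  have QY : 0 < Q * Yp by rewrite mulr_gt0.
  have qy : Q * Yp <= q * fy t x.1.
    by case/andP: Hq => hq _; apply: ler_pM => //; exact: ltW.
  have qy0 : 0 < q * fy t x.1 by exact: lt_le_trans qy.
  have e : q * fy t x.1 * b%:~R = Dab t x (a, b) + a%:R * (fq t x.1 x.2 * s - q' * fy t x.1).
    by rewrite /Dab /=; ring.
  have h1 : q * fy t x.1 * `|b%:~R| < a%:R * (16 * Qp * Y).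
    rewrite -(gtr0_norm qy0) -normrM e; apply: (le_lt_trans (ler_normD _ _)).
    rewrite normrM (ger0_norm (ler0n _ _)).
    have h2 : a%:R * `|fq t x.1 x.2 * s - q' * fy t x.1| <= a%:R * (8 * Qp * Y).
      by apply: ler_wpM2l.
    have h3 : 8 * Qp * Y <= a%:R * (8 * Qp * Y).
      by rewrite ler_peMl // !mulr_ge0 // ltW.
    have -> : a%:R * (16 * Qp * Y) = a%:R * (8 * Qp * Y) + a%:R * (8 * Qp * Y) by ring.
    apply: ltr_leD => //; apply: lt_le_trans hab _; exact: le_trans h3.
  have c0 : 0 <= 16 * Qp * Y / (Q * Yp) by rewrite divr_ge0 ?mulr_ge0 // ltW.
  have [_] := truncn_bounds c0; rewrite natr1 -/B ltr_pdivrMr // => hB.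
  rewrite natrM -(ltr_pM2l QY).
  apply: (@le_lt_trans _ _ (q * fy t x.1 * `|b%:~R|)); first exact: ler_wpM2r.
  apply: (lt_le_trans h1); have -> : Q * Yp * (a%:R * B%:R) = a%:R * (B%:R * (Q * Yp)) by ring.
  by apply: ler_wpM2l => //; exact: ltW.
apply/hasP; exists (a, b); last by rewrite /badab /= cop.
apply/allpairsPdep; exists a, (absz (b + (a * B)%N%:Z)); split.
- rewrite mem_iota a0 add1n ltnS /=.
  apply: (@leq_trans dj); first by rewrite ea leq_pmulr.
  by rewrite (leq_trans (leq_subr _ _)) // ltnW.
- by rewrite mem_iota /= add0n; have [] := offset_range (absz_lt hb).
- by congr pair; have [_ ->] := offset_range (absz_lt hb).
Qed.

(** Different columns: bad_of_close. Same column: the difference of the positions is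
    explicit and at least Yp / (2 Qp)^2. *)
Let row_separation (t t' : idx) : ok t -> ok t' -> t.1.1 = t'.1.1 ->
  `|tY t - tY t'| < 4 * bp -> t = t'.
Proof.
move=> okt okt' e hY; have := cross_small hY.
case: t t' okt okt' e hY => [[i j] c] [[i' j'] c'] /andP[_ nb] /andP[_ nb'] /= e.
subst i'; move=> hY hc.
case: (ltngtP j j') => [lt|lt|ej].
- by move: nb; rewrite (bad_of_close (x := (j, c)) (x' := (j', c')) lt hc).
- move: nb'; rewrite (bad_of_close (x := (j', c')) (x' := (j, c)) lt) //.
  by rewrite distrC.
- have ej' : j = j' by apply: val_inj.
  subst j'; congr pair; apply: val_inj => /=.
  have [y2 y1] := fy_bounds i j.
  have eD : fy i j * fq i j c' - fy i j * fq i j c = q * fy i j * (c'%:Z - c%:Z)%:~R.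
    by rewrite /fq /fc !rmorphD /= rmorphN /=; ring.
  case: (eqVneq (c' : nat) (c : nat)) => [//|nc]; exfalso.
  move: hY; rewrite /tY /= => hY.
  have f1 := fq0 i j c; have f2 := fq0 i j c'.
  have [g1 _] := fq_bounds i j c; have [g2 _] := fq_bounds i j c'.
  have e1 : fy i j / (q * fq i j c) - fy i j / (q * fq i j c') =
    (fy i j * (c'%:Z - c%:Z)%:~R) / (fq i j c * fq i j c').
    rewrite (_ : fy i j / (q * fq i j c) - fy i j / (q * fq i j c') =
      (fy i j * fq i j c' - fy i j * fq i j c) / (q * fq i j c * fq i j c')).
      by rewrite eD; field; rewrite !gt_eqF.
    by field; rewrite !gt_eqF.
  move: hY; rewrite e1 normrM [X in _ * X]gtr0_norm; last by rewrite invr_gt0 mulr_gt0.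
  rewrite ltr_pdivrMr ?mulr_gt0 // normrM.
  have c1 : 1 <= `|(c'%:Z - c%:Z)%:~R| :> R.
    by apply: absz_ge1; move: nc; clear; lia.
  have y0 : 0 < fy i j by apply: lt_trans y1.
  rewrite (gtr0_norm y0); apply/negP; rewrite -leNgt.
  apply: (@le_trans _ _ Yp).
    apply: le_trans (ltW N9).
    have -> : 16 * bp * Qp ^+ 2 = 4 * bp * (2 * Qp * (2 * Qp)) by ring.
    apply: ler_wpM2l; first by rewrite mulr_ge0 // ltW.
    by apply: ler_pM => //; exact: ltW.
  by apply: (le_trans (ltW y1)); rewrite ler_peMr // ltW.
Qed.

(** For rows i, i' the determinant of the two displacements is an integer
    i' j - i j' divided by a product of denominators. If it is zero, the coprime pairs
    (i, j) and (i', j') agree and row_separation applies. Otherwise it is at least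
    1 / (8 Q Qp^2), more than two displacements as close as this can produce. *)
Let box_separation (t t' : idx) : ok t -> ok t' ->
  `|tX t - tX t'| < 4 * ap -> `|tY t - tY t'| < 4 * bp -> t = t'.
Proof.
move=> okt okt' hX hY; apply: row_separation => //.
have /andP[cop _] := okt; have /andP[cop' _] := okt'.
have [i1 i2] := fi_bounds t.1.1; have [i1' i2'] := fi_bounds t'.1.1.
have ip : 0 < fi t.1.1 by rewrite -(ltr_int R); apply: lt_trans i1.
have ip' : 0 < fi t'.1.1 by rewrite -(ltr_int R); apply: lt_trans i1'.
have inj : fi t.1.1 = fi t'.1.1 -> t.1.1 = t'.1.1.
  by rewrite /fi => /addrI [] /val_inj.
case: (eqVneq (fi t.1.1 * fj t'.1.1 t'.1.2) (fi t'.1.1 * fj t.1.1 t.1.2)) => [e|ne].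
  by apply: inj; have [] := coprime_cross ip ip' cop cop' e.
exfalso.
have /andP[Y1 Y2] := tY_bounds t'; have /andP[X1 X2] := tX_bounds t'.
have f1 := fq0 t.1.1 t.1.2 t.2; have f2 := fq0 t'.1.1 t'.1.2 t'.2.
have [g1 _] := fq_bounds t.1.1 t.1.2 t.2; have [g2 _] := fq_bounds t'.1.1 t'.1.2 t'.2.
have eD : tX t * tY t' - tX t' * tY t =
  (fi t'.1.1 * fj t.1.1 t.1.2 - fi t.1.1 * fj t'.1.1 t'.1.2)%:~R /
  (q * fq t.1.1 t.1.2 t.2 * fq t'.1.1 t'.1.2 t'.2).
  rewrite (_ : tX t * tY t' - tX t' * tY t =
    (fx t.1.1 t.1.2 * fy t'.1.1 t'.1.2 - fx t'.1.1 t'.1.2 * fy t.1.1 t.1.2)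
    / (q * q * fq t.1.1 t.1.2 t.2 * fq t'.1.1 t'.1.2 t'.2)); last first.
    by rewrite /tX /tY; field; rewrite !gt_eqF.
  rewrite (_ : fx t.1.1 t.1.2 * fy t'.1.1 t'.1.2 - fx t'.1.1 t'.1.2 * fy t.1.1 t.1.2 =
    q * (fi t'.1.1 * fj t.1.1 t.1.2 - fi t.1.1 * fj t'.1.1 t'.1.2)%:~R); last first.
    by rewrite -[in RHS]Hdet /fx /fy rmorphB !rmorphM /=; ring.
  by field; rewrite !gt_eqF.
have hD1 : 1 / (8 * Q * Qp ^+ 2) <= `|tX t * tY t' - tX t' * tY t|.
  rewrite eD normrM [X in _ <= _ * X]gtr0_norm; last by rewrite invr_gt0 !mulr_gt0.
  apply: ler_pM => //.
    by rewrite invr_ge0 !mulr_ge0 // ?sqr_ge0 // ltW.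
    by apply: absz_ge1; rewrite subr_eq0 eq_sym.
  rewrite lef_pV2 ?posrE ?mulr_gt0 ?exprn_gt0 //.
  have -> : 8 * Q * Qp ^+ 2 = 2 * Q * (2 * Qp) * (2 * Qp) by ring.
  by case/andP: Hq => _ hq; apply: ler_pM3.
have hD2 : `|tX t * tY t' - tX t' * tY t| <=
    4 * ap * (2 * Yp / (Q * Qp)) + 2 * Xp / (Q * Qp) * (4 * bp).
  rewrite (_ : _ - _ = (tX t - tX t') * tY t' - tX t' * (tY t - tY t')); last by ring.
  apply: (le_trans (ler_normB _ _)).
  rewrite (normrM (tX t - tX t')) (normrM (tX t')) (ger0_norm Y1) (ger0_norm X1).
  by apply: lerD; apply: ler_pM => //; exact: ltW.
have := le_trans hD1 hD2; apply/negP; rewrite -ltNge.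
rewrite (_ : 4 * ap * (2 * Yp / (Q * Qp)) + 2 * Xp / (Q * Qp) * (4 * bp) =
  (64 * Qp * (ap * Yp + bp * Xp)) / (8 * Q * Qp ^+ 2)); last first.
  by field; rewrite !gt_eqF.
by rewrite ltr_pM2r // invr_gt0 !mulr_gt0 // exprn_gt0.
Qed.

Let count_mk (p : pred (state R)) :
  count p [seq mk t | t <- enum ok] = #|[pred t | ok t && p (mk t)]|.
Proof.
rewrite count_map -sum1_count big_enum_cond /= sum1_card.
by apply: eq_card => t; rewrite !unfold_in.
Qed.

Let size_mk : size [seq mk t | t <- enum ok] = #|ok|.
Proof. by rewrite size_map -cardE. Qed.

Let hits_close (xi eta rho : R) t t' : rho < bp ->
  hits ap bp xi eta rho (mk t) -> hits ap bp xi eta rho (mk t') ->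
  `|tY t - tY t'| < 4 * bp /\ (rho < ap -> `|tX t - tX t'| < 4 * ap).
Proof.
move=> hb /andP[h1 h2] /andP[h1' h2'].
have eX : tX t - tX t' = (posX (mk t) - xi) - (posX (mk t') - xi).
  by rewrite !posX_mk; ring.
have eY : tY t - tY t' = (posY (mk t) - eta) - (posY (mk t') - eta).
  by rewrite !posY_mk; ring.
rewrite eX eY; split=> [|ha].
  by apply: le_lt_trans (ler_normB _ _) _; move: h2 h2' hb; lra.
by apply: le_lt_trans (ler_normB _ _) _; move: h1 h1' ha; lra.
Qed.

Let nI_gt0 : 0 < nI%:R :> R.
Proof. by apply: lt_le_trans nI_ge; rewrite divr_gt0 ?mulr_gt0. Qed.
Let nJ_gt0 : 0 < nJ%:R :> R.
Proof. by apply: lt_le_trans nJ_ge; rewrite divr_gt0 ?mulr_gt0. Qed.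
Let nC_gt0 : 0 < nC%:R :> R.
Proof. by apply: lt_le_trans nC_ge; rewrite divr_gt0 ?mulr_gt0. Qed.

(** There are at least nI nJ nC / 16 children. A square of radius less than bp meets at
    most one child in each of the nI rows, and a square of radius less than ap meets
    at most one child altogether; the two fractions follow. *)
Lemma exists_children : exists cs : seq (state R),
  [/\ (0 < size cs)%N,
      forall c, c \in cs -> [/\ good Qp Xp Yp c, child_of (w, u, v) c,
        0 <= posX c - posX (w, u, v) <= 2 * Xp / (Q * Qp) &
        0 <= posY c - posY (w, u, v) <= 2 * Yp / (Q * Qp)],
      forall xi eta rho, rho < bp ->
        (count (hits ap bp xi eta rho) cs)%:R <=
        256 * Q * X / (Xp * Qp) * (size cs)%:R &
      forall xi eta rho, rho < ap -> rho < bp ->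
        (count (hits ap bp xi eta rho) cs)%:R <=
        4096 * Q ^+ 2 / (Yp * Xp * Qp) * (size cs)%:R].
Proof.
exists [seq mk t | t <- enum ok]; rewrite size_mk.
have ok_gt0 : 0 < #|ok|%:R :> R.
  by apply: lt_le_trans card_ok; rewrite divr_gt0 // !mulr_gt0.
split.
- by move: ok_gt0; rewrite ltr0n.
- move=> c /mapP[t]; rewrite mem_enum => okt ->; split.
  + exact: good_mk.
  + by do 5 eexists.
  + by rewrite posX_mk addrC addKr.
  + by rewrite posY_mk addrC addKr.
- move=> xi eta rho hb; rewrite count_mk.
  apply: (@le_trans _ _ nI%:R).
    rewrite ler_nat -[leqRHS]card_ord.
    apply: (@leq_card_in _ _ (fun t : idx => t.1.1)) => t t'; rewrite !inE.
    move=> /andP[okt ht] /andP[okt' ht'] e.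
    by apply: row_separation => //; have [] := hits_close hb ht ht'.
  have hp : 0 < 256 * Q * X / (Xp * Qp).
    by rewrite -(mulrA 256); apply: frac_gt0; rewrite // mulr_gt0.
  apply: (@le_trans _ _ (256 * Q * X / (Xp * Qp) * (nI%:R * nJ%:R * nC%:R / 16))); last first.
    by rewrite ler_pM2l.
  rewrite (_ : 256 * Q * X / (Xp * Qp) * (nI%:R * nJ%:R * nC%:R / 16) =
    nI%:R * (nJ%:R * nC%:R / ((Xp / (4 * X)) * (Qp / (4 * Q))))); last first.
    by field; rewrite !gt_eqF.
  rewrite ler_peMr // ler_pdivlMr ?mul1r; first by apply: ler_pM; rewrite ?divr_ge0 ?mulr_ge0 // ltW.
  by rewrite mulr_gt0 // divr_gt0 ?mulr_gt0.
- move=> xi eta rho ha hb; rewrite count_mk.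
  apply: (@le_trans _ _ 1).
    rewrite (ler_nat R _ 1); apply/card_le1P => t; rewrite inE => /andP[okt ht] t'.
    rewrite !inE; apply/andP/eqP => [[okt' ht']|->//].
    have [hY /(_ ha) hX] := hits_close hb ht ht'.
    by apply/esym; apply: box_separation.
  have hp : 0 < 4096 * Q ^+ 2 / (Yp * Xp * Qp).
    by apply: frac_gt0; rewrite ?exprn_gt0 ?mulr_gt0.
  apply: (@le_trans _ _ (4096 * Q ^+ 2 / (Yp * Xp * Qp) * (nI%:R * nJ%:R * nC%:R / 16))); last first.
    by rewrite ler_pM2l.
  rewrite (_ : 4096 * Q ^+ 2 / (Yp * Xp * Qp) * (nI%:R * nJ%:R * nC%:R / 16) =
    (nI%:R * nJ%:R * nC%:R / ((Yp * X / (16 * Q)) * (Xp / (4 * X)) * (Qp / (4 * Q))))); last first.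
    by field; rewrite !gt_eqF.
  rewrite ler_pdivlMr ?mul1r; first by apply: ler_pM3; rewrite ?divr_gt0 ?mulr_gt0.
  by rewrite !(mulr_gt0, invr_gt0).
Qed.

End steps.

(** * Descent along a branch, and slicing *)

Section descent.
Variables (R : realType) (T : eqType).
Variables (ok : nat -> T -> Prop) (rel : nat -> T -> T -> Prop).
Variable F : nat -> T -> nat -> \bar R.
Hypothesis F0 : forall k x i, (0 <= F k x i)%E.
Hypothesis step : forall k x, ok k x -> exists cs : seq T,
  [/\ (0 < size cs)%N, forall c, c \in cs -> ok k.+1 c /\ rel k x c &
      forall i, (\sum_(c <- cs) F k.+1 c i <= (size cs)%:R%:E * F k x i)%E].

(** Averaging: the sums over the children add up to at most the number of children
    times the sum at x. *)
Lemma descent_step k x : ok k x -> (\sum_(i <oo) F k x i < 1)%E ->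
  exists c, [/\ ok k.+1 c, rel k x c & (\sum_(i <oo) F k.+1 c i < 1)%E].
Proof.
move=> okx hlt; have [cs [cs0 hcs hF]] := step okx.
apply: contrapT => nex.
have h1 c : c \in cs -> (1 <= \sum_(i <oo) F k.+1 c i)%E.
  move=> ccs; rewrite leNgt; apply/negP => hc; apply: nex.
  by exists c; have [? ?] := hcs _ ccs.
have h2 : ((size cs)%:R%:E <= \sum_(c <- cs) \sum_(i <oo) F k.+1 c i :> \bar R)%E.
  rewrite -sum1_size natr_sum -sumEFin big_seq [leRHS]big_seq.
  by apply: lee_sum => c; exact: h1.
have h3 : (\sum_(c <- cs) \sum_(i <oo) F k.+1 c i <=
    (size cs)%:R%:E * \sum_(i <oo) F k x i)%E.
  rewrite -nneseries_sum // -nneseriesZl //; apply: lee_nneseries => // i _ _.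
  by rewrite sume_ge0.
have := le_trans h2 h3; apply/negP; rewrite -ltNge.
by rewrite -[ltRHS]mule1 lte_pmul2l // lte_fin ltr0n.
Qed.

Lemma descent x0 : ok 0%N x0 -> (\sum_(i <oo) F 0%N x0 i < 1)%E ->
  exists f : nat -> T, f 0%N = x0 /\
    forall k, [/\ ok k (f k), rel k (f k) (f k.+1) &
                  (\sum_(i <oo) F k (f k) i < 1)%E].
Proof.
move=> ok0 lt0.
pose A (p : nat * T) := ok p.1 p.2 /\ (\sum_(i <oo) F p.1 p.2 i < 1)%E.
pose S := {p | A p}.
pose Rl (s s' : S) := (sval s').1 = (sval s).1.+1 /\ rel (sval s).1 (sval s).2 (sval s').2.
have hs (s : S) : {s' : S | Rl s s'}.
  apply: cid; case: s => [[k x] [/= okx hx]].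
  have [c [okc xc hc]] := descent_step okx hx.
  by exists (exist A (k.+1, c) (conj okc hc)).
have [f [f0 fS]] := dependent_choice hs (exist A (0%N, x0) (conj ok0 lt0)).
have fk k : (sval (f k)).1 = k.
  by elim: k => [|k IH]; [rewrite f0 | have [-> _] := fS k; rewrite IH].
exists (fun k => (sval (f k)).2); split; first by rewrite f0.
move=> k; have [+ +] := svalP (f k); rewrite fk => h1 h2.
by have [_] := fS k; rewrite fk.
Qed.

End descent.

Section slicing.
Variable R : realType.

(** Integrate the hypothesis over [lo, hi]; the interval around t i has length
    2 rho i. *)
Lemma slice1 (lo hi m : R) (t rho f : nat -> R) :
  lo <= hi -> (forall i, 0 <= rho i) -> (forall i, 0 <= f i) ->
  (forall x, lo <= x <= hi ->
    (m%:E <= \sum_(i <oo) (if `|x - t i| <= rho i then f i else 0)%:E)%E) ->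
  ((m * (hi - lo))%:E <= \sum_(i <oo) (2 * rho i * f i)%:E)%E.
Proof.
move=> lohi rho0 f0 hm.
have [m0|m0] := leP m 0.
  apply: (@le_trans _ _ 0%E); first by rewrite lee_fin mulr_le0_ge0 // subr_ge0.
  by apply: nneseries_ge0 => i _ _; rewrite lee_fin !mulr_ge0.
pose D : set R := `[lo, hi]%classic.
pose J i : set R := `[t i - rho i, t i + rho i]%classic.
pose g i (x : measurableTypeR R) : \bar (Real.sort R) := (f i * \1_(J i) x)%:E.
have JP i x : J i x <-> t i - rho i <= x <= t i + rho i.
  by change (x \in `[t i - rho i, t i + rho i] <-> t i - rho i <= x <= t i + rho i); rewrite in_itv.
have gE i x : g i x = (if `|x - t i| <= rho i then f i else 0)%:E.
  rewrite /g indicE; case: ifPn => h.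
    rewrite mem_set ?mulr1 //; apply/JP.
  by move: h; rewrite ler_norml => /andP[h1 h2]; apply/andP; split; lra.
rewrite memNset ?mulr0 // => /JP /andP[h1 h2]; move/negP: h; apply.
by rewrite ler_norml; apply/andP; split; lra.
have mD : measurable D by exact: measurable_itv.
have mJ i : measurable (J i) by exact: measurable_itv.
have mg i : measurable_fun D (g i).
  apply/measurable_EFinP; apply: measurable_funM => //.
have g0 i x : D x -> (0 <= g i x)%E.
  by move=> _; rewrite /g lee_fin mulr_ge0.
have muD : lebesgue_measure D = (hi - lo)%:E :> \bar R.
  rewrite /D lebesgue_measure_itv /= lte_fin; case: ltP => [_|h]; first by rewrite EFinB.
  by rewrite (le_anti (introT andP (conj lohi h))) subrr.
have -> : (m * (hi - lo))%:E = (\int[lebesgue_measure]_(x in D) (cst m%:E x))%E.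
  by rewrite integral_cst // EFinM; congr (_ * _)%E; exact/esym/muD.
apply: (@le_trans _ _ (\int[lebesgue_measure]_(x in D) (\sum_(i <oo) g i x))%E).
  apply: ge0_le_integral => //.
  - by move=> x _; rewrite lee_fin ltW.
  - have := @ge0_emeasurable_sum _ _ _ D g predT (fun k x Dx _ => g0 k x Dx) (fun k _ => mg k).
    by under eq_fun do under eq_eseriesl do rewrite inE.
  - move=> x; change (x \in `[lo, hi] -> (cst m%:E x <= \sum_(i <oo) g i x)%E).
    rewrite in_itv /= => hx; apply: (le_trans (hm x hx)).
    by rewrite (eq_eseriesr (fun i _ => gE i x)).
rewrite integral_nneseries //; apply: lee_nneseries => [i _ _|i _].
  by apply: integral_ge0 => x Dx; exact: g0.
have -> : (\int[lebesgue_measure]_(x in D) g i x = (f i)%:E * \int[lebesgue_measure]_(x in D) (\1_(J i) x)%:E)%E.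
  rewrite -ge0_integralZl_EFin //.
  by apply/measurable_EFinP; apply: (@measurable_indic _ _ R D (J i) (mJ i)).
have -> : (2 * rho i * f i)%:E = ((f i)%:E * (2 * rho i)%:E)%E by rewrite -EFinM mulrC.
rewrite integral_indic //; last exact: mJ.
apply: lee_wpmul2l; first by rewrite lee_fin.
apply: (@le_trans _ _ (lebesgue_measure (J i))).
  apply: (le_measure lebesgue_measure); rewrite ?inE //; last exact: mJ.
  by apply: measurableI => //; exact: mJ.
rewrite /J lebesgue_measure_itv /= lte_fin; case: ifP => _; last by rewrite lee_fin mulr_ge0.
by rewrite -EFinB lee_fin; lra.
Qed.

(** Fubini by hand: one coordinate at a time, which avoids product measures. The
    functions x and t i have infinitely many coordinates, of which the first n
    matter. *)
Lemma slices (n : nat) (d m : R) (t : nat -> nat -> R) (rho f : nat -> R) :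
  0 <= d -> (forall i, 0 <= rho i) -> (forall i, 0 <= f i) ->
  (forall x : nat -> R, (forall j, 0 <= x j <= d) ->
    (m%:E <= \sum_(i <oo) (if all (fun j => `|x j - t i j| <= rho i) (iota 0 n)
                           then f i else 0)%:E)%E) ->
  ((m * d ^+ n)%:E <= \sum_(i <oo) ((2 * rho i) ^+ n * f i)%:E)%E.
Proof.
move=> d0 rho0; elim: n f => [|n IH] f f0 hm.
  have h := hm (fun=> 0) (fun j => introT andP (conj (lexx 0) d0)).
  rewrite expr0 mulr1; apply: (le_trans h); apply: lee_nneseries => [i _ _|i _] /=; first by rewrite lee_fin.
  by rewrite expr0 mul1r.
have -> : m * d ^+ n.+1 = m * d ^+ n * (d - 0) by rewrite subr0 exprSr mulrA.
rewrite (eq_eseriesr (g := fun i => (2 * rho i * ((2 * rho i) ^+ n * f i))%:E)); last first.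
  by move=> i _; rewrite exprS mulrA.
apply: (@slice1 0 d _ (t^~ n)) => //.
  by move=> i; rewrite mulr_ge0 // exprn_ge0 // mulr_ge0.
move=> c hc.
rewrite (eq_eseriesr (g := fun i => ((2 * rho i) ^+ n *
   (if `|c - t i n| <= rho i then f i else 0))%:E)); last first.
  by move=> i _; case: ifP; rewrite ?mulr0.
apply: IH => [i|x hx]; first by case: ifP.
pose x' j := if j == n then c else x j.
have hx' j : 0 <= x' j <= d by rewrite /x'; case: eqP.
apply: (le_trans (hm x' hx')); apply: lee_nneseries => [i _ _|i _].
  by rewrite lee_fin; case: ifP.
have e : x' n = c by rewrite /x' eqxx.
have -> : iota 0 n.+1 = iota 0 n ++ [:: n] by rewrite -addn1 iotaD.
rewrite lee_fin all_cat /= andbT e.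
have -> : all (fun j => `|x' j - t i j| <= rho i) (iota 0 n) =
          all (fun j => `|x j - t i j| <= rho i) (iota 0 n).
  apply: eq_in_all => j; rewrite mem_iota /= add0n => jn.
  by rewrite /x' ltn_eqF.
by case: (all _ _); rewrite /= ?lexx.
Qed.

End slicing.

(** * The scales and their numerical relations *)

Section scales.
Variables (R : realType) (w e d : R).
Hypotheses (w0 : 0 < w) (e0 : 0 < e) (d1 : d <= 1)
  (he : 40 * e <= d) (hw : 8 * e <= w) (hww : e <= 1 - w - w).

Let c : R := w * e ^+ 2 / 2.

(** Scales at time t: the denominator is exp t, and the wedge products have exponents
    slightly below w and 1 - w. The loss e^2 is what makes vectors tend to zero. *)
Definition scQ (t : R) : R := expR t.
Definition scX (t : R) : R := expR ((w - e ^+ 2) * t).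
Definition scY (t : R) : R := expR ((1 - w - e ^+ 2) * t).
(** Half-sides of the box around a node at time t. The displacement of a child is at
    most half of this, and the boxes of the next level are at most half as large, so
    that the displacements of all descendants add up to less. *)
Definition bxX (t : R) : R :=
  4 * scX ((1 + e) * t) / (scQ t * scQ ((1 + e) * t)).
Definition bxY (t : R) : R :=
  4 * scY ((1 + e) * t) / (scQ t * scQ ((1 + e) * t)).

Lemma bxXE t : bxX t = 4 * expR ((w - e ^+ 2) * ((1 + e) * t) - t - (1 + e) * t).
Proof. by rewrite /bxX /scX /scQ -expRD -mulrA -expRN -expRD; congr (_ * expR _); ring. Qed.

Lemma bxYE t : bxY t = 4 * expR ((1 - w - e ^+ 2) * ((1 + e) * t) - t - (1 + e) * t).
Proof. by rewrite /bxY /scY /scQ -expRD -mulrA -expRN -expRD; congr (_ * expR _); ring. Qed.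

Lemma bxX_gt0 t : 0 < bxX t. Proof. by rewrite bxXE mulr_gt0 ?expR_gt0. Qed.
Lemma bxY_gt0 t : 0 < bxY t. Proof. by rewrite bxYE mulr_gt0 ?expR_gt0. Qed.

Lemma e_lt : 16 * e <= 1.
Proof. by move: hw hww e0; lra. Qed.

Variable t : R.
Hypotheses (t0 : 0 < t) (Lbig : 4096 * (1 + t) <= expR (c * t)).

Let L := expR (c * t).

Let L4096 : 4096 <= L.
Proof. by rewrite /L; move: Lbig t0; move: (expR _) => l; lra. Qed.

(** Constants are absorbed by a difference c t of the exponents; exp_gap2 does the same
    for larger constants. *)
Lemma exp_gap1 (u v C : R) : u + c * t <= v -> 0 <= C -> C <= L ->
  C * expR u <= expR v.
Proof.
move=> h C0 hC; apply: (@le_trans _ _ (L * expR u)).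
  by rewrite ler_wpM2r // ltW ?expR_gt0.
by rewrite -expRD ler_expR addrC.
Qed.

Lemma exp_gap2 (u v C : R) : u + 2 * c * t <= v -> 0 <= C -> C <= 4096 * 4096 ->
  C * expR u <= expR v.
Proof.
move=> h C0 hC; apply: (@le_trans _ _ (L * L * expR u)).
  apply: ler_wpM2r; first by rewrite ltW ?expR_gt0.
  by apply: (le_trans hC); apply: ler_pM; rewrite ?ler0n ?L4096.
rewrite -!expRD ler_expR; apply: le_trans h; rewrite le_eqVlt; apply/orP; left.
by apply/eqP; ring.
Qed.

Lemma ge0_by (u v P : R) : v - u = t * P -> 0 <= P -> u <= v.
Proof. by move=> h P0; rewrite -subr_ge0 h mulr_ge0 // ltW. Qed.

Let Q := scQ t.
Let X := scX t.
Let Y := scY t.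
Let Qp := scQ ((1 + e) * t).
Let Xp := scX ((1 + e) * t).
Let Yp := scY ((1 + e) * t).
Let ap := bxX ((1 + e) * t).
Let bp := bxY ((1 + e) * t).

Lemma slope_decreases : Q * Yp <= Qp * Y.
Proof.
rewrite /Q /Yp /Qp /Y /scQ /scY -!expRD ler_expR.
apply: (@ge0_by _ _ (e * (w + e ^+ 2))); first by ring.
by rewrite mulr_ge0 ?addr_ge0 ?sqr_ge0 // ltW.
Qed.

Lemma strip_thin : 4 * bp * Qp * Q <= Y.
Proof.
rewrite /bp bxYE /Qp /Q /Y /scQ /scY.
set u := expR (_ - _).
have -> : 4 * (4 * u) * expR ((1 + e) * t) * expR t = 16 * (u * expR ((1 + e) * t) * expR t) by ring.
rewrite -!expRD; apply: exp_gap1 => //; last by move: L4096; lra.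
rewrite /c; apply: (@ge0_by _ _ (e * (2 * w + w * e + 2 * e ^+ 2 + e ^+ 3 - w * e / 2))); first by ring.
have := e_lt; move: w0 e0 => ? ? ?; rewrite mulr_ge0 // ?ltW //; nra.
Qed.

Lemma bad_rare : 12288 * (64 * bp * Qp ^+ 2 + Y) * Xp <= Yp * X.
Proof.
rewrite /bp bxYE /Qp /Xp /Yp /X /Y /scQ /scX /scY.
set u := expR (_ - _).
have -> : 12288 * (64 * (4 * u) * (expR ((1 + e) * t)) ^+ 2 + expR ((1 - w - e ^+ 2) * t)) *
  expR ((w - e ^+ 2) * ((1 + e) * t)) =
  (12288 * 512 * (u * expR ((1 + e) * t) * expR ((1 + e) * t) * expR ((w - e ^+ 2) * ((1 + e) * t)))) / 2 +
  (12288 * 2 * (expR ((1 - w - e ^+ 2) * t) * expR ((w - e ^+ 2) * ((1 + e) * t)))) / 2 by field.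
rewrite -!expRD.
set v := expR ((1 - w - e ^+ 2) * ((1 + e) * t) + (w - e ^+ 2) * t).
have h1 : 12288 * 512 * expR ((1 - w - e ^+ 2) * ((1 + e) * ((1 + e) * t)) - (1 + e) * t - (1 + e) * ((1 + e) * t) + (1 + e) * t + (1 + e) * t + (w - e ^+ 2) * ((1 + e) * t)) <= v.
  apply: exp_gap2; [|lra|lra].
  rewrite /c; apply: (@ge0_by _ _ (2 * e ^+ 3 + e ^+ 4)); first by field.
  by rewrite addr_ge0 ?mulr_ge0 ?exprn_ge0 // ltW.
have h2 : 12288 * 2 * expR ((1 - w - e ^+ 2) * t + (w - e ^+ 2) * ((1 + e) * t)) <= v.
  apply: exp_gap2; [|lra|lra].
  rewrite /c; apply: (@ge0_by _ _ (e * (1 - w - w - w * e))); first by field.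
  have w1 : w <= 1 by move: hww e0 w0; lra.
  by rewrite mulr_ge0 ?ltW //; move: hww e0 w0 => ? ? ?; nra.
lra.
Qed.

Let w_le : 2 * w <= 1 - e. Proof. by move: hww; lra. Qed.

Lemma many_columns : 16 * (3 + t) + 256 <= Xp / (4 * X).
Proof.
rewrite ler_pdivlMr ?mulr_gt0 ?expR_gt0 //.
have h1 : L * X <= Xp.
  rewrite /L /X /Xp /scX -expRD ler_expR /c.
  apply: (@ge0_by _ _ (e * (w - e ^+ 2 - w * e / 2))); first by field.
  by have := e_lt; move: hw e0 w0 => ? ? ? ?; rewrite mulr_ge0 // ?ltW //; nra.
have h2 : 64 * (3 + t) + 1024 <= L by move: Lbig t0; rewrite -/L; move: L => l; lra.
have X0 : 0 <= X by rewrite ltW ?expR_gt0.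
apply: le_trans h1; rewrite mulrA; apply: ler_wpM2r => //.
by apply: le_trans h2; lra.
Qed.

Lemma ratio_ge : L <= Yp * X / Q.
Proof.
rewrite /L /X /Yp /Q /scX /scY /scQ -expRD -expRN -expRD ler_expR /c.
apply: (@ge0_by _ _ (e * (1 - w - e ^+ 2 - 2 * e - w * e / 2))); first by field.
by have := e_lt; move: w_le hw e0 w0 => ? ? ? ? ?; rewrite mulr_ge0 // ?ltW //; nra.
Qed.

Lemma many_rows : 16 * (3 + t) <= Yp * X / (16 * Q).
Proof.
have -> : Yp * X / (16 * Q) = Yp * X / Q / 16 by field; rewrite gt_eqF ?expR_gt0.
have h := ratio_ge.
have h2 : 256 * (3 + t) <= L by move: Lbig t0; rewrite -/L; move: L => l; lra.
by have := le_trans h2 h; move: (_ / _) => z; lra.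
Qed.

Lemma first_row_ge8 : 8 <= Yp * X / (2 * Q).
Proof.
have -> : Yp * X / (2 * Q) = Yp * X / Q / 2 by field; rewrite gt_eqF ?expR_gt0.
have := le_trans L4096 ratio_ge; move: (_ / _) => z; lra.
Qed.

Lemma denominators_grow : 8 * Q <= Qp.
Proof.
apply: exp_gap1; [|lra|by move: L4096; lra].
rewrite /c; apply: (@ge0_by _ _ (e * (1 - w * e / 2))); first by field.
by have := e_lt; move: w_le e0 w0 => ? ? ? ?; rewrite mulr_ge0 // ?ltW //; nra.
Qed.

Lemma log_range_le : ln (4 * Yp * X / Q) <= 3 + t.
Proof.
have -> : 4 * Yp * X / Q = 4 * expR ((e * (1 - w - e ^+ 2) - 2 * e ^+ 2) * t).
  rewrite /Yp /X /Q /scX /scY /scQ -expRN -!mulrA -!expRD; congr (_ * expR _); ring.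
rewrite lnM ?posrE ?expR_gt0 // expRK.
have h4 : ln 4 <= 3 :> R.
  by have := @le_ln1Dx R 3; rewrite (_ : 1 + 3 = 4); [apply; lra|ring].
apply: lerD => //; rewrite ler_piMl //; first exact: ltW.
by have := e_lt; move: w_le e0 w0 => ? ? ? ?; nra.
Qed.

Lemma boxes_separate : 64 * Qp * (ap * Yp + bp * Xp) < 1.
Proof.
rewrite /ap /bp bxXE bxYE /Qp /Xp /Yp /scQ /scX /scY.
set u := expR (_ - _); set v := expR (_ - _).
have -> : 64 * expR ((1 + e) * t) * (4 * u * expR ((1 - w - e ^+ 2) * ((1 + e) * t))
    + 4 * v * expR ((w - e ^+ 2) * ((1 + e) * t))) =
  (1024 * (u * expR ((1 - w - e ^+ 2) * ((1 + e) * t)) * expR ((1 + e) * t))) / 4 +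
  (1024 * (v * expR ((w - e ^+ 2) * ((1 + e) * t)) * expR ((1 + e) * t))) / 4 by field.
rewrite -!expRD.
have l1024 : 1024 <= L by move: L4096; lra.
have h1 : 1024 * expR ((w - e ^+ 2) * ((1 + e) * ((1 + e) * t)) - (1 + e) * t - (1 + e) * ((1 + e) * t) + (1 - w - e ^+ 2) * ((1 + e) * t) + (1 + e) * t) <= expR 0.
  apply: exp_gap1; [|lra|exact: l1024].
  rewrite /c; apply: (@ge0_by _ _ ((1 + e) * ((1 - w) * e + (2 + e) * e ^+ 2) - w * e ^+ 2 / 2)); first by field.
  by have := e_lt; move: w_le e0 w0 => ? ? ? ?; rewrite subr_ge0; nra.
have h2 : 1024 * expR ((1 - w - e ^+ 2) * ((1 + e) * ((1 + e) * t)) - (1 + e) * t - (1 + e) * ((1 + e) * t) + (w - e ^+ 2) * ((1 + e) * t) + (1 + e) * t) <= expR 0.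
  apply: exp_gap1; [|lra|exact: l1024].
  rewrite /c; apply: (@ge0_by _ _ ((1 + e) * (w * e + (2 + e) * e ^+ 2) - w * e ^+ 2 / 2)); first by field.
  by have := e_lt; move: w_le e0 w0 => ? ? ? ?; rewrite subr_ge0; nra.
by move: h1 h2; rewrite expR0; lra.
Qed.

Lemma strips_separate : 16 * bp * Qp ^+ 2 < Yp.
Proof.
rewrite /bp bxYE /Qp /Yp /scQ /scY.
set u := expR (_ - _).
have -> : 16 * (4 * u) * expR ((1 + e) * t) ^+ 2 =
  (128 * (u * expR ((1 + e) * t) * expR ((1 + e) * t))) / 2 by field.
rewrite -!expRD; set v := expR ((1 - w - e ^+ 2) * ((1 + e) * t)).
have h1 : 128 * expR ((1 - w - e ^+ 2) * ((1 + e) * ((1 + e) * t)) - (1 + e) * t - (1 + e) * ((1 + e) * t) + (1 + e) * t + (1 + e) * t) <= v.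
  apply: exp_gap1; [|lra|by move: L4096; lra].
  rewrite /c; apply: (@ge0_by _ _ ((1 + e) * e * (w + e ^+ 2) - w * e ^+ 2 / 2)); first by field.
  by have := e_lt; move: w_le e0 w0 => ? ? ? ?; rewrite subr_ge0; nra.
have v0 : 0 < v by rewrite expR_gt0.
by move: h1; lra.
Qed.

Lemma box_halfX : 2 * ap <= bxX t.
Proof.
rewrite /ap !bxXE mulrCA ler_pM2l //; apply: exp_gap1; [|lra|by move: L4096; lra].
rewrite /c; apply: (@ge0_by _ _ (e * (1 + (1 + e) * (1 - w + e ^+ 2)) - w * e ^+ 2 / 2)); first by field.
by have := e_lt; move: w_le e0 w0 => ? ? ? ?; rewrite subr_ge0; nra.
Qed.

Lemma box_halfY : 2 * bp <= bxY t.
Proof.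
rewrite /bp !bxYE mulrCA ler_pM2l //; apply: exp_gap1; [|lra|by move: L4096; lra].
rewrite /c; apply: (@ge0_by _ _ (e * (1 + (1 + e) * (w + e ^+ 2)) - w * e ^+ 2 / 2)); first by field.
by have := e_lt; move: w_le e0 w0 => ? ? ? ?; rewrite subr_ge0; nra.
Qed.

Lemma bxX_le_bxY : bxX t <= bxY t.
Proof.
rewrite bxXE bxYE ler_pM2l // ler_expR.
apply: (@ge0_by _ _ ((1 + e) * (1 - w - w))); first by ring.
by move: hww e0 => ? ?; rewrite mulr_ge0; lra.
Qed.

Lemma bxX_ratio : bxX ((1 + e) * t) / bxX t = expR (- e * (1 + (1 + e) * (1 - w + e ^+ 2)) * t).
Proof.
rewrite !bxXE -mulf_div divff ?mul1r // -expRN -expRD; congr expR; ring.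
Qed.

Lemma bxY_ratio : bxY ((1 + e) * t) / bxY t = expR (- e * (1 + (1 + e) * (w + e ^+ 2)) * t).
Proof.
rewrite !bxYE -mulf_div divff ?mul1r // -expRN -expRD; congr expR; ring.
Qed.

(** Only the first order in e matters; the coefficient 4 leaves room for the rest. *)
Let growth z : 0 <= z -> z <= 1 ->
  (1 + e) * (1 + (1 + e) * (z + e ^+ 2)) <= 1 + z + 4 * e.
Proof.
move=> z0 z1; have he16 := e_lt.
have m1 : e * z <= e by rewrite ler_piMr // ltW.
have m2 : e ^+ 2 <= e / 16 by rewrite expr2 ler_pM2l //; move: he16; lra.
have m3 : e ^+ 3 <= e ^+ 2 / 16.
  by rewrite exprSr ler_pM2l ?exprn_gt0 //; move: he16; lra.
have m4 : e ^+ 2 * z <= e ^+ 2 by rewrite ler_piMr // sqr_ge0.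
have m5 : e ^+ 4 <= e ^+ 3 / 16.
  by rewrite exprSr ler_pM2l ?exprn_gt0 //; move: he16; lra.
have -> : (1 + e) * (1 + (1 + e) * (z + e ^+ 2)) =
  1 + e + z + e ^+ 2 + 2 * (e * z) + 2 * e ^+ 3 + e ^+ 2 * z + e ^+ 4 by ring.
move: m1 m2 m3 m4 m5 e0; move: (e * z) (e ^+ 2 * z) (e ^+ 2) (e ^+ 3) (e ^+ 4).
by move=> a b c' f g; lra.
Qed.

Let rX : R := - e * (1 + (1 + e) * (1 - w + e ^+ 2)) * ((1 + e) * t).
Let rY : R := - e * (1 + (1 + e) * (w + e ^+ 2)) * ((1 + e) * t).

(** Here d beats the errors of first order in e: as e tends to 0 the two exponents,
    divided by - e t, tend to 1 + w and (1 - d) (1 + w). *)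
Lemma strip_ratio_le : 256 * Q * X / (Xp * Qp) <= expR ((1 - d) * rY).
Proof.
rewrite /Q /X /Xp /Qp /scQ /scX.
have -> : 256 * expR t * expR ((w - e ^+ 2) * t) / (expR ((w - e ^+ 2) * ((1 + e) * t)) * expR ((1 + e) * t)) =
  256 * expR (t + (w - e ^+ 2) * t - ((w - e ^+ 2) * ((1 + e) * t) + (1 + e) * t)).
  by rewrite -expRD -expRN -!mulrA -!expRD; congr (_ * expR _); ring.
apply: exp_gap1; [|lra|by move: L4096; lra].
rewrite /rY /c; apply: (@ge0_by _ _ (e * (1 + w - e ^+ 2 - (1 - d) * ((1 + e) * (1 + (1 + e) * (w + e ^+ 2))) - w * e / 2))).
  by field.
rewrite mulr_ge0 ?ltW //.
have h1 : (1 + e) * (1 + (1 + e) * (w + e ^+ 2)) <= 1 + w + 4 * e.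
  by apply: growth; move: w_le e0 w0; lra.
have h2 : (1 - d) * ((1 + e) * (1 + (1 + e) * (w + e ^+ 2))) <= (1 - d) * (1 + w + 4 * e).
  by apply: ler_wpM2l => //; rewrite subr_ge0.
have := e_lt; move: he w_le e0 w0 => ? ? ? ? ?; nra.
Qed.

(** As e tends to 0 the exponents, divided by - e t, tend to 2 and
    (1 - d) (1 + w) + (1 - w); the exponent (1 - w) / (2 - w) is the one for which
    they agree when d = 0. *)
Lemma box_ratio_le : 4096 * Q ^+ 2 / (Yp * Xp * Qp) <=
  expR ((1 - d) * rY + (1 - w) / (2 - w) * rX).
Proof.
have w2 : 0 < 2 - w by move: w_le e0; lra.
rewrite /Q /Yp /Xp /Qp /scQ /scX /scY.
have -> : 4096 * expR t ^+ 2 / (expR ((1 - w - e ^+ 2) * ((1 + e) * t)) * expR ((w - e ^+ 2) * ((1 + e) * t)) * expR ((1 + e) * t)) =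
  4096 * expR (t + t - ((1 - w - e ^+ 2) * ((1 + e) * t) + (w - e ^+ 2) * ((1 + e) * t) + (1 + e) * t)).
  by rewrite -!expRD -expRN expr2 -!mulrA -!expRD; congr (_ * expR _); ring.
apply: exp_gap1; [|lra|exact: L4096].
set om := (1 - w) / (2 - w).
rewrite /rY /rX /c; apply: (@ge0_by _ _ (e * (2 - 2 * e - 2 * e ^+ 2
   - (1 - d) * ((1 + e) * (1 + (1 + e) * (w + e ^+ 2)))
   - om * ((1 + e) * (1 + (1 + e) * (1 - w + e ^+ 2))) - w * e / 2))).
  by field.
rewrite mulr_ge0 ?ltW //.
have h1 : (1 + e) * (1 + (1 + e) * (w + e ^+ 2)) <= 1 + w + 4 * e.
  by apply: growth; move: w_le e0 w0; lra.
have h2 : (1 - d) * ((1 + e) * (1 + (1 + e) * (w + e ^+ 2))) <= (1 - d) * (1 + w + 4 * e).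
  by apply: ler_wpM2l => //; rewrite subr_ge0.
have h3 : (1 + e) * (1 + (1 + e) * (1 - w + e ^+ 2)) <= 2 - w + 6 * e.
  apply: (@le_trans _ _ (1 + (1 - w) + 4 * e)); last by move: e0; lra.
  by apply: growth; move: w_le e0 w0; lra.
have om0 : 0 <= om by rewrite /om divr_ge0 ?ltW //; move: w_le e0; lra.
have om1 : om <= 1 by rewrite /om ler_pdivrMr //; lra.
have h4 : om * ((1 + e) * (1 + (1 + e) * (1 - w + e ^+ 2))) <= om * (2 - w + 6 * e).
  exact: ler_wpM2l.
have h5 : om * (2 - w) = 1 - w by rewrite /om; field; rewrite gt_eqF.
have h6 : om * (6 * e) <= 6 * e by rewrite ler_piMl // mulr_ge0 // ltW.
have h7 : om * (2 - w + 6 * e) = 1 - w + om * (6 * e) by rewrite mulrDr h5.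
have h8 : e ^+ 2 <= e / 16 by have := e_lt; move: e0 => ? ?; nra.
have h9 : w * e <= e by rewrite ler_piMl ?ltW //; move: w_le e0; lra.
have h10 : (1 - d) * (1 + w + 4 * e) <= 1 + w + 4 * e - d.
  have d0 : 0 <= d by move: he e0; lra.
  have : 0 <= d * (w + 4 * e) by rewrite mulr_ge0 // addr_ge0 ?mulr_ge0 // ltW.
  lra.
move: h2 h4 h6 h7 h8 h9 h10 he e0.
move: (om * _) ((1 - d) * _) => A B; lra.
Qed.

End scales.

(** * The potential on the tree *)

Section powers.
Variable R : realType.

Lemma expR_powR (u y : R) : expR u `^ y = expR (y * u).
Proof. by rewrite /powR gt_eqF ?expR_gt0 // expRK. Qed.

(** A power capped at one: a square larger than a box is worth no more than the
    box. *)
Definition capped (a x : R) : R := Num.min 1 (x `^ a).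

Lemma capped_ge0 a x : 0 <= capped a x.
Proof. by rewrite le_min ler01 powR_ge0. Qed.

Lemma capped_le1 a x : capped a x <= 1.
Proof. by rewrite ge_min lexx. Qed.

Lemma capped_le a x : capped a x <= x `^ a.
Proof. by rewrite ge_min lexx orbT. Qed.

Lemma capped_ge1 a x : 0 <= a -> 1 <= x -> capped a x = 1.
Proof.
move=> a0 x1; apply/min_idPl; have -> : 1 = 1 `^ a by rewrite powR1.
by apply: ge0_ler_powR; rewrite ?nnegrE //; apply: le_trans x1.
Qed.

Lemma capped_lt1 a x : 0 <= a -> 0 <= x -> x <= 1 -> capped a x = x `^ a.
Proof.
move=> a0 x0 x1; apply/min_idPr; have -> : 1 = 1 `^ a by rewrite powR1.
by apply: ge0_ler_powR; rewrite ?nnegrE.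
Qed.

End powers.

Lemma nested_intervals (R : realType) (u b : nat -> R) :
  (forall k, 0 <= b k) -> (forall k, u k <= u k.+1) ->
  (forall k, u k.+1 + b k.+1 <= u k + b k) ->
  exists z, forall k, u k <= z <= u k + b k.
Proof.
move=> b0 hu hb.
have mono i j : (i <= j)%N -> u i <= u j.
  by move=> /subnK <-; elim: (j - i)%N => // n IH; apply: le_trans (hu _).
have anti i j : (i <= j)%N -> u j + b j <= u i + b i.
  by move=> /subnK <-; elim: (j - i)%N => // n IH; apply: le_trans (hb _) _.
have ub j k : u j <= u k + b k.
  case: (leqP j k) => h; first by apply: (le_trans (mono _ _ h)); rewrite lerDl.
  by apply: le_trans (anti _ _ (ltnW h)); rewrite lerDl.
have hs : has_sup (range u).
  split; first by exists (u 0%N), 0%N.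
  by exists (u 0%N + b 0%N) => _ [j _ <-].
exists (sup (range u)) => k; apply/andP; split.
  by apply: ub_le_sup; [case: hs | exists k].
by apply: ge_sup; [case: hs | move=> _ [j _ <-]].
Qed.

Section tree.
Variables (R : realType) (w e d T0 : R).
Hypotheses (w0 : 0 < w) (e0 : 0 < e) (d1 : d <= 1)
  (he : 40 * e <= d) (hw : 8 * e <= w) (hww : e <= 1 - w - w).
Hypotheses (T00 : 0 < T0)
  (Tbig : forall t, T0 <= t -> 4096 * (1 + t) <= expR (w * e ^+ 2 / 2 * t)).

(** The times t_k at which the vectors have denominators about exp t_k. *)
Definition level (k : nat) : R := (1 + e) ^+ k * T0.

Lemma levelS k : level k.+1 = (1 + e) * level k.
Proof. by rewrite /level exprS mulrA. Qed.

Lemma level_ge k : T0 <= level k.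
Proof.
elim: k => [|k IH]; first by rewrite /level expr0 mul1r.
by rewrite levelS (le_trans IH) // mulrDl mul1r lerDl mulr_ge0 ?ltW // (lt_le_trans T00).
Qed.

Lemma level_gt0 k : 0 < level k.
Proof. exact: lt_le_trans (level_ge k). Qed.

Let Lbig k := Tbig (level_ge k).

Let om : R := (1 - w) / (2 - w).

Let wlt : 2 * w <= 1 - e. Proof. by move: hww; lra. Qed.

Let om0 : 0 <= om.
Proof. by rewrite /om divr_ge0 //; move: wlt e0 w0; lra. Qed.

Let d0 : 0 <= 1 - d. Proof. by rewrite subr_ge0. Qed.

Definition aX k := bxX w e (level k).
Definition bY k := bxY w e (level k).

Lemma aX_gt0 k : 0 < aX k. Proof. exact: bxX_gt0. Qed.
Lemma bY_gt0 k : 0 < bY k. Proof. exact: bxY_gt0. Qed.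

Lemma aX_le_bY k : aX k <= bY k.
Proof. by apply: bxX_le_bxY => //; exact: level_gt0. Qed.

Lemma aX_half k : 2 * aX k.+1 <= aX k.
Proof. rewrite /aX levelS; apply: box_halfX (Lbig k) => //; exact: level_gt0. Qed.

Lemma bY_half k : 2 * bY k.+1 <= bY k.
Proof. rewrite /bY levelS; apply: box_halfY (Lbig k) => //; exact: level_gt0. Qed.

(** The fraction of the mass of a node at level k that a square of radius rho can
    carry. Its two factors change regime at the sides of the boxes of the children. *)
Definition potential k (rho : R) : R :=
  capped (1 - d) (rho / bY k.+1) * capped ((1 - w) / (2 - w)) (rho / aX k.+1).

Lemma potential_ge0 k rho : 0 <= potential k rho.
Proof. by rewrite mulr_ge0 ?capped_ge0. Qed.

Lemma potential_le1 k rho : potential k rho <= 1.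
Proof. by rewrite mulr_ile1 ?capped_ge0 ?capped_le1. Qed.

Lemma potential1 k rho : bY k.+1 <= rho -> potential k rho = 1.
Proof.
move=> h; rewrite /potential !capped_ge1 ?mulr1 //.
  by rewrite ler_pdivlMr ?aX_gt0 // mul1r (le_trans _ h) // aX_le_bY.
by rewrite ler_pdivlMr ?bY_gt0 // mul1r.
Qed.

Lemma potential_le k rho :
  potential k rho <= (rho / bY k.+1) `^ (1 - d) * (rho / aX k.+1) `^ ((1 - w) / (2 - w)).
Proof. by apply: ler_pM; rewrite ?capped_ge0 ?capped_le. Qed.

Let rescale (a rho b b' : R) : 0 <= rho -> 0 < b -> 0 < b' ->
  (rho / b) `^ a = (rho / b') `^ a * (b' / b) `^ a.
Proof.
move=> r0 b0 b'0.
have -> : rho / b = rho / b' * (b' / b) by field; rewrite !gt_eqF.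
by rewrite powRM // divr_ge0 // ltW.
Qed.

Let ratioY k : bY k.+2 / bY k.+1 = expR (- e * (1 + (1 + e) * (w + e ^+ 2)) * ((1 + e) * level k)).
Proof. by rewrite /bY (levelS k.+1) bxY_ratio levelS. Qed.

Let ratioX k : aX k.+2 / aX k.+1 = expR (- e * (1 + (1 + e) * (1 - w + e ^+ 2)) * ((1 + e) * level k)).
Proof. by rewrite /aX (levelS k.+1) bxX_ratio levelS. Qed.

(** A square wider than the boxes of the children but less high meets at most one child
    per row. *)
Lemma potential_strip k rho : 0 < rho -> rho < bY k.+1 -> aX k.+1 <= rho ->
  256 * scQ (level k) * scX w e (level k) /
   (scX w e (level k.+1) * scQ (level k.+1)) * potential k.+1 rho <= potential k rho.
Proof.
move=> r0 rb ra.
have b1 := bY_gt0 k.+1; have b2 := bY_gt0 k.+2.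
rewrite [leRHS]/potential (capped_ge1 om0) ?mulr1; last by rewrite ler_pdivlMr ?aX_gt0 // mul1r.
rewrite capped_lt1 //; first last.
- by rewrite ler_pdivrMr // mul1r ltW.
- by rewrite divr_ge0 // ltW.
rewrite (rescale (1 - d) (ltW r0) b1 b2) mulrC; apply: ler_pM.
- exact: potential_ge0.
- by rewrite !mulr_ge0 ?invr_ge0 ?mulr_ge0 ?expR_ge0 ?ler0n.
- rewrite /potential -[leRHS]mulr1; apply: ler_pM; rewrite ?capped_ge0 ?capped_le ?capped_le1 //.
- rewrite ratioY expR_powR levelS; apply: strip_ratio_le => //; exact: level_gt0.
Qed.

(** A square smaller than the boxes of the children meets at most one child. *)
Lemma potential_square k rho : 0 < rho -> rho < aX k.+1 ->
  4096 * scQ (level k) ^+ 2 / (scY w e (level k.+1) * scX w e (level k.+1)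
   * scQ (level k.+1)) * potential k.+1 rho <= potential k rho.
Proof.
move=> r0 ra.
have b1 := bY_gt0 k.+1; have b2 := bY_gt0 k.+2.
have a1 := aX_gt0 k.+1; have a2 := aX_gt0 k.+2.
have rb : rho < bY k.+1 by apply: lt_le_trans ra (aX_le_bY _).
rewrite [leRHS]/potential (capped_lt1 om0); first last.
- by rewrite ler_pdivrMr // mul1r ltW.
- by rewrite divr_ge0 // ltW.
rewrite capped_lt1 //; first last.
- by rewrite ler_pdivrMr // mul1r ltW.
- by rewrite divr_ge0 // ltW.
rewrite (rescale (1 - d) (ltW r0) b1 b2) (rescale om (ltW r0) a1 a2) [leRHS]mulrACA [leLHS]mulrC; apply: ler_pM.
- exact: potential_ge0.
- by rewrite !mulr_ge0 ?invr_ge0 ?mulr_ge0 ?expR_ge0 ?ler0n ?sqr_ge0.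
- exact: potential_le.
- rewrite ratioY ratioX !expR_powR -[leRHS]expRD levelS; apply: box_ratio_le => //; exact: level_gt0.
Qed.

Let goodk k (st : state R) :=
  good (scQ (level k)) (scX w e (level k)) (scY w e (level k)) st.

Definition linked k (st st' : state R) : Prop :=
  [/\ child_of st st', 0 <= posX st' - posX st <= aX k / 2 &
      0 <= posY st' - posY st <= bY k / 2].

(** The potential is superharmonic: its sum over the children that are hit is at most
    the number of children times its value at the parent. *)
Let child_count k st : goodk k st -> exists cs : seq (state R),
  [/\ (0 < size cs)%N, forall c, c \in cs -> goodk k.+1 c /\ linked k st c &
    forall xi eta rho, 0 < rho ->
     (count (hits (aX k.+1) (bY k.+1) xi eta rho) cs)%:R * potential k.+1 rho
       <= (size cs)%:R * potential k rho].
Proof.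
case: st => [[v' u] v] gst.
have t0 := level_gt0 k; have Lk := Lbig k.
pose tp := (1 + e) * level k.
have gt (x : R) : 0 < expR x by exact: expR_gt0.
have [cs [cs0 hcs h1 h2]] := @exists_children R v' u v
  (scQ (level k)) (scX w e (level k)) (scY w e (level k))
  (scQ tp) (scX w e tp) (scY w e tp) (bxX w e tp) (bxY w e tp) (3 + level k)
  (gt _) (gt _) (gt _) (gt _) (gt _) (gt _) (bxY_gt0 _ _ _) gst
  (slope_decreases w0 e0 t0) (strip_thin w0 e0 hw hww t0 Lk)
  (bad_rare w0 e0 hww t0 Lk) (many_columns w0 e0 hw hww t0 Lk)
  (many_rows w0 e0 hw hww t0 Lk) (first_row_ge8 w0 e0 hw hww t0 Lk)
  (denominators_grow w0 e0 hw hww t0 Lk) (log_range_le w0 e0 hw hww t0)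
  (boxes_separate w0 e0 hw hww t0 Lk) (strips_separate w0 e0 hw hww t0 Lk).
move: hcs h1 h2; rewrite /tp -!levelS -!/(aX _) -!/(bY _) => hcs h1 h2.
exists cs; split; first exact: cs0.
- move=> c /hcs [gc cc hX hY]; split; first exact: gc.
  split; first exact: cc.
  + rewrite (_ : aX k / 2 = 2 * scX w e (level k.+1) / (scQ (level k) * scQ (level k.+1))) //.
    by rewrite /aX /bxX levelS; field; rewrite ?gt_eqF ?gt.
  + rewrite (_ : bY k / 2 = 2 * scY w e (level k.+1) / (scQ (level k) * scQ (level k.+1))) //.
    by rewrite /bY /bxY levelS; field; rewrite ?gt_eqF ?gt.
- move=> xi eta rho r0.
  have S0 : 0 <= (size cs)%:R :> R by [].
  have G0 := potential_ge0 k.+1 rho.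
  have fin (pi x : R) : x <= pi * (size cs)%:R -> pi * potential k.+1 rho <= potential k rho ->
      x * potential k.+1 rho <= (size cs)%:R * potential k rho.
    move=> hx hp; apply: (le_trans (ler_wpM2r G0 hx)).
    rewrite [leLHS](_ : _ = (size cs)%:R * (pi * potential k.+1 rho)); last by ring.
    exact: ler_wpM2l.
  have [rb|rb] := leP (bY k.+1) rho.
    rewrite (potential1 rb); apply: ler_pM => //; last exact: potential_le1.
    by rewrite ler_nat count_size.
  have [ra|ra] := leP (aX k.+1) rho.
    exact: fin (h1 xi eta rho rb) (potential_strip r0 rb ra).
  exact: fin (h2 xi eta rho ra rb) (potential_square r0 ra).
Qed.

Lemma linked_hits k st st' xi eta rho : linked k st st' ->
  hits (aX k.+1) (bY k.+1) xi eta rho st' -> hits (aX k) (bY k) xi eta rho st.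
Proof.
move=> [_ /andP[x1 x2] /andP[y1 y2]] /andP[h1 h2]; apply/andP.
have hX := aX_half k; have hY := bY_half k.
rewrite (_ : posX st - xi = (posX st' - xi) - (posX st' - posX st)); last by ring.
rewrite (_ : posY st - eta = (posY st' - eta) - (posY st' - posY st)); last by ring.
split; apply: le_trans (ler_normB _ _) _.
  by rewrite (ger0_norm x1); move: x2 h1 hX; lra.
by rewrite (ger0_norm y1); move: y2 h2 hY; lra.
Qed.

Lemma bY_small (rho : R) : 0 < rho -> exists K, forall k, (K <= k)%N -> bY k <= rho.
Proof.
move=> r0.
have anti i j : (i <= j)%N -> bY j <= bY i.
  move=> /subnK <-; elim: (j - i)%N => // n IH; apply: le_trans IH.
  by have := bY_half (n + i); have := bY_gt0 (n + i).+1; rewrite addSn; lra.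
have dec n : n%:R * bY n <= bY 0.
  elim: n => [|n IH]; first by rewrite mul0r ltW ?bY_gt0.
  have h1 := bY_half n; have h2 := bY_gt0 n.+1.
  case: n IH h1 h2 => [|n] IH h1 h2; first by rewrite mul1r; move: h1 h2; lra.
  apply: le_trans IH; apply: (@le_trans _ _ (n.+1%:R * (2 * bY n.+2))).
    rewrite mulrA ler_pM2r // -natr1 -[in leRHS]natr1.
    by have : 0 <= n%:R :> R by []; lra.
  by apply: ler_wpM2l.
exists (Num.truncn (bY 0 / rho)).+1 => k hk; apply: le_trans (anti _ _ hk) _.
set K := (Num.truncn _).+1.
have hK : bY 0 / rho < K%:R by exact: truncnS_gt.
have K0 : 0 < K%:R :> R by rewrite ltr0n.
rewrite -(ler_pM2l K0); apply: le_trans (dec K) _.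
by move: hK; rewrite ltr_pdivrMr // => /ltW.
Qed.

(** If the total potential at the root is less than one, [descent] keeps it so along a
    branch. The boxes of the branch shrink to a point. A square that contained this
    point would meet all of them, and its potential would be one from some level
    on. *)
Lemma tree_cover (st0 : state R) (z x rho : nat -> R) :
  good (scQ (level 0)) (scX w e (level 0)) (scY w e (level 0)) st0 ->
  (forall i, 0 < rho i) ->
  (1 <= \sum_(i <oo) (if hits (aX 0) (bY 0) (z i) (x i) (rho i) st0
                      then potential 0 (rho i) else 0)%:E)%E \/
  exists (st : nat -> state R) (zx : R * R),
    [/\ st 0%N = st0,
        forall k, good (scQ (level k)) (scX w e (level k)) (scY w e (level k)) (st k),
        forall k, child_of (st k) (st k.+1),
        forall k, `|posX (st k) - zx.1| <= aX k /\ `|posY (st k) - zx.2| <= bY k &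
        forall i, ~~ ((`|zx.1 - z i| <= rho i) && (`|zx.2 - x i| <= rho i))].
Proof.
move=> g0 r0.
pose F k st i : \bar R := (if hits (aX k) (bY k) (z i) (x i) (rho i) st
                           then potential k (rho i) else 0)%:E.
have [?|lt1] := leP 1%E (\sum_(i <oo) F 0%N st0 i)%E; [by left|right].
have F0 k st i : (0 <= F k st i)%E.
  by rewrite /F lee_fin; case: ifP => // _; exact: potential_ge0.
have stepF k st : goodk k st -> exists cs : seq (state R),
  [/\ (0 < size cs)%N, forall c, c \in cs -> goodk k.+1 c /\ linked k st c &
   forall i, (\sum_(c <- cs) F k.+1 c i <= (size cs)%:R%:E * F k st i)%E].
  move=> /child_count [cs [cs0 hcs hc]]; exists cs; split=> // i.
  rewrite /F sumEFin -EFinM lee_fin.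
  case: (boolP (hits (aX k) _ _ _ _ st)) => [h|nh].
    apply: le_trans (hc (z i) (x i) (rho i) (r0 i)).
    rewrite -big_mkcond /= big_const_seq iter_addr addr0.
    by rewrite mulr_natl.
  rewrite mulr0 big_seq big1 // => c ccs; case: ifP => // hit.
  by case/negP: nh; apply: linked_hits hit; case: (hcs _ ccs).
have [st [st_0 hst]] := descent F0 stepF g0 lt1.
have gst k : goodk k (st k) by case: (hst k).
have lst k : linked k (st k) (st k.+1) by case: (hst k).
have [zz hz] : exists zz, forall k, posX (st k) <= zz <= posX (st k) + aX k.
  apply: nested_intervals => k; first by rewrite ltW ?aX_gt0.
    by have [_ /andP[+ _] _] := lst k; rewrite subr_ge0.
  by have [_ /andP[_ h] _] := lst k; have := aX_half k; move: h; lra.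
have [xx hx] : exists xx, forall k, posY (st k) <= xx <= posY (st k) + bY k.
  apply: nested_intervals => k; first by rewrite ltW ?bY_gt0.
    by have [_ _ /andP[+ _]] := lst k; rewrite subr_ge0.
  by have [_ _ /andP[_ h]] := lst k; have := bY_half k; move: h; lra.
have near k : `|posX (st k) - zz| <= aX k /\ `|posY (st k) - xx| <= bY k.
  have /andP[z1 z2] := hz k; have /andP[x1 x2] := hx k.
  by rewrite !ler_norml; split; apply/andP; split; lra.
exists st, (zz, xx); split => //= [k|i]; first by case: (lst k).
apply/negP => /andP[hzi hxi].
have [K hK] := bY_small (r0 i).
have hit : hits (aX K) (bY K) (z i) (x i) (rho i) (st K).
  have [n1 n2] := near K; apply/andP; split.
    rewrite (_ : posX (st K) - z i = (posX (st K) - zz) + (zz - z i)); last by ring.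
    by apply: le_trans (ler_normD _ _) _; apply: lerD.
  rewrite (_ : posY (st K) - x i = (posY (st K) - xx) + (xx - x i)); last by ring.
  by apply: le_trans (ler_normD _ _) _; apply: lerD.
have [_ _] := hst K; apply/negP; rewrite -leNgt.
apply: (@le_trans _ _ (F K (st K) i)).
  by rewrite /F hit potential1 // hK.
rewrite (nneseriesD1 (n := i)) //.
by rewrite leeDl // nneseries_ge0.
Qed.

End tree.

(** * Unimodular lattices *)

Section lattices.
Variable R : realType.

Lemma unit_int_mx (A : 'M[int]_3) : \det A = 1 -> A \in unitmx.
Proof. by rewrite unitmxE => ->; exact: unitr1. Qed.

Lemma lattice_of_mul (h : 'M[R]_3) (A : 'M[int]_3) : \det A = 1 ->
  lattice_of (h *m map_mx intr A) = lattice_of h.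
Proof.
move=> /unit_int_mx uA; apply/seteqP; split => v [z _ <-].
  by exists (A *m z) => //; rewrite map_mxM mulmxA.
exists (invmx A *m z) => //.
by rewrite map_mxM -mulmxA (mulmxA (map_mx _ A)) -map_mxM mulmxV // map_mx1 mul1mx.
Qed.

(** The columns of g are integral combinations of those of h; comparing determinants
    shows that the matrix of coefficients is unimodular. *)
Lemma lattice_of_eq (g h : 'M[R]_3) : \det g = 1 -> \det h = 1 ->
  lattice_of g = lattice_of h ->
  exists2 A : 'M[int]_3, \det A = 1 & g = h *m map_mx intr A.
Proof.
move=> dg dh e.
have hj j : exists z : 'cV[int]_3, h *m map_mx intr z = g *m map_mx intr (delta_mx j 0).
  have : lattice_of g (g *m map_mx intr (delta_mx j 0 : 'cV[int]_3)) by exists (delta_mx j 0).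
  by rewrite e => -[z _ hz]; exists z.
have [z hz] := choice hj.
pose A : 'M[int]_3 := \matrix_(i, j) z j i 0.
have gA : g = h *m map_mx intr A.
  apply/matrixP => i j; have := congr1 (fun m : 'cV[R]_3 => m i 0) (hz j).
  rewrite map_delta_mx -colE !mxE => <-.
  by apply: eq_bigr => k _; rewrite !mxE.
exists A => //; apply: (@intr_inj R).
have := congr1 determinant gA; rewrite det_mulmx dg dh mul1r det_map_mx => <-.
by [].
Qed.

Definition mkSL3 (g : 'M[R]_3) (h : \det g = 1) : @SL3 R := SigSub (mem_set h).

Lemma SL3_det (g : @SL3 R) : \det (set_val g) = 1.
Proof. by have := set_valP g. Qed.

Lemma L3_proj_eq (g h : @SL3 R) :
  lattice_of (set_val g) = lattice_of (set_val h) -> L3_proj g = L3_proj h.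
Proof. by move=> e; apply: val_inj. Qed.

Lemma L3_val_proj (g : @SL3 R) : L3_val (L3_proj g) = lattice_of (set_val g).
Proof. by []. Qed.

Lemma L3_proj_surjective (L : L3 R) : exists g : @SL3 R, L3_proj g = L.
Proof.
have [g dg e] := set_valP L.
by exists (mkSL3 dg); apply: val_inj => /=; rewrite -e.
Qed.

Lemma mulmxr_continuous (c : 'M[R]_3) : continuous (fun m : 'M[R]_3 => m *m c).
Proof.
move=> m s /nbhs_ballP [eps eps0 es].
have h : \forall m' \near m, forall i j, ball ((m *m c) i j) eps ((m' *m c) i j).
  apply: (filter_forall (F := nbhs m) (f := (fun i m' => forall j, ball ((m *m c) i j) eps ((m' *m c) i j)))) => i.
  apply: (filter_forall (F := nbhs m) (f := (fun j m' => ball ((m *m c) i j) eps ((m' *m c) i j)))) => j.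
  have cj : continuous (fun m' : 'M[R]_3 => (m' *m c) i j).
    rewrite (_ : (fun m' : 'M[R]_3 => (m' *m c) i j) = (fun m' => \sum_k m' i k * c k j)); last first.
      by apply/funext => m'; rewrite mxE.
    apply: continuous_big => // [|k _ m']; first by move=> x; apply: add_continuous.
    by apply: continuousM; [exact: coord_continuous|exact: cst_continuous].
  by have /cvg_ballP := cj m; apply.
by apply: filterS h => m' h; apply: es; split.
Qed.

Lemma det_norm_le (n : nat) (A : 'M[R]_n) (M : R) :
  (forall i j, `|A i j| <= M) -> `|\det A| <= (n`!)%:R * M ^+ n.
Proof.
move=> hM; apply: (le_trans (ler_norm_sum _ _ _)).
have -> : (n`!)%:R * M ^+ n = \sum_(s : 'S_n) M ^+ n.
  by rewrite sumr_const card_Sn mulr_natl.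
apply: ler_sum => s _; rewrite normrM normrX normrN1 expr1n mul1r normr_prod.
rewrite -[n in M ^+ n]card_ord -prodr_const; apply: ler_prod => i _.
by rewrite normr_ge0 hM.
Qed.

Lemma adj_entry_le (g : 'M[R]_3) (M : R) : 0 <= M ->
  (forall i j, `|g i j| <= M) -> forall i j, `|(\adj g) i j| <= 2 * M ^+ 2.
Proof.
move=> M0 hM i j; rewrite mxE /cofactor normrM normrX normrN1 expr1n mul1r.
by apply: det_norm_le => k l; rewrite !mxE.
Qed.

(** The integral vector is the adjugate of g applied to g z, so it has entries less
    than one. *)
Lemma short_vector_lb (g : 'M[R]_3) (M : R) (z : 'cV[int]_3) : 0 < M -> \det g = 1 ->
  (forall i j, `|g i j| <= M) ->
  (forall i, `|(g *m map_mx intr z) i 0| < (6 * M ^+ 2)^-1) -> z = 0.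
Proof.
move=> M0 dg hM hv; apply/matrixP => i j; rewrite ord1 mxE.
have e : \adj g *m (g *m map_mx intr z) = map_mx intr z.
  by rewrite mulmxA mul_adj_mx dg mul1mx.
have P0 : 0 < 6 * M ^+ 2 by rewrite mulr_gt0 // exprn_gt0.
have hz : `|(z i 0)%:~R| < 1 :> R.
  have := congr1 (fun m : 'cV[R]_3 => m i 0) e; rewrite !mxE => <-.
  apply: le_lt_trans (ler_norm_sum _ _ _) _.
  have h k : `|(\adj g) i k * (g *m map_mx intr z) k 0| < 3^-1.
    rewrite normrM; apply: (@le_lt_trans _ _ (2 * M ^+ 2 * `|(g *m map_mx intr z) k 0|)).
      by apply: ler_wpM2r => //; apply: adj_entry_le => //; exact: ltW.
    rewrite -ltr_pdivlMl; last by rewrite mulr_gt0 // exprn_gt0.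
    by rewrite -invfM (_ : 2 * M ^+ 2 * 3 = 6 * M ^+ 2); [exact: hv|ring].
  rewrite !big_ord_recl big_ord0 addr0.
  have := h ord0; have := h (lift ord0 ord0); have := h (lift ord0 (lift ord0 ord0)).
  by lra.
by move: hz; rewrite -intr_norm (ltr_int R _ 1); lia.
Qed.

(** The lattices that have a basis with entries less than n + 1: an open exhaustion of
    the space of lattices. *)
Definition bounded_part (n : nat) : set (L3 R) :=
  fun L => exists2 g : @SL3 R, L3_proj g = L & forall i j, `|set_val g i j| < n.+1%:R.

(** Its preimage is the union, over the unimodular integral matrices A, of the open
    sets where h A has small entries. *)
Lemma open_bounded_part n : open (bounded_part n).
Proof.
change (open ((@L3_proj R) @^-1` bounded_part n)%classic).
pose W (A : 'M[int]_3) : set (@SL3 R) :=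
  fun h => forall i j, `|(set_val h *m map_mx intr A) i j| < n.+1%:R.
have -> : ((@L3_proj R) @^-1` bounded_part n = \bigcup_(A in (fun A => \det A = 1)) W A)%classic.
  apply/seteqP; split => h /=.
    move=> [g eg hg].
    have [A dA e] := lattice_of_eq (SL3_det g) (SL3_det h) (congr1 (@L3_val R) eg).
    by exists A => // i j; rewrite -e.
  move=> [A dA hA].
  have d1 : \det (set_val h *m map_mx intr A) = 1.
    by rewrite det_mulmx SL3_det mul1r det_map_mx dA.
  exists (mkSL3 d1) => //; apply: L3_proj_eq; exact: lattice_of_mul.
apply: bigcup_open => A _.
pose f (h : @SL3 R) : 'M[R]_3 := set_val h *m map_mx intr A.
have -> : (W A = f @^-1` (ball 0 n.+1%:R))%classic.
  apply/seteqP; split => h hW /=.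
    by split => // i j; rewrite mxE /ball /= sub0r normrN; exact: hW.
  by move=> i j; have [_ /(_ i j)] := hW; rewrite mxE /ball /= sub0r normrN.
apply: open_comp; last exact: ball_open.
move=> h _.
have h1 : {for h, continuous (set_val : @SL3 R -> 'M[R]_3)} by exact: initial_continuous.
exact: (continuous_comp h1 (@mulmxr_continuous (map_mx intr A) (set_val h))).
Qed.

(** The easy half of Mahler's criterion: a compact set lies in some bounded part, whose
    lattices have no short vectors. *)
Lemma compact_systole (K : set (L3 R)) : compact K ->
  exists2 eps : R, 0 < eps & forall L, K L -> forall v, L3_val L v ->
    (forall i, `|v i 0| < eps) -> v = 0.
Proof.
move=> cK.
have [n hn] : exists n, forall L, K L -> bounded_part n L.
  apply: contrapT => nex.
  have hx n : exists L, K L /\ ~ bounded_part n L.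
    apply: contrapT => h; apply: nex; exists n => L KL; apply: contrapT => nb.
    by apply: h; exists L.
  have [x xP] := choice hx.
  have [|L [KL cl]] := cK (x @ \oo)%classic _.
    by exists 0%N => // k _ /=; case: (xP k).
  have [g eg] := L3_proj_surjective L.
  have [m hm] : exists m, bounded_part m L.
    pose M := \sum_i \sum_j `|set_val g i j|.
    exists (Num.truncn M); exists g => // i j.
    apply: le_lt_trans (truncnS_gt M).
    rewrite /M (bigD1 i) //= (bigD1 j) //= -addrA lerDl addr_ge0 ?sumr_ge0 // => *.
    by rewrite sumr_ge0.
  have nb : nbhs L (bounded_part m) by apply: open_nbhs_nbhs; split => //; exact: open_bounded_part.
  have fA : (x @ \oo)%classic (x @` (fun k => (m <= k)%N))%classic.
    by exists m => // k mk; exists k.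
  have [L' [[k mk <-] hb]] := cl _ _ fA nb.
  have [_] := xP k; apply; case: hb => g' eg' hg'; exists g' => // i j.
  by apply: lt_le_trans (hg' i j) _; rewrite ler_nat ltnS.
exists (6 * n.+1%:R ^+ 2)^-1; first by rewrite invr_gt0 mulr_gt0 // exprn_gt0.
move=> L KL v; have [g <- hg] := hn L KL; rewrite L3_val_proj => -[z _ <-] hv.
rewrite (@short_vector_lb (set_val g) n.+1%:R z) ?map_mx0 ?mulmx0 //; first exact: SL3_det.
by move=> i j; exact: ltW.
Qed.

End lattices.

(** * Charts and divergence *)

Section chart.
Variable R : realType.

Definition mx3 (s : seq (seq R)) : 'M[R]_3 := \matrix_(i, j) nth 0 (nth [::] s i) j.

(** The last diagonal entry makes the determinant one; th 5 is kept for y. *)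
Definition lowmx (th : nat -> R) : 'M[R]_3 :=
  mx3 [:: [:: 1 + th 0%N; 0; 0]; [:: th 1%N; 1 + th 2%N; 0];
          [:: th 3%N; th 4%N; ((1 + th 0%N) * (1 + th 2%N))^-1]].

(** Applied to a vector of denominator q, it measures the distance of its position
    to (z, x). *)
Definition unimx (y z x : R) : 'M[R]_3 :=
  mx3 [:: [:: 1; y; - z]; [:: 0; 1; - x]; [:: 0; 0; 1]].

Definition chart (th : nat -> R) (z x : R) : 'M[R]_3 :=
  lowmx th *m unimx (th 5%N) z x.

Lemma sum3 (F : 'I_3 -> R) : \sum_i F i = F 0 + F 1 + F (inord 2).
Proof.
rewrite !big_ord_recl big_ord0 addr0 addrA; congr (_ + F _ + F _); apply: val_inj => //=.
by rewrite inordK.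
Qed.

Lemma det_lowmx th : 1 + th 0%N != 0 -> 1 + th 2%N != 0 -> \det (lowmx th) = 1.
Proof.
move=> h0 h2; rewrite det_trig.
  rewrite !big_ord_recl big_ord0 !mxE /= mulr1 mulrA mulfV //.
  by rewrite mulf_neq0.
by apply/is_trig_mxP => -[[|[|[|//]]] ?] [[|[|[|//]]] ?] //= _; rewrite !mxE.
Qed.

Lemma det_unimx y z x : \det (unimx y z x) = 1.
Proof.
rewrite -det_tr det_trig; first by rewrite !big_ord_recl big_ord0 !mxE /= !mulr1.
by apply/is_trig_mxP => -[[|[|[|//]]] ?] [[|[|[|//]]] ?] //= _; rewrite !mxE.
Qed.

Lemma det_chart th z x : 0 <= th 0%N -> 0 <= th 2%N -> \det (chart th z x) = 1.
Proof.
by move=> h0 h2; rewrite det_mulmx det_lowmx ?det_unimx ?mulr1 // gt_eqF // ltr_pwDl.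
Qed.

Definition col3 (a b c : R) : 'cV[R]_3 := \col_i nth 0 [:: a; b; c] i.

Lemma unimx_mul y z x p1 p2 q :
  unimx y z x *m col3 p1 p2 q = col3 (p1 + y * p2 - q * z) (p2 - q * x) q.
Proof.
apply/colP => i; rewrite !mxE sum3 !mxE inordK //=.
by case: i => [[|[|[|//]]] ?] /=; ring.
Qed.

Lemma lowmx_mul th a b c : lowmx th *m col3 a b c =
  col3 ((1 + th 0%N) * a) (th 1%N * a + (1 + th 2%N) * b)
       (th 3%N * a + th 4%N * b + ((1 + th 0%N) * (1 + th 2%N))^-1 * c).
Proof.
apply/colP => i; rewrite !mxE sum3 !mxE inordK //=.
by case: i => [[|[|[|//]]] ?] /=; ring.
Qed.

Lemma flow_mul (w1 w2 t a b c : R) : flow w1 w2 t *m col3 a b c =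
  col3 (expR (w1 * t) * a) (expR (w2 * t) * b) (expR (- t) * c).
Proof.
apply/colP => i; rewrite !mxE sum3 !mxE.
case: i => [[|[|[|//]]] ?] /=; rewrite -!val_eqE /= inordK //=; ring.
Qed.

(** The vectors (p1 + y p2, p2, q); tracking them with the shear by y already applied
    leaves only (z, x) to the tree. *)
Definition in_lattice (y : R) (v : vec R) : Prop :=
  exists p1 p2 q : int, v = (p1%:~R + y * p2%:~R, p2%:~R, q%:~R).

Lemma in_lattice_icomb y i j c u w v : in_lattice y u -> in_lattice y w ->
  in_lattice y v -> in_lattice y (icomb i j c u w v).
Proof.
move=> [a1 [a2 [a3 ->]]] [b1 [b2 [b3 ->]]] [c1 [c2 [c3 ->]]].
exists (i * a1 + j * b1 + c * c1), (i * a2 + j * b2 + c * c2), (i * a3 + j * b3 + c * c3).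
rewrite /icomb /= !intrD !intrM; congr ((_, _), _); ring.
Qed.

Definition state_in_lattice y (st : state R) : Prop :=
  [/\ in_lattice y st.1.1, in_lattice y st.1.2 & in_lattice y st.2].

Lemma child_in_lattice y st st' : child_of st st' ->
  state_in_lattice y st -> state_in_lattice y st'.
Proof.
by move=> [i [j [c [i' [j' ->]]]]] [h1 h2 h3]; split; exact: in_lattice_icomb.
Qed.

(** Every large time lies in a window. *)
Lemma bracket (s : nat -> R) (k0 : nat) (t : R) : s k0 <= t ->
  (exists n, (k0 <= n)%N && (t < s n)) ->
  exists k, [/\ (k0 <= k)%N, s k <= t & t <= s k.+1].
Proof.
move=> h0 hex; case: (ex_minnP hex) => -[|n] /andP[kn tn] hmin.
  by move: kn h0; rewrite leqn0 => /eqP ->; rewrite leNgt tn.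
move: kn; rewrite leq_eqVlt => /orP[/eqP e|kn].
  by move: h0; rewrite e leNgt tn.
exists n; split => //; last exact: ltW.
rewrite leNgt; apply/negP => h.
by have := hmin n; rewrite h andbT => /(_ kn); rewrite ltnn.
Qed.

End chart.

Section divergence.
Variables (R : realType) (w e T0 : R).
Hypotheses (w0 : 0 < w) (e0 : 0 < e) (hww : e <= 1 - w - w) (T00 : 0 < T0).
Variables (th : nat -> R) (z x : R) (st : nat -> state R).
Hypothesis th_bounds : forall j, 0 <= th j <= 1.
Hypothesis st_good : forall k, good (scQ (level e T0 k)) (scX w e (level e T0 k))
  (scY w e (level e T0 k)) (st k).
Hypothesis st_near : forall k,
  `|posX (st k) - z| <= aX w e T0 k /\ `|posY (st k) - x| <= bY w e T0 k.

Let lev := level e T0.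

Let q_bounds k : scQ (lev k) <= (st k).2.2 <= 2 * scQ (lev k).
Proof. by case: (st_good k). Qed.

Let levS k : lev k.+1 = (1 + e) * lev k. Proof. exact: levelS. Qed.

Let lev_gt0 k : 0 < lev k.
Proof. by rewrite /lev /level mulr_gt0 // exprn_gt0 // addr_gt0. Qed.

Let lev_le k : lev k <= lev k.+1.
Proof. by rewrite levS mulrDl mul1r lerDl mulr_ge0 // ltW. Qed.

Lemma level_unbounded (M : R) : exists n, M < lev n.
Proof.
have h n : T0 * (1 + n%:R * e) <= lev n.
  elim: n => [|n IH]; first by rewrite mul0r addr0 mulr1 /lev /level expr0 mul1r.
  rewrite levS mulrDl mul1r -natr1.
  have h1 : T0 <= lev n.
    by apply: le_trans IH; rewrite ler_peMr ?(ltW T00) // lerDl mulr_ge0 // ltW.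
  have h2 : e * T0 <= e * lev n by rewrite ler_pM2l.
  by move: IH h2; rewrite !mulrDr; lra.
exists (Num.truncn (M / (T0 * e))).+1; apply: lt_le_trans (h _).
have := truncnS_gt (M / (T0 * e)); rewrite ltr_pdivrMr ?mulr_gt0 // => /lt_le_trans; apply.
by rewrite mulrDr mulr1 mulrCA mulrA [leRHS]addrC -mulrA (mulrC T0) lerDl ltW.
Qed.

(** The first two coordinates have size exp(-e^2 t_{k+1}) at time t_{k+1}, by the loss
    e^2 in the scales, and the last one decays once t exceeds t_k; the windows are
    delayed by the factor 1 + e^2 / 2 to share the gain between them. The lower
    triangular part costs a constant, because the flow contracts the entries below
    the diagonal. *)
Lemma short_at (k : nat) (t : R) :
  (1 + e ^+ 2 / 2) * lev k <= t -> t <= (1 + e ^+ 2 / 2) * lev k.+1 ->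
  let v := (st k).2 in
  forall i, `|(flow (1 - w) w t *m (chart th z x *m
     col3 (v.1.1 - th 5%N * v.1.2) v.1.2 v.2)) i 0| <=
    36 * expR (- (e ^+ 2 / 2) * lev k).
Proof.
move=> t1 t2 v i; have [n1 n2] := st_near k; have /andP[q1 q2] := q_bounds k.
have Q0 : 0 < scQ (lev k) by exact: expR_gt0.
have v0 : 0 < v.2 by exact: lt_le_trans q1.
have l0 := lev_gt0 k; have ll := lev_le k.
have w1 : 0 < 1 - w by move: hww e0 w0; lra.
have t0 : 0 < t by apply: lt_le_trans t1; rewrite mulr_gt0 // addr_gt0 // divr_gt0 // exprn_gt0.
set E := expR (- (e ^+ 2 / 2) * lev k).
pose a := v.1.1 - v.2 * z; pose b := v.1.2 - v.2 * x.
have ea : a = v.2 * (posX (st k) - z) by rewrite /a /posX -/v; field; rewrite gt_eqF.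
have eb : b = v.2 * (posY (st k) - x) by rewrite /b /posY -/v; field; rewrite gt_eqF.
have e2 : 0 < e ^+ 2 by rewrite exprn_gt0.
have c0 : 0 < e ^+ 2 / 2 by rewrite divr_gt0.
have ha : expR ((1 - w) * t) * `|a| <= 8 * E.
  have h1 : `|a| <= 2 * scQ (lev k) * aX w e T0 k.
    by rewrite ea normrM (gtr0_norm v0); apply: ler_pM => //; exact: ltW.
  have h2 : 2 * scQ (lev k) * aX w e T0 k = 8 * expR ((w - e ^+ 2 - 1) * lev k.+1).
    rewrite /aX -/lev bxXE levS /scQ (_ : 2 * expR (lev k) * (4 * _) = 8 * (expR (lev k) * expR ((w - e ^+ 2) * ((1 + e) * lev k) - lev k - (1 + e) * lev k))); last by ring.
    by rewrite -expRD; congr (_ * expR _); ring.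
  rewrite h2 in h1; apply: (@le_trans _ _ (expR ((1 - w) * t) * (8 * expR ((w - e ^+ 2 - 1) * lev k.+1)))).
    by rewrite ler_pM2l ?expR_gt0.
  rewrite mulrCA ler_pM2l // -expRD ler_expR.
  have h3 : (1 - w) * t <= (1 - w) * ((1 + e ^+ 2 / 2) * lev k.+1) by rewrite ler_pM2l.
  have h4 : (e ^+ 2 / 2) * lev k <= (1 + w) * (e ^+ 2 / 2) * lev k.+1.
    apply: ler_pM; [exact: ltW|exact: ltW| |exact: ll].
    by rewrite ler_peMl ?(ltW c0) //; move: w0; lra.
  move: h3 h4; move: (lev k.+1) (lev k) => L' L; move: (e ^+ 2) => ee; lra.
have hb : expR (w * t) * `|b| <= 8 * E.
  have h1 : `|b| <= 2 * scQ (lev k) * bY w e T0 k.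
    by rewrite eb normrM (gtr0_norm v0); apply: ler_pM => //; exact: ltW.
  have h2 : 2 * scQ (lev k) * bY w e T0 k = 8 * expR ((1 - w - e ^+ 2 - 1) * lev k.+1).
    rewrite /bY -/lev bxYE levS /scQ (_ : 2 * expR (lev k) * (4 * _) = 8 * (expR (lev k) * expR ((1 - w - e ^+ 2) * ((1 + e) * lev k) - lev k - (1 + e) * lev k))); last by ring.
    by rewrite -expRD; congr (_ * expR _); ring.
  rewrite h2 in h1; apply: (@le_trans _ _ (expR (w * t) * (8 * expR ((1 - w - e ^+ 2 - 1) * lev k.+1)))).
    by rewrite ler_pM2l ?expR_gt0.
  rewrite mulrCA ler_pM2l // -expRD ler_expR.
  have h3 : w * t <= w * ((1 + e ^+ 2 / 2) * lev k.+1) by rewrite ler_pM2l.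
  have h4 : (e ^+ 2 / 2) * lev k <= (2 - w) * (e ^+ 2 / 2) * lev k.+1.
    apply: ler_pM; [exact: ltW|exact: ltW| |exact: ll].
    by rewrite ler_peMl ?(ltW c0) //; move: w1; lra.
  move: h3 h4; move: (lev k.+1) (lev k) => L' L; move: (e ^+ 2) => ee; lra.
have hc : expR (- t) * v.2 <= 2 * E.
  apply: (@le_trans _ _ (expR (- t) * (2 * scQ (lev k)))); first by rewrite ler_pM2l ?expR_gt0.
  rewrite mulrCA ler_pM2l // /scQ -expRD ler_expR.
  by move: t1; rewrite mulrDl mul1r; lra.
have [th0 th1 th2 th3 th4] : [/\ 0 <= th 0%N <= 1, 0 <= th 1%N <= 1, 0 <= th 2%N <= 1,
  0 <= th 3%N <= 1 & 0 <= th 4%N <= 1] by split.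
rewrite -mulmxA unimx_mul.
rewrite (_ : v.1.1 - _ + _ - _ = a); last by rewrite /a; ring.
rewrite -/b lowmx_mul flow_mul mxE; clearbody a b.
have E0 : 0 < E by exact: expR_gt0.
have A0 : 0 <= `|a| := normr_ge0 a.
have B0 : 0 <= `|b| := normr_ge0 b.
have ha2 : expR (w * t) * `|a| <= 8 * E.
  apply: le_trans ha; apply: ler_wpM2r => //; rewrite ler_expR ler_pM2r //.
  by move: hww e0; lra.
have ha3 : expR (- t) * `|a| <= 8 * E.
  apply: le_trans ha; apply: ler_wpM2r => //; rewrite ler_expR.
  by have : 0 < (1 - w) * t by [rewrite mulr_gt0]; move: t0; lra.
have hb3 : expR (- t) * `|b| <= 8 * E.
  apply: le_trans hb; apply: ler_wpM2r => //; rewrite ler_expR.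
  by have : 0 < w * t by [rewrite mulr_gt0]; move: t0; lra.
have mulle (c u B' : R) : 0 <= c <= 2 -> `|u| <= B' -> `|c * u| <= 2 * B'.
  move=> /andP[p0 p2] hu; rewrite normrM (ger0_norm p0).
  by apply: ler_pM.
have le02 (c : R) : 0 <= c <= 1 -> 0 <= c <= 2.
  by case/andP => -> /= /le_trans; apply; rewrite ler1n.
have le12 (c : R) : 0 <= c <= 1 -> 0 <= 1 + c <= 2.
  by case/andP => ? ?; rewrite addr_ge0 //= (_ : 2 = 1 + 1) ?lerD2l.
case: i => [[|[|[|//]]] hi] /=.
- rewrite [X in `|X|]mulrCA.
  have h1 := mulle (1 + th 0%N) (expR ((1 - w) * t) * a) (8 * E).
  have g1 : `|(1 + th 0%N) * (expR ((1 - w) * t) * a)| <= 2 * (8 * E).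
    apply: h1; last by rewrite normrM (gtr0_norm (expR_gt0 _)).
    by exact: le12.
  by move: g1 E0; lra.
- rewrite mulrDr [X in `|X + _|]mulrCA [X in `|_ + X|]mulrCA.
  apply: (le_trans (ler_normD _ _)).
  have h1 := mulle (th 1%N) (expR (w * t) * a) (8 * E).
  have h2 := mulle (1 + th 2%N) (expR (w * t) * b) (8 * E).
  have g1 : `|th 1%N * (expR (w * t) * a)| <= 2 * (8 * E).
    apply: h1; last by rewrite normrM (gtr0_norm (expR_gt0 _)).
    by exact: le02.
  have g2 : `|(1 + th 2%N) * (expR (w * t) * b)| <= 2 * (8 * E).
    apply: h2; last by rewrite normrM (gtr0_norm (expR_gt0 _)).
    by exact: le12.
  by move: g1 g2 E0; lra.
- set l := ((1 + th 0%N) * (1 + th 2%N))^-1.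
  have hl : 0 <= l <= 2.
    case/andP: th0 => ? ?; case/andP: th2 => ? ?.
    rewrite invr_ge0 mulr_ge0 ?addr_ge0 //=.
    apply: (@le_trans _ _ 1); last by lra.
    by rewrite invf_le1 ?mulr_gt0 ?ltr_pwDl // -[leLHS]mulr1; apply: ler_pM; rewrite ?lerDl.
  rewrite !mulrDr [X in `|X + _ + _|]mulrCA [X in `|_ + X + _|]mulrCA [X in `|_ + _ + X|]mulrCA.
  apply: (le_trans (ler_normD _ _)).
  have h1 := mulle (th 3%N) (expR (- t) * a) (8 * E).
  have h2 := mulle (th 4%N) (expR (- t) * b) (8 * E).
  have h3 := mulle l (expR (- t) * v.2) (2 * E) hl.
  have h12 := ler_normD (th 3%N * (expR (- t) * a)) (th 4%N * (expR (- t) * b)).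
  have g3 : `|l * (expR (- t) * v.2)| <= 2 * (2 * E).
    by apply: h3; rewrite ger0_norm // mulr_ge0 ?expR_ge0 // ltW.
  have g1 : `|th 3%N * (expR (- t) * a)| <= 2 * (8 * E).
    apply: h1; last by rewrite normrM (gtr0_norm (expR_gt0 _)).
    by exact: le02.
  have g2 : `|th 4%N * (expR (- t) * b)| <= 2 * (8 * E).
    apply: h2; last by rewrite normrM (gtr0_norm (expR_gt0 _)).
    by exact: le02.
  by move: h12 g1 g2 g3 E0; lra.
Qed.

(** At every large time some v_k is short, and its image is a nonzero vector of the
    lattice: its denominator is positive. *)
Lemma divergent_chart (h : \det (chart th z x) = 1) :
  state_in_lattice (th 5%N) (st 0%N) ->
  (forall k, child_of (st k) (st k.+1)) ->
  divergent_set (1 - w) w (L3_proj (mkSL3 h)).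
Proof.
move=> st0 stS K cK.
have stL k : state_in_lattice (th 5%N) (st k).
  by elim: k => // k; apply: child_in_lattice.
have [eps eps0 hK] := compact_systole cK.
have c0 : 0 < e ^+ 2 / 2 by rewrite divr_gt0 ?exprn_gt0.
(* from the k0-th window on, the bound of short_at is below eps *)
have [k0 hk0] := level_unbounded (ln (36 / eps) / (e ^+ 2 / 2)).
have s1 : 0 < 1 + e ^+ 2 / 2 by rewrite addr_gt0.
have mono i j : (i <= j)%N -> lev i <= lev j.
  by move=> /subnK <-; elim: (j - i)%N => // n IH; apply: le_trans (lev_le _).
exists ((1 + e ^+ 2 / 2) * lev k0); first by rewrite mulr_gt0.
move=> t ht [L KL eL].
have [|k [kk t1 t2]] := @bracket R (fun k => (1 + e ^+ 2 / 2) * lev k) k0 t ht.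
  have [n hn] := level_unbounded (t / (1 + e ^+ 2 / 2)).
  exists (maxn k0 n); rewrite leq_maxl /=.
  rewrite [ltRHS]mulrC -ltr_pdivrMr //; apply: lt_le_trans hn _; apply: mono.
  exact: leq_maxr.
have small := short_at t1 t2.
have [_ _ [p1 [p2 [p3 ev]]]] := stL k.
set v := (st k).2 in ev small.
pose m : 'cV[int]_3 := \col_i nth 0 [:: p1; p2; p3] i.
have em : map_mx intr m = col3 (v.1.1 - th 5%N * v.1.2) v.1.2 v.2.
  apply/colP => i; rewrite !mxE ev /=.
  by case: i => [[|[|[|//]]] ?] //=; ring.
have inL : L3_val L (flow (1 - w) w t *m (chart th z x *m map_mx intr m)).
  rewrite eL; exists (chart th z x *m map_mx intr m) => //.
  by rewrite L3_val_proj; exists m.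
have hE : 36 * expR (- (e ^+ 2 / 2) * lev k) < eps.
  have hl : ln (36 / eps) < (e ^+ 2 / 2) * lev k.
    rewrite [ltRHS]mulrC -ltr_pdivrMr //; apply: lt_le_trans hk0 _; exact: mono.
  rewrite mulNr expRN ltr_pdivrMr ?expR_gt0 // [ltRHS]mulrC -ltr_pdivrMr //.
  by rewrite -ltr_ln ?posrE ?expR_gt0 ?divr_gt0 // expRK.
rewrite em in inL.
have v0 := hK L KL _ inL (fun i => le_lt_trans (small i) hE).
have q0 : 0 < v.2.
  by case/andP: (q_bounds k) => + _; apply: lt_le_trans; exact: expR_gt0.
move: v0; rewrite -mulmxA unimx_mul lowmx_mul flow_mul => v0.
have l0 : 0 < 1 + th 0%N by rewrite ltr_pwDl //; case/andP: (th_bounds 0).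
have l2 : 0 < 1 + th 2%N by rewrite ltr_pwDl //; case/andP: (th_bounds 2).
have ent c i := congr1 (fun M : 'cV[R]_3 => M i c) v0.
have := ent 0 0; rewrite !mxE /= => /eqP.
rewrite !mulf_eq0 (gt_eqF (expR_gt0 _)) (gt_eqF l0) /= => /eqP ha.
have := ent 0 1; rewrite !mxE /= ha mulr0 add0r => /eqP.
rewrite !mulf_eq0 (gt_eqF (expR_gt0 _)) (gt_eqF l2) /= => /eqP hb.
have := ent 0 (inord 2); rewrite !mxE inordK //= ha hb !mulr0 !add0r => /eqP.
by rewrite !mulf_eq0 invr_eq0 mulf_eq0 (gt_eqF (expR_gt0 _)) (gt_eqF l0) (gt_eqF l2) (gt_eqF q0).
Qed.

End divergence.

(** * Lengths of curves *)

Section curves.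
Variable R : realType.

(** The integral of a nonnegative function is a supremum over the simple functions
    below it, hence monotone for arbitrary functions, such as the speed of a curve. *)
Lemma subset_le_integral (D E : set R) (f g : R -> R) : (D `<=` E)%classic ->
  (forall t, 0 <= f t) -> (forall t, 0 <= g t) -> (forall t, D t -> g t <= f t) ->
  (\int[lebesgue_measure]_(t in D) (g t)%:E <=
   \int[lebesgue_measure]_(t in E) (f t)%:E)%E.
Proof.
move=> DE f0 g0 gf; rewrite !ge0_integralE; last 2 first.
- by move=> t _; rewrite lee_fin.
- by move=> t _; rewrite lee_fin.
apply: ereal_sup_le => _ [h hg <-]; exists h => // t.
apply: le_trans (hg t) _; rewrite /patch; case: ifPn => [/set_mem Dt|_].
  by rewrite mem_set; [rewrite lee_fin; exact: gf|exact: DE].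
by case: ifP => // _; rewrite lee_fin.
Qed.

(** The displacement is at most the integral of the absolute value of the derivative,
    which the integral of f dominates by [subset_le_integral]. *)
Lemma displacement_le (u f : R -> R) (k tau : R) :
  (forall t, derivable u t 1) -> continuous (derive1 u) -> 0 < k -> 0 < tau <= 1 ->
  (forall t, 0 <= f t) ->
  (forall t, 0 < t < tau -> k * `|derive1 u t| <= f t) ->
  ((k * `|u tau - u 0|)%:E <=
    \int[lebesgue_measure]_(t in `[0%R, 1%R]%classic) (f t)%:E)%E.
Proof.
move=> du cu k0 /andP[tau0 tau1] f0 hf.
have cuu : continuous u by move=> t; apply/differentiable_continuous/derivable1_diffP.
have wcu : ({within `[0%R, tau]%classic, continuous (derive1 u)})%classic.
  by apply: continuous_subspaceT.
have e : (\int[lebesgue_measure]_(t in `[0%R, tau]%classic) (derive1 u t)%:E = (u tau)%:E - (u 0)%:E)%E.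
  apply: continuous_FTC2 => //.
  split; first by move=> t _; exact: du.
    by apply: cvg_at_right_filter; exact: cuu.
  by apply: cvg_at_left_filter; exact: cuu.
have mu' : measurable_fun `[0%R, tau]%classic (EFin \o derive1 u).
  apply/measurable_EFinP; apply: measurable_funTS.
  exact: continuous_measurable_fun.
have h1 : (`|u tau - u 0|%:E <= \int[lebesgue_measure]_(t in `[0%R, tau]%classic) `|derive1 u t|%:E)%E.
  by have := le_abse_integral lebesgue_measure (measurable_itv `[0%R, tau]) mu'; rewrite /= e.
have h2 : (k%:E * (\int[lebesgue_measure]_(t in `[0%R, tau]%classic) `|derive1 u t|%:E) =
   \int[lebesgue_measure]_(t in `[0%R, tau]%classic) (k * `|derive1 u t|)%:E)%E.
  rewrite -ge0_integralZl //=.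
  - by apply/measurable_EFinP; apply: measurableT_comp => //; apply/measurable_EFinP.
  - by rewrite lee_fin ltW.
rewrite EFinM; apply: (@le_trans _ _ (k%:E * (\int[lebesgue_measure]_(t in `[0%R, tau]%classic) `|derive1 u t|%:E))%E).
  by apply: lee_wpmul2l => //; rewrite lee_fin ltW.
rewrite h2 integral_itv_bndoo; last first.
  by apply/measurable_EFinP; apply: measurable_funM => //; apply: measurableT_comp => //; apply: measurable_funTS; exact: continuous_measurable_fun.
apply: subset_le_integral => //.
- by move=> t /=; rewrite !in_itv /= => /andP[? ?]; apply/andP; split; [exact: ltW|apply: le_trans tau1; exact: ltW].
by move=> t; rewrite mulr_ge0 // ltW.
Qed.

Lemma derive1_entry (M : R -> 'M[R]_3) (t : R) i j : derivable M t 1 ->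
  derivable (fun s => M s i j) t 1 /\ derive1 (fun s => M s i j) t = derive1 M t i j.
Proof.
move=> dM; split; first by move/derivable_mxP: dM.
by rewrite !derive1E derive_mx // mxE.
Qed.

Lemma derive1_mulmxr (M : R -> 'M[R]_3) (B : 'M[R]_3) (t : R) : derivable M t 1 ->
  derivable (fun s => M s *m B) t 1 /\
  derive1 (fun s => M s *m B) t = derive1 M t *m B.
Proof.
move=> dM.
have h i j : is_derive t 1 (fun s => (M s *m B) i j) ((derive1 M t *m B) i j).
  have -> : (fun s => (M s *m B) i j) = \sum_k (fun s => B k j * M s i k).
    by apply/funext => s; rewrite mxE fct_sumE; apply: eq_bigr => k _; rewrite mulrC.
  have -> : (derive1 M t *m B) i j = \sum_k B k j *: derive1 M t i k.
    by rewrite mxE; apply: eq_bigr => k _; rewrite mulrC.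
  apply: is_derive_sum => k.
  have [d1 <-] := derive1_entry i k dM.
  apply: is_deriveZ; apply: DeriveDef => //.
  by rewrite derive1E.
have d : derivable (fun s => M s *m B) t 1.
  by apply/derivable_mxP => i j; case: (h i j).
split => //; apply/matrixP => i j.
have [_ <-] := derive1_entry i j d.
by rewrite derive1E; case: (h i j).
Qed.

(** Written with natural number indices so that the expansion computes. *)
Lemma det33 (A : 'M[R]_3) (F := fun i j => A (inord i) (inord j)) : \det A =
  F 0%N 0%N * (F 1%N 1%N * F 2%N 2%N - F 1%N 2%N * F 2%N 1%N)
  - F 0%N 1%N * (F 1%N 0%N * F 2%N 2%N - F 1%N 2%N * F 2%N 0%N)
  + F 0%N 2%N * (F 1%N 0%N * F 2%N 1%N - F 1%N 1%N * F 2%N 0%N).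
Proof.
have hA i j : A i j = F i j by rewrite /F !inord_val.
clearbody F.
rewrite (expand_det_row _ 0) !big_ord_recl big_ord0 /cofactor.
rewrite !(expand_det_row _ 0) !big_ord_recl !big_ord0 /cofactor !det_mx11 !mxE !hA /= /bump /=.
rewrite !(addn0, add0n, add1n) !expr0 !expr1 sqrrN expr1n; ring.
Qed.

Lemma derive_det3_id (f : nat -> nat -> R -> R) (df : nat -> nat -> R) (t : R) :
  (forall i j, is_derive t 1 (f i j) (df i j)) ->
  (forall i j, (i < 3)%N -> (j < 3)%N -> f i j t = (i == j)%:R) ->
  'D_1 (f 0%N 0%N * (f 1%N 1%N * f 2%N 2%N - f 1%N 2%N * f 2%N 1%N)
    - f 0%N 1%N * (f 1%N 0%N * f 2%N 2%N - f 1%N 2%N * f 2%N 0%N)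
    + f 0%N 2%N * (f 1%N 0%N * f 2%N 1%N - f 1%N 1%N * f 2%N 0%N)) t =
  df 0%N 0%N + df 1%N 1%N + df 2%N 2%N.
Proof.
move=> hf ft; rewrite derive_val !fctE !ft // /GRing.scale /=; ring.
Qed.

(** Differentiate det = 1: the derivative of the determinant at the identity is the
    trace. *)
Lemma trace_velocity (c : R -> @SL3 R) t : C1_curve c -> \tr (velocity c t) = 0.
Proof.
move=> [dc _].
set B := invmx (mx_curve c t).
have [dn en] := derive1_mulmxr B (dc t).
pose n s := mx_curve c s *m B; rewrite -/n in dn en.
have mu : mx_curve c t \in unitmx by rewrite unitmxE SL3_det unitr1.
have nt : n t = 1%:M by rewrite /n mulmxV.
have dB : \det B = 1 by rewrite det_inv SL3_det invr1.
have dn1 s : \det (n s) = 1 by rewrite det_mulmx dB mulr1 SL3_det.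
rewrite /velocity -/B -en.
have h i j : is_derive t 1 (fun s => n s (inord i) (inord j)) (derive1 n t (inord i) (inord j)).
  by have [d1 <-] := derive1_entry (inord i) (inord j) dn; apply: DeriveDef => //; rewrite derive1E.
pose f i j := (fun s => n s (inord i) (inord j)).
have ft i j : (i < 3)%N -> (j < 3)%N -> f i j t = (i == j)%:R.
  by move=> i3 j3; rewrite /f nt mxE -val_eqE /= !inordK.
have hf i j : is_derive t 1 (f i j) (derive1 n t (inord i) (inord j)) by exact: h.
have e : f 0%N 0%N * (f 1%N 1%N * f 2%N 2%N - f 1%N 2%N * f 2%N 1%N)
  - f 0%N 1%N * (f 1%N 0%N * f 2%N 2%N - f 1%N 2%N * f 2%N 0%N)
  + f 0%N 2%N * (f 1%N 0%N * f 2%N 1%N - f 1%N 1%N * f 2%N 0%N) = cst 1.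
  by apply/funext => s; rewrite /cst -(dn1 s) det33.
have {e} := congr1 (fun g : R -> R => 'D_1 g t) e.
rewrite derive_cst (@derive_det3_id f _ t hf ft).
rewrite /mxtrace !big_ord_recl big_ord0.
have -> : ord0 = inord 0 :> 'I_3 by apply: val_inj; rewrite /= inordK.
have -> : lift (inord 0) (ord0 : 'I_2) = inord 1 :> 'I_3 by apply: val_inj; rewrite /= inordK //= inordK.
have -> : lift (inord 0) (lift ord0 (ord0 : 'I_1)) = inord 2 :> 'I_3 by apply: val_inj; rewrite /= inordK //= inordK.
by move=> h0; rewrite -[RHS]h0; ring.
Qed.

End curves.

(** * Local positivity of the metric *)

Section metric.
Variables (R : realType) (Q : riemannian_metric R).

(** A spanning family of the matrices of trace zero, indexed like the entries, so
    that the entries of X are its coefficients ([sl3_decomp]). *)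
Definition sl3_generator (p : 'I_3 * 'I_3) : 'M[R]_3 :=
  delta_mx p.1 p.2 - (p.1 == p.2)%:R *: delta_mx ord_max ord_max.

Lemma tr_delta (i j : 'I_3) : \tr (delta_mx i j : 'M[R]_3) = (i == j)%:R.
Proof.
rewrite /mxtrace (bigD1 i) //= big1 ?addr0 => [|k /negbTE ki]; rewrite mxE ?eqxx //.
by rewrite ki.
Qed.

Lemma tr_sl3_generator p : \tr (sl3_generator p) = 0.
Proof. by rewrite raddfB /= mxtraceZ !tr_delta eqxx mulr1 subrr. Qed.

Lemma sl3_decomp (X : 'M[R]_3) : \tr X = 0 ->
  X = \sum_p X p.1 p.2 *: sl3_generator p.
Proof.
move=> tX; transitivity (\sum_p (X p.1 p.2 *: delta_mx p.1 p.2 : 'M[R]_3)).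
  by rewrite {1}[X]matrix_sum_delta pair_bigA.
under [RHS]eq_bigr do rewrite scalerBr scalerA.
rewrite sumrB -scaler_suml.
suff -> : \sum_(p : 'I_3 * 'I_3) X p.1 p.2 * (p.1 == p.2)%:R = \tr X by rewrite tX scale0r subr0.
rewrite -(pair_bigA _ (fun i j => X i j * (i == j)%:R)) /=; apply: eq_bigr => i _.
rewrite (bigD1 i) //= eqxx mulr1 big1 ?addr0 // => j /negbTE ji.
by rewrite eq_sym ji mulr0.
Qed.

Lemma form0l L Z : \tr Z = 0 -> Q L 0 Z = 0.
Proof.
move=> tZ; have := @rm_linear _ Q L 1 0 0 Z (mxtrace0 _ _) (mxtrace0 _ _) tZ.
by rewrite scaler0 addr0 mul1r => /eqP; rewrite -subr_eq subrr => /eqP.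
Qed.

Lemma form_sum L (a : 'I_3 * 'I_3 -> R) Z : \tr Z = 0 ->
  Q L (\sum_p a p *: sl3_generator p) Z = \sum_p a p * Q L (sl3_generator p) Z.
Proof.
move=> tZ.
have h : forall s, \tr (\sum_(p <- s) a p *: sl3_generator p) = 0 /\
    Q L (\sum_(p <- s) a p *: sl3_generator p) Z = \sum_(p <- s) a p * Q L (sl3_generator p) Z.
  elim=> [|p s [t0 IH]]; first by rewrite !big_nil mxtrace0 form0l.
  rewrite !big_cons; split.
    by rewrite raddfD /= mxtraceZ tr_sl3_generator mulr0 t0 addr0.
  by rewrite rm_linear // ?tr_sl3_generator // IH.
by case: (h (index_enum _)).
Qed.

(** The smoothness of a metric concerns its values on fixed pairs of matrices; this
    reduces the quadratic form to finitely many of them. *)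
Lemma form_quad L (X : 'M[R]_3) : \tr X = 0 ->
  Q L X X = \sum_p \sum_q X p.1 p.2 * X q.1 q.2 * Q L (sl3_generator p) (sl3_generator q).
Proof.
move=> tX; rewrite {1}(sl3_decomp tX) form_sum //; apply: eq_bigr => p _.
rewrite rm_sym // ?tr_sl3_generator // {2}(sl3_decomp tX) form_sum ?tr_sl3_generator //.
rewrite mulr_sumr; apply: eq_bigr => q _.
by rewrite mulrA (@rm_sym _ Q _ (sl3_generator q)) ?tr_sl3_generator.
Qed.

Lemma form_ge0 L (X : 'M[R]_3) : \tr X = 0 -> 0 <= Q L X X.
Proof.
by move=> tX; have [->|X0] := eqVneq X 0; [rewrite form0l ?mxtrace0|apply/ltW/rm_pos].
Qed.

Let vcoord (v : 'rV[R]_(3 * 3)) (p : 'I_3 * 'I_3) : R := v 0 (mxvec_index p.1 p.2).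

(** The form has a positive minimum on the compact unit sphere of sl_3. *)
Lemma metric_lower_bound_at L : exists2 k : R, 0 < k &
  forall X, \tr X = 0 -> forall i j, k * X i j ^+ 2 <= Q L X X.
Proof.
pose phi v := \sum_p \sum_q vcoord v p * vcoord v q * Q L (sl3_generator p) (sl3_generator q).
pose trv v := \sum_i vcoord v (i, i).
pose S : set 'rV[R]_(3 * 3) := fun v => `|v| = 1 /\ trv v = 0.
have cc p : continuous (vcoord ^~ p) by exact: coord_continuous.
have cphi : continuous phi.
  apply: continuous_big => // [|p _]; first by move=> x; apply: add_continuous.
  apply: continuous_big => // [|q _ v']; first by move=> x; apply: add_continuous.
  have h1 : {for v', continuous (fun v => vcoord v p * vcoord v q)}.
    exact: (continuousM (cc p v') (cc q v')).
  exact: (continuousM h1 (@cst_continuous _ _ (Q L (sl3_generator p) (sl3_generator q)) v')).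
have ctr : continuous trv.
  by apply: continuous_big => // x; apply: add_continuous.
have clS : closed S.
  apply: closedI.
    apply: (preimage_closed _ (@closed_eq _ 1)) => v _.
    exact: norm_continuous.
  by apply: (preimage_closed _ (@closed_eq _ 0)) => v _; exact: ctr.
have cS : compact S.
  apply: bounded_closed_compact => //.
  exists 1; split => // M M1 v [v1 _] /=; rewrite [leLHS]v1; exact: ltW.
have phiE (X : 'M[R]_3) : phi (mxvec X) = \sum_p \sum_q X p.1 p.2 * X q.1 q.2 * Q L (sl3_generator p) (sl3_generator q).
  by apply: eq_bigr => p _; apply: eq_bigr => q _; rewrite /vcoord !mxvecE.
have trvE X : trv (mxvec X) = \tr X by apply: eq_bigr => i _; rewrite /vcoord mxvecE.
have nrm (X : 'M[R]_3) i j : `|X i j| <= `|mxvec X|.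
  rewrite -(mxvecE X) [leRHS]mx_normrE.
  by apply/bigmax_geP; right; exists (0, mxvec_index i j).
have key (X : 'M[R]_3) : \tr X = 0 -> mxvec X != 0 -> S (`|mxvec X|^-1 *: mxvec X).
  move=> tX X0; split.
    by rewrite normrZ normfV normr_id mulVf // normr_eq0.
  rewrite /trv; under eq_bigr do rewrite /vcoord mxE.
  by rewrite -mulr_sumr [X in _ * X]trvE tX mulr0.
have S0 : (S !=set0)%classic.
  pose X0 : 'M[R]_3 := delta_mx ord0 ord_max.
  have tX0 : \tr X0 = 0 by rewrite tr_delta.
  exists (`|mxvec X0|^-1 *: mxvec X0); apply: key => //.
  apply/eqP => /(congr1 (fun v => vec_mx v ord0 ord_max)) /eqP.
  by rewrite mxvecK linear0 !mxE !eqxx oner_eq0.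
have [|v0 /set_mem [v01 tv0] hmin] := EVT_min_rV S0 cS (f := phi).
  by apply: continuous_subspaceT.
have vm0 : vec_mx v0 != 0.
  apply/eqP => /(congr1 mxvec); rewrite vec_mxK linear0 => e.
  by move: v01; rewrite e normr0 => /eqP; rewrite eq_sym oner_eq0.
have tvm : \tr (vec_mx v0) = 0 by rewrite -trvE vec_mxK.
have k0 : 0 < phi v0.
  by rewrite -[v0]vec_mxK phiE -form_quad //; exact: rm_pos.
exists (phi v0) => // X tX i j.
have [e|X0] := eqVneq (mxvec X) 0.
  have -> : X = 0 by rewrite -[X]mxvecK e linear0.
  by rewrite mxE expr0n mulr0 form_ge0 // mxtrace0.
have N0 : 0 < `|mxvec X| by rewrite normr_gt0.
have := hmin _ (mem_set (key _ tX X0)).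
have -> : phi (`|mxvec X|^-1 *: mxvec X) = (`|mxvec X| ^+ 2)^-1 * Q L X X.
  rewrite form_quad // -phiE /phi mulr_sumr; apply: eq_bigr => p _.
  rewrite mulr_sumr; apply: eq_bigr => q _; rewrite /vcoord !mxE.
  set a := mxvec _ _ _; set b := mxvec _ _ _; rewrite -exprVn; ring.
rewrite ler_pdivlMl ?exprn_gt0 // => h; apply: le_trans h.
rewrite mulrC ler_wpM2r ?(ltW k0) // -real_normK ?num_real //.
by rewrite ler_sqr ?nnegrE.
Qed.

(** The coefficients of the form on the spanning family are continuous, so the bound
    at the identity survives nearby with half the constant. *)
Lemma metric_lower_bound : exists k rho : R, [/\ 0 < k, 0 < rho &
  forall m : @SL3 R, (forall i j, `|set_val m i j - (i == j)%:R| <= rho) ->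
  forall X, \tr X = 0 -> forall i j, k * X i j ^+ 2 <= Q (L3_proj m) X X].
Proof.
pose one : @SL3 R := mkSL3 (det1 R 3).
have [k k0 hk] := metric_lower_bound_at (L3_proj one).
have hF (pq : ('I_3 * 'I_3) * ('I_3 * 'I_3)) : exists F : 'M[R]_3 -> R, continuous F /\
    forall g : @SL3 R, F (set_val g) = Q (L3_proj g) (sl3_generator pq.1) (sl3_generator pq.2).
  have [F sF eF] := @rm_smooth _ Q (sl3_generator pq.1) (sl3_generator pq.2)
    (tr_sl3_generator _) (tr_sl3_generator _).
  by exists F; split => //; exact: (sF 0%N).
have [F {}hF] := choice hF.
(* 81 pairs of entries contribute at most half of the bound at the identity *)
pose d := k / 162.
have d0 : 0 < d by rewrite divr_gt0.
have nb : \forall m \near (1%:M : 'M[R]_3), forall pq, `|F pq 1%:M - F pq m| < d.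
  apply: (filter_forall (F := nbhs (1%:M : 'M[R]_3)) (f := fun pq m => `|F pq 1%:M - F pq m| < d)) => pq.
  have [cF _] := hF pq.
  by have /cvgrPdist_lt := cF 1%:M; apply.
have /nbhs_ballP [rho0 /= rho00 hb] := nb.
exists (k / 2), (rho0 / 2); split; [by rewrite divr_gt0|by rewrite divr_gt0|].
move=> m hm X tX i j.
have hm' : forall pq, `|F pq 1%:M - F pq (set_val m)| < d.
  apply: hb; split => // a b; rewrite /ball /= distrC mxE.
  by apply: le_lt_trans (hm a b) _; lra.
pose M := \big[Num.max/0]_(p : 'I_3 * 'I_3) `|X p.1 p.2|.
have XM p : `|X p.1 p.2| <= M by apply: le_bigmax.
have M0 : 0 <= M by apply: le_trans (XM (i, j)).
have kM : k * M ^+ 2 <= Q (L3_proj one) X X.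
  have [p _ ->] : exists2 p : 'I_3 * 'I_3, true & M = `|X p.1 p.2|.
    have [p _ e] := @eq_bigmax _ _ _ (0 : R) (ord0, ord0) xpredT (fun p : 'I_3 * 'I_3 => `|X p.1 p.2|) isT (fun _ _ => normr_ge0 _).
    by exists p.
  by rewrite real_normK ?num_real //; exact: hk.
have dif : Q (L3_proj one) X X - Q (L3_proj m) X X <= 81 * (M ^+ 2 * d).
  rewrite !form_quad // -sumrB.
  have -> : 81 * (M ^+ 2 * d) = \sum_(p : 'I_3 * 'I_3) \sum_(q : 'I_3 * 'I_3) M ^+ 2 * d.
    by rewrite !sumr_const card_prod card_ord -mulrnA mulr_natl.
  apply: ler_sum => p _; rewrite -sumrB; apply: ler_sum => q _.
  rewrite -mulrBr; apply: le_trans (ler_norm _) _; rewrite normrM.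
  apply: ler_pM => //; first by rewrite normrM expr2; apply: ler_pM => //; exact: XM.

  have [_ e1] := hF (p, q); rewrite -(e1 one) -(e1 m).
  by apply/ltW; exact: hm'.
have Xij : X i j ^+ 2 <= M ^+ 2.
  by rewrite -real_normK ?num_real // ler_sqr ?nnegrE //; exact: (XM (i, j)).
have h1 : k / 2 * X i j ^+ 2 <= k / 2 * M ^+ 2 by rewrite ler_pM2l // divr_gt0.
have e2 : 81 * (M ^+ 2 * d) = k / 2 * M ^+ 2 by rewrite /d; field.
by move: dif kM h1; rewrite e2; set a := M ^+ 2; set b := X i j ^+ 2; clearbody a b; lra.
Qed.

End metric.

(** * Comparison of the distance with the matrix entries *)

Section local_comparison.
Variable R : realType.

Definition near_one (b : R) (m : 'M[R]_3) := forall i j, `|m i j - (i == j)%:R| <= b.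

Lemma entry_le_norm (m : 'M[R]_3) i j : `|m i j| <= `|m|.
Proof. by rewrite [leRHS]mx_normrE; apply/bigmax_geP; right; exists (i, j). Qed.

Lemma norm_le_entry (m : 'M[R]_3) (b : R) : 0 <= b -> (forall i j, `|m i j| <= b) -> `|m| <= b.
Proof. by move=> b0 h; rewrite [leLHS]mx_normrE; apply/bigmax_leP; split => // ij _. Qed.

Lemma sub_oneE (m : 'M[R]_3) i j : (m - 1%:M) i j = m i j - (i == j)%:R.
Proof. by rewrite !mxE. Qed.

Lemma near_one_le (b : R) m i j : b <= 1 -> near_one b m -> `|m i j| <= 2.
Proof.
move=> b1 h; have := h i j; case: (i == j); last by rewrite subr0; lra.
move=> /(le_trans (lerB_dist _ _)); rewrite normr1; lra.
Qed.

(** Each column of A - 1 is an integral vector that h sends to a short one. *)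
Lemma unimodular_rigid (h : 'M[R]_3) (A : 'M[int]_3) : \det h = 1 ->
  (forall i j, `|h i j| <= 2) ->
  (forall i j, `|(h *m map_mx intr A) i j - h i j| < 24^-1) -> A = 1%:M.
Proof.
move=> dh h2 hA; apply/matrixP => i j.
have sv := @short_vector_lb _ h 2 (col j A - delta_mx j 0) (ltr0n _ 2) dh h2.
have e : h *m map_mx intr (col j A - delta_mx j 0) =
    col j (h *m map_mx intr A) - col j h.
  by rewrite map_mxB mulmxBr map_delta_mx map_col !colE mulmxA.
have /eqP : col j A - delta_mx j 0 = 0.
  apply: sv => k; rewrite (_ : (6 * 2 ^+ 2 : R) = 24); last by ring.
  by rewrite e !mxE; have := hA k j; rewrite !mxE.
rewrite subr_eq0 => /eqP /(congr1 (fun v : 'cV[int]_3 => v i 0)); rewrite !mxE => ->.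
by rewrite andbT.
Qed.

Variable Q : riemannian_metric R.

(** The curve c A projects to the same curve of lattices as c, and has the same
    velocity V; its derivative is V c A, whose entries are bounded by those of V. *)
Lemma speed_ge (k b : R) (c : R -> @SL3 R) (A : 'M[int]_3) (t : R) :
  0 < k -> b <= 1 -> C1_curve c -> \det A = 1 ->
  (forall m : @SL3 R, near_one b (set_val m) ->
    forall X, \tr X = 0 -> forall i j, k * X i j ^+ 2 <= Q (L3_proj m) X X) ->
  near_one b (mx_curve c t *m map_mx intr A) ->
  forall i j, Num.sqrt k / 6 * `|derive1 (fun s => (mx_curve c s *m map_mx intr A) i j) t|
    <= Num.sqrt (Q (L3_proj (c t)) (velocity c t) (velocity c t)).
Proof.
move=> k0 b1 hc dA hk nm i j; set G := map_mx intr A; set V := velocity c t.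
have trV : \tr V = 0 by exact: trace_velocity.
have [dcG eG] := derive1_mulmxr G (hc.1 t).
have [_ ->] := derive1_entry i j dcG; rewrite eG.
have mu : mx_curve c t \in unitmx by rewrite unitmxE SL3_det unitr1.
have -> : derive1 (mx_curve c) t *m G = V *m (mx_curve c t *m G).
  by rewrite mulmxA /V /velocity mulmxKV.
have dm : \det (mx_curve c t *m G) = 1 by rewrite det_mulmx SL3_det mul1r det_map_mx dA.
have eL : L3_proj (mkSL3 dm) = L3_proj (c t).
  by apply: L3_proj_eq; exact: lattice_of_mul.
rewrite -eL; set S := Num.sqrt (Q _ V V).
have hV l : Num.sqrt k * `|V i l| <= S.
  rewrite -sqrtr_sqr -sqrtrM ?(ltW k0) //; apply: ler_wsqrtr.
  exact: (hk (mkSL3 dm)).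
rewrite mxE; set s := \sum_l _.
have hs : Num.sqrt k * `|s| <= 6 * S.
  apply: (@le_trans _ _ (\sum_(l : 'I_3) (Num.sqrt k * `|V i l| * 2))).
    rewrite -mulr_suml -mulr_sumr -mulrA ler_wpM2l ?sqrtr_ge0 // mulr_suml.
    apply: le_trans (ler_norm_sum _ _ _) _; apply: ler_sum => l _.
    by rewrite normrM ler_wpM2l //; exact: near_one_le nm.
  apply: (@le_trans _ _ (\sum_(l : 'I_3) (S * 2))).
    by apply: ler_sum => l _; rewrite ler_wpM2r.
  by rewrite sumr_const card_ord -mulr_natr; lra.
by rewrite mulrAC ler_pdivrMr // mulrC; rewrite mulrC in hs; lra.
Qed.

(** Multiply a curve that joins the two lattices by an integral matrix so that it starts
    at g. While it stays near the identity, its displacement is bounded by a multiple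
    of its length, which is less than r; so it never leaves. Its endpoint is h A with A integral, and A = 1 as
    both h A and h are near the identity. *)
Lemma dist_lower_bound : exists C rho : R, [/\ 0 < C, 0 < rho &
  forall g h : @SL3 R, near_one rho (set_val g) -> near_one rho (set_val h) ->
  forall r, r <= rho -> (riemannian_dist Q (L3_proj g) (L3_proj h) < r%:E)%E ->
  forall i j, `|set_val g i j - set_val h i j| <= C * r].
Proof.
have [k [rho0 [k0 rho00 hk]]] := metric_lower_bound Q.
(* 100^-1 makes the entries at most 2 and keeps two matrices of the ball closer than
   the 24^-1 asked by unimodular_rigid *)
pose b := Num.min rho0 100^-1.
have b0 : 0 < b by rewrite lt_min rho00 invr_gt0 ltr0n.
have b1 : b <= 100^-1 by rewrite ge_min lexx orbT.
have {hk} hk m : near_one b (set_val m) -> forall X, \tr X = 0 ->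
    forall i j, k * X i j ^+ 2 <= Q (L3_proj m) X X.
  move=> nm; apply: hk => i j; apply: le_trans (nm i j) _.
  by rewrite ge_min lexx.
clearbody b; have b11 : b <= 1 by lra.
pose kap := Num.sqrt k / 6.
have kap0 : 0 < kap by rewrite divr_gt0 ?sqrtr_gt0.
have kb0 : 0 < Num.min (b / 4) (kap * (b / 4)) by rewrite lt_min (divr_gt0 b0 (ltr0n _ 4)) mulr_gt0 ?(divr_gt0 b0 (ltr0n _ 4)).
exists kap^-1, (Num.min (b / 4) (kap * (b / 4))); split => //; first by rewrite invr_gt0.
move=> g h ng nh r; rewrite le_min => /andP[_ rb].
move=> /ereal_inf_lt [_ [c [hc c0 c1] <-] len].
have nb m : near_one (Num.min (b / 4) (kap * (b / 4))) m -> near_one (b / 4) m.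
  by move=> hm i j; apply: le_trans (hm i j) _; rewrite ge_min lexx.
have {}ng := nb _ ng; have {}nh := nb _ nh.
have [A dA eg] := lattice_of_eq (SL3_det g) (SL3_det (c 0)) (congr1 (@L3_val R) (esym c0)).
pose m t := mx_curve c t *m map_mx intr A.
have dm t : derivable m t 1 by case: (derive1_mulmxr (map_mx intr A) (hc.1 t)).
have cm : continuous m by move=> t; apply/differentiable_continuous/derivable1_diffP.
have est tau : 0 < tau <= 1 -> (forall t, 0 < t < tau -> near_one b (m t)) ->
    forall i j, `|m tau i j - set_val g i j| <= kap^-1 * r.
  move=> ht hn i j; rewrite ler_pdivlMl // -lee_fin; apply: le_trans (ltW len).
  rewrite eg; apply: (@displacement_le R (fun s => m s i j)) => //.
  - by move=> t; case: (derive1_entry i j (dm t)).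
  - have -> : derive1 (fun s => m s i j) = fun t => (derive1 (mx_curve c) t *m map_mx intr A) i j.
      apply/funext => t; have [_ ->] := derive1_entry i j (dm t).
      by have [_ ->] := derive1_mulmxr (map_mx intr A) (hc.1 t).
    move=> t.
    have h1 := continuous_comp (hc.2 t) (@mulmxr_continuous R (map_mx intr A) _).
    exact: (continuous_comp h1 (@coord_continuous _ _ _ i j _)).
  - by move=> t t01; apply: (speed_ge k0 b11) => //; exact: hn.
have Cr : kap^-1 * r <= b / 4 by rewrite ler_pdivrMl.
have nt tau : 0 < tau <= 1 -> (forall t, 0 < t < tau -> near_one b (m t)) -> near_one (b / 2) (m tau).
  move=> ht hn i j; have h1 := est _ ht hn i j; have h2 := ng i j.
  have -> : m tau i j - (i == j)%:R = (m tau i j - set_val g i j) + (set_val g i j - (i == j)%:R) by ring.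
  by apply: le_trans (ler_normD _ _) _; lra.
pose N t := `|m t - 1%:M|.
have nN t : N t < b -> near_one b (m t).
  move=> Nb i j; have := entry_le_norm (m t - 1%:M) i j; rewrite sub_oneE.
  by move=> /le_trans; apply; exact: ltW.
have cN : continuous N.
  move=> t; have h1 : {for t, continuous (fun s => m s - 1%:M)}.
    by apply: cvgB; [exact: cm|exact: cvg_cst].
  exact: (continuous_comp h1 (@norm_continuous _ _ _)).
(* at the first exit time tau the estimate est already confines the curve to b / 2 *)
have stay t : 0 < t <= 1 -> N t < b.
  move=> ht; rewrite ltNge; apply/negP => bN.
  pose E : set R := (`[0%R, 1%R] `&` [set s | b <= N s])%classic.
  have cE : compact E.
    apply: subclosed_compact (@segment_compact _ 0 1) _; last by move=> s [].
    apply: closedI; first exact: interval_closed.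
    by apply: (preimage_closed _ (@closed_ge _ b)) => s _; exact: cN.
  have E0 : (E !=set0)%classic.
    by exists t; split => //=; rewrite in_itv /=; move/andP: ht => [/ltW -> ->].
  have [|tau /set_mem [/=]] := compact_EVT_min E0 cE (f := id).
    by apply: continuous_subspaceT => x; exact: cvg_id.
  rewrite in_itv /= => /andP[tau0 tau1] btau tmin.
  have N0 : N 0 <= b / 4.
    apply: norm_le_entry => [|i j]; first by rewrite ltW // divr_gt0 ?ltr0n.
    have em : m 0 = set_val g by rewrite eg.
    by rewrite em sub_oneE; exact: ng.
  have tau_gt0 : 0 < tau.
    rewrite lt_neqAle tau0 andbT; apply/eqP => e.
    by move: btau; rewrite -e; lra.
  have : N tau <= b / 2.
    apply: norm_le_entry => [|i j]; first by rewrite ltW // divr_gt0 ?ltr0n.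
    rewrite sub_oneE; apply: nt; first by rewrite tau_gt0.
    move=> s /andP[s0 st]; apply: nN; rewrite ltNge; apply/negP => bs.
    have : tau <= s.
      apply: tmin; apply/mem_set; split => //=.
      by rewrite in_itv /= (ltW s0) /=; apply: le_trans tau1; exact: ltW.
    by rewrite leNgt st.
  by lra.
have hn t : 0 < t < 1 -> near_one b (m t).
  by move=> /andP[t0 t1]; apply/nN/stay; rewrite t0 ltW.
have h11 : ((0 : R) < 1) && ((1 : R) <= 1) by rewrite ltr01 lexx.
have m1 : m 1 = set_val h.
  have dm1 : \det (m 1) = 1 by rewrite det_mulmx SL3_det mul1r det_map_mx dA.
  have eL : lattice_of (m 1) = lattice_of (set_val h).
    rewrite lattice_of_mul //; exact: (congr1 (@L3_val R) c1).
  have [B dB eB] := lattice_of_eq dm1 (SL3_det h) eL.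
  rewrite eB (@unimodular_rigid (set_val h) B) ?map_mx1 ?mulmx1 //.
  - exact: SL3_det.
  - by move=> i j; apply: near_one_le nh; lra.
  - move=> i j; rewrite -eB.
    have h1 := nt _ h11 hn i j; have h2 := nh i j.
    have -> : m 1 i j - set_val h i j = (m 1 i j - (i == j)%:R) - (set_val h i j - (i == j)%:R) by ring.
    by apply: le_lt_trans (ler_normB _ _) _; lra.
move=> i j; rewrite distrC -m1; exact: est.
Qed.

End local_comparison.

(** * Initial nodes and chart coordinates *)

Section initial_state.
Variable R : realType.

(** An explicit basis of the sheared lattice. The condition on y says that the shear
    changes the first wedge product by at most one. *)
Lemma initial_state (Q0 X0 Y0 y : R) : 1 <= Q0 -> 2 <= X0 -> 2 * X0 <= Y0 ->
  0 <= y -> y * (2 * Y0) <= 1 ->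
  exists st : state R, [/\ good Q0 X0 Y0 st, state_in_lattice y st,
    0 <= posX st <= 2 * X0 / Q0 & 0 <= posY st <= 2 * Y0 / Q0].
Proof.
move=> Q1 X2 XY y0 yY.
have tr (u : R) : 0 <= u -> u <= (Num.truncn u).+1%:R <= u + 1.
  move=> u0; have /andP[h1 h2] := truncn_itv u0.
  by rewrite ltW //= -natr1 lerD2r.
(* v has wedge products m + y s and s with v' = (0, 0, -1), and the determinant is
   s - m h = 1 *)
pose m := (Num.truncn X0).+1; pose h := (Num.truncn (Y0 / m%:R)).+1.
pose q := (Num.truncn Q0).+1.
have m0 : 0 < m%:R :> R by rewrite ltr0n.
have /andP[m1 m2] : X0 <= m%:R <= X0 + 1 by apply: tr; lra.
have /andP[q1 q2] : Q0 <= q%:R <= Q0 + 1 by apply: tr; lra.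
have /andP[h1 h2] : Y0 <= m%:R * h%:R <= Y0 + m%:R.
  have /andP[] : Y0 / m%:R <= h%:R <= Y0 / m%:R + 1 by apply: tr; rewrite divr_ge0 ?ltW //; lra.
  rewrite ler_pdivrMr // mulrC => -> /= hh.
  have := ler_wpM2l (ltW m0) hh.
  by rewrite mulrDr mulr1 mulrCA mulfV ?mulr1 ?gt_eqF.
pose s := 1 + m%:R * h%:R : R.
have s0 : 0 <= s by rewrite /s; lra.
have s2 : s <= 2 * Y0 by rewrite /s; lra.
have ys0 : 0 <= y * s by rewrite mulr_ge0.
have ys1 : y * s <= 1 by apply: le_trans yY; rewrite ler_wpM2l.
pose v : vec R := (m%:R + y * s, s, q%:R).
pose v' : vec R := (0, 0, -1).
pose u : vec R := (-1 - y * h%:R, - h%:R, 0).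
exists (v', u, v); split.
- rewrite /good /wedX /wedY /det3 /v /u /v' /= normrN1.
  split; [lra|lra|rewrite /s; lra|lra|rewrite /s; ring].
- split.
  + by exists 0, 0, (-1); rewrite /v' /= intrN mulr0 addr0.
  + by exists (-1), (- h%:Z), 0; rewrite /u /= !intrN mulrN.
  + by exists m%:Z, (1 + m%:Z * h%:Z), q%:Z; rewrite /v /s /= intrD intrM.
- rewrite /posX /=; apply/andP; split; first by rewrite divr_ge0 //; lra.
  by apply: ler_pM; rewrite ?invr_ge0 ?ler0n ?lef_pV2 ?posrE //; lra.
- rewrite /posY /=; apply/andP; split; first by rewrite divr_ge0 //; lra.
  by apply: ler_pM; rewrite ?invr_ge0 ?ler0n ?lef_pV2 ?posrE //; lra.
Qed.

End initial_state.

Section chart_coordinates.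
Variable R : realType.

(** Coordinates near the identity; those in th are taken nonnegative, as
    one orthant suffices. *)
Definition chart_domain (eta : R) (th : nat -> R) (zx : R * R) : Prop :=
  [/\ forall j, 0 <= th j <= eta, `|zx.1| <= eta & `|zx.2| <= eta].

Lemma mulr_dist_le (a a' b b' A B r s : R) : `|a| <= A -> `|b'| <= B ->
  `|a - a'| <= r -> `|b - b'| <= s -> `|a * b - a' * b'| <= A * s + r * B.
Proof.
move=> hA hB hr hs.
have -> : a * b - a' * b' = a * (b - b') + (a - a') * b' by ring.
apply: le_trans (ler_normD _ _) _; rewrite !normrM.
by apply: lerD; apply: ler_pM.
Qed.

Lemma chart_entries (th : nat -> R) (z x : R) : let g := chart th z x in
  [/\ g 0 0 = 1 + th 0%N, g 0 1 = (1 + th 0%N) * th 5%N, g 0 (inord 2) = - ((1 + th 0%N) * z),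
      g 1 0 = th 1%N & g 1 1 = th 1%N * th 5%N + (1 + th 2%N)] /\
  [/\ g 1 (inord 2) = - (th 1%N * z) - (1 + th 2%N) * x,
      g (inord 2) 0 = th 3%N, g (inord 2) 1 = th 3%N * th 5%N + th 4%N &
      g (inord 2) (inord 2) = - (th 3%N * z) - th 4%N * x + ((1 + th 0%N) * (1 + th 2%N))^-1].
Proof.
by split; split; rewrite /chart !mxE sum3 !mxE !inordK //=; ring.
Qed.

Lemma ord3P (P : 'I_3 -> Prop) : P 0 -> P 1 -> P (inord 2) -> forall i, P i.
Proof.
move=> p0 p1 p2 [[|[|[|//]]] hi].
- by rewrite (_ : Ordinal hi = 0) //; apply: val_inj.
- by rewrite (_ : Ordinal hi = 1) //; apply: val_inj.
- by rewrite (_ : Ordinal hi = inord 2) //; apply: val_inj; rewrite /= inordK.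
Qed.

Lemma inv_prod_near (a b eta : R) : 0 <= a -> a <= eta -> 0 <= b -> b <= eta ->
  eta <= 1 -> `|((1 + a) * (1 + b))^-1 - 1| <= 3 * eta.
Proof.
move=> a0 a1 b0 b1 e1.
have p1 : 1 <= (1 + a) * (1 + b) by have := mulr_ge0 a0 b0; lra.
have p0 : 0 < (1 + a) * (1 + b) by lra.
have ab : a * b <= 1 * eta by apply: ler_pM => //; lra.
have ab0 := mulr_ge0 a0 b0.
rewrite distrC ger0_norm; last by rewrite subr_ge0 invf_le1.
rewrite -(ler_pM2r p0) mulrBl mulVf ?gt_eqF // mul1r.
have : 3 * eta * 1 <= 3 * eta * ((1 + a) * (1 + b)) by apply: ler_wpM2l => //; lra.
by lra.
Qed.

Lemma chart_near_one (eta : R) th zx : eta <= 1 -> chart_domain eta th zx ->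
  near_one (5 * eta) (chart th zx.1 zx.2).
Proof.
case: zx => z x /= e1 [hth /= hz hx].
have /andP[t0 t0'] := hth 0%N; have /andP[t1 t1'] := hth 1%N.
have /andP[t2 t2'] := hth 2%N; have /andP[t3 t3'] := hth 3%N.
have /andP[t4 t4'] := hth 4%N; have /andP[t5 t5'] := hth 5%N.
have [[g00 g01 g02 g10 g11] [g12 g20 g21 g22]] := chart_entries th z x.
have inv_near : `|((1 + th 0%N) * (1 + th 2%N))^-1 - 1| <= 3 * eta by exact: inv_prod_near.
move: (th 0%N) (th 1%N) (th 2%N) (th 3%N) (th 4%N) (th 5%N) t0 t0' t1 t1' t2 t2' t3 t3' t4 t4' t5 t5' g00 g01 g02 g10 g11 g12 g20 g21 g22 inv_near => {hth}.
move=> a0 a1 a2 a3 a4 a5 t0 t0' t1 t1' t2 t2' t3 t3' t4 t4' t5 t5' g00 g01 g02 g10 g11 g12 g20 g21 g22 inv_near.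
have e0 : 0 <= eta by lra.
have pr a b A : `|a| <= A -> `|b| <= eta -> `|a * b| <= A * eta.
  by move=> ha hb; rewrite normrM; apply: ler_pM.
have n a A : 0 <= a -> a <= A -> `|a| <= A by move=> ?; rewrite ger0_norm.
have n0 : `|1 + a0| <= 2 by apply: n; lra.
have n2 : `|1 + a2| <= 2 by apply: n; lra.
have n1 : `|a1| <= 1 by apply: n; lra.
have n3 : `|a3| <= 1 by apply: n; lra.
have n4 : `|a4| <= 1 by apply: n; lra.
have n5 : `|a5| <= eta by apply: n; lra.
have k01 := pr _ _ _ n0 n5; have k02 := pr _ _ _ n0 hz.
have k11 := pr _ _ _ n1 n5; have k12 := pr _ _ _ n1 hz; have k12' := pr _ _ _ n2 hx.
have k21 := pr _ _ _ n3 n5; have k22 := pr _ _ _ n3 hz; have k22' := pr _ _ _ n4 hx.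
have N2 : (inord 2 : 'I_3) == 0 = false by rewrite -val_eqE /= inordK.
have N2' : (inord 2 : 'I_3) == 1 = false by rewrite -val_eqE /= inordK.
by apply: ord3P; apply: ord3P; rewrite ?(g00, g01, g02, g10, g11, g12, g20, g21, g22)
  ?(eq_sym _ (inord 2 : 'I_3)) ?N2 ?N2' ?eqxx /=; move: k01 k02 k11 k12 k12' k21 k22 k22' inv_near;
  rewrite !ler_norml => *; lra.
Qed.

(** The coordinates are recovered from the entries one after the other, by divisions
    by 1 + th 0 and 1 + th 2, which are at least one. *)
Lemma chart_coordinates (th th' : nat -> R) (zx zx' : R * R) (r : R) :
  chart_domain 1 th zx -> chart_domain 1 th' zx' ->
  (forall i j, `|chart th zx.1 zx.2 i j - chart th' zx'.1 zx'.2 i j| <= r) ->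
  [/\ forall j, (j < 6)%N -> `|th j - th' j| <= 8 * r,
      `|zx.1 - zx'.1| <= 8 * r & `|zx.2 - zx'.2| <= 8 * r].
Proof.
case: zx => z x; case: zx' => z' x' [hth /= hz hx] [hth' /= hz' hx'] hg.
have [[g00 g01 g02 g10 g11] [g12 g20 g21 _]] := chart_entries th z x.
have [[g00' g01' g02' g10' g11'] [g12' g20' g21' _]] := chart_entries th' z' x'.
have r0 : 0 <= r by apply: le_trans (hg 0 0).
have nth j : `|th j| <= 1 by have /andP[? ?] := hth j; rewrite ger0_norm.
have nth' j : `|th' j| <= 1 by have /andP[? ?] := hth' j; rewrite ger0_norm.
have big1 (a b B : R) : 1 <= a -> `|a * b| <= B -> `|b| <= B.
  move=> a1; rewrite normrM; apply: le_trans; rewrite ler_peMl //.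
  by rewrite ger0_norm //; lra.
have d0 : `|th 0%N - th' 0%N| <= r.
  by have := hg 0 0; rewrite g00 g00' opprD addrACA subrr add0r.
have d1 : `|th 1%N - th' 1%N| <= r by have := hg 1 0; rewrite g10 g10'.
have d3 : `|th 3%N - th' 3%N| <= r by have := hg (inord 2) 0; rewrite g20 g20'.
have a1 : 1 <= 1 + th 0%N by have /andP[? ?] := hth 0%N; lra.
have l1 : 1 <= 1 + th 2%N by have /andP[? ?] := hth 2%N; lra.
have quot (a a' b b' s t : R) : 1 <= a -> `|b'| <= 1 -> `|a - a'| <= s -> `|a * b - a' * b'| <= t -> `|b - b'| <= s + t.
  move=> h1 hb hs ht; apply: (big1 a _ _ h1).
  have -> : a * (b - b') = (a * b - a' * b') - (a - a') * b' by ring.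
  apply: le_trans (ler_normB _ _) _; rewrite addrC; apply: lerD => //.
  by rewrite normrM -[s]mulr1; apply: ler_pM.
have d0' : `|1 + th 0%N - (1 + th' 0%N)| <= r by rewrite opprD addrACA subrr add0r.
have d5 : `|th 5%N - th' 5%N| <= 2 * r.
  have := hg 0 1; rewrite g01 g01' => h.
  by have := quot _ _ _ _ _ _ a1 (nth' 5%N) d0' h; lra.
have dz : `|z - z'| <= 2 * r.
  have := hg 0 (inord 2); rewrite g02 g02' -opprD normrN => h.
  by have := quot _ _ _ _ _ _ a1 hz' d0' h; lra.
have p15 := mulr_dist_le (nth 1%N) (nth' 5%N) d1 d5.
have p35 := mulr_dist_le (nth 3%N) (nth' 5%N) d3 d5.
have p1z := mulr_dist_le (nth 1%N) hz' d1 dz.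
have d2 : `|1 + th 2%N - (1 + th' 2%N)| <= 4 * r.
  have := hg 1 1; rewrite g11 g11'; move: p15; rewrite !ler_norml; lra.
have d4 : `|th 4%N - th' 4%N| <= 4 * r.
  have := hg (inord 2) 1; rewrite g21 g21'; move: p35; rewrite !ler_norml; lra.
have dx : `|x - x'| <= 8 * r.
  have h : `|(1 + th 2%N) * x - (1 + th' 2%N) * x'| <= 4 * r.
    by have := hg 1 (inord 2); rewrite g12 g12'; move: p1z; rewrite !ler_norml; lra.
  by have := quot _ _ _ _ _ _ l1 hx' d2 h; lra.
split; [|by lra|by lra].
move: d2; rewrite opprD addrACA subrr add0r => d2.
by case=> [|[|[|[|[|[|//]]]]]] _; lra.
Qed.

End chart_coordinates.

Section scale_choice.
Variable R : realType.

(** exp (c t) is the square of exp (c t / 2), hence at least c^2 t^2 / 4. *)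
Lemma expR_beats_linear (c B : R) : 0 < c ->
  exists T0 : R, [/\ 0 < T0, B <= T0 & forall t, T0 <= t -> 4096 * (1 + t) <= expR (c * t)].
Proof.
move=> c0; pose T1 := 4 * 8192 / c ^+ 2.
exists (Num.max (Num.max 1 B) T1); split.
- by rewrite !lt_max ltr01.
- by rewrite !le_max lexx orbT.
move=> t; rewrite !ge_max => /andP[/andP[t1 _]].
rewrite /T1 ler_pdivrMr ?exprn_gt0 // => t2.
have h : 1 + c * t / 2 <= expR (c * t / 2) by exact: expR_ge1Dx.
have -> : c * t = c * t / 2 + c * t / 2 by field.
rewrite expRD.
have p : 0 <= c * t by rewrite mulr_ge0 ?ltW //; lra.
have q : (1 + c * t / 2) * (1 + c * t / 2) <= expR (c * t / 2) * expR (c * t / 2).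
  by apply: ler_pM => //; lra.
apply: le_trans q.
have k : 4 * 8192 * t <= t * c ^+ 2 * t by rewrite ler_wpM2r //; lra.
have e : (1 + c * t / 2) * (1 + c * t / 2) = 1 + c * t + t * c ^+ 2 * t / 4 by field.
by rewrite e; move: k; set a := t * c ^+ 2 * t; lra.
Qed.

End scale_choice.

(** * Fibres of the divergent set *)

Section box.
Variables (R : realType) (w e d T0 eta : R).
Hypotheses (w0 : 0 < w) (e0 : 0 < e) (d1 : d <= 1)
  (he : 40 * e <= d) (hw : 8 * e <= w) (hww : e <= 1 - w - w).
Hypotheses (T00 : 0 < T0)
  (Tbig : forall t, T0 <= t -> 4096 * (1 + t) <= expR (w * e ^+ 2 / 2 * t)).
Hypotheses (eta0 : 0 < eta) (eta1 : eta <= 1) (Teta : 4 / eta <= T0).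

Let sq : [/\ 0 < e ^+ 2, e ^+ 2 <= e, e ^+ 2 <= w / 8 & w * e ^+ 2 <= e ^+ 2].
Proof.
have w2 : w <= 1 by move: e0 hww; lra.
have e1 : e <= 1 by move: w0 hww; lra.
have e8 : e <= w / 8 by move: hw; lra.
have p : 0 < e ^+ 2 by rewrite exprn_gt0.
have h : e ^+ 2 <= e by rewrite expr2 ler_piMr // ltW.
split => //; first exact: le_trans h e8.
by rewrite ler_piMl // ltW.
Qed.

Let rate_le (a : R) : w * e ^+ 2 / 2 <= a -> 4096 * (1 + T0) <= expR (a * T0).
Proof. by move=> h; apply: le_trans (Tbig (lexx _)) _; rewrite ler_expR ler_pM2r. Qed.

Let small_le (a b : R) : b <= 4 -> w * e ^+ 2 / 2 <= a -> b * expR (- (a * T0)) <= eta / 2.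
Proof.
move=> b4 h; rewrite expRN ler_pdivrMr ?expR_gt0 //.
have h2 : eta / 2 * (4096 * (1 + T0)) <= eta / 2 * expR (a * T0).
  by rewrite ler_pM2l ?divr_gt0 ?ltr0n //; exact: rate_le.
have h3 : 4 <= T0 * eta by rewrite -ler_pdivrMr.
apply: le_trans h2.
have -> : eta / 2 * (4096 * (1 + T0)) = 2048 * eta + 2048 * (T0 * eta) by field.
by move: h3 b4 eta0; set q := T0 * eta; lra.
Qed.

(** All the scales at time T0 are exponentials of a multiple of T0 of rate at least
    w e^2 / 2. *)
Lemma initial_scales : [/\ 1 <= scQ T0, 2 <= scX w e T0, 2 * scX w e T0 <= scY w e T0,
  2 * scY w e T0 / scQ T0 <= eta / 2 & bxY w e T0 <= eta / 2].
Proof.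
have [s1 s2 s3 s4] := sq.
have big (x : R) : 4096 * (1 + T0) <= x -> 2 <= x by move: T00; lra.
split.
- have r1 : w * e ^+ 2 / 2 <= 1 by move: s2 s4 hww w0; lra.
  by rewrite /scQ -[T0]mul1r; have := big _ (rate_le r1); lra.
- by apply/big/rate_le; move: s1 s2 s3 s4 hww w0; lra.
- have -> : scY w e T0 = expR ((1 - w - w) * T0) * scX w e T0.
    by rewrite /scY /scX -expRD; congr expR; ring.
  by rewrite ler_pM2r ?expR_gt0 //; apply/big/rate_le; move: s1 s2 s3 s4 hww w0; lra.
- have -> : 2 * scY w e T0 / scQ T0 = 2 * expR (- ((w + e ^+ 2) * T0)).
    by rewrite /scY /scQ -mulrA -expRN -expRD; congr (_ * expR _); ring.
  by apply: small_le; [lra|move: s1 s2 s3 s4 hww w0; lra].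
- rewrite bxYE.
  have -> : (1 - w - e ^+ 2) * ((1 + e) * T0) - T0 - (1 + e) * T0
      = - ((1 + (1 + e) * (w + e ^+ 2)) * T0) by ring.
  apply: small_le; first exact: lexx.
  have : 0 <= (1 + e) * (w + e ^+ 2) by rewrite mulr_ge0 //; move: s1 w0 e0; lra.
  by move: s1 s2 s4 hww w0; lra.
Qed.

(** The second bound keeps the shear compatible with initial_state. *)
Definition box_size : R := Num.min eta (2 * scY w e T0)^-1.

Lemma box_size_gt0 : 0 < box_size.
Proof. by rewrite lt_min eta0 invr_gt0 mulr_gt0 ?expR_gt0 ?ltr0n. Qed.

(** [tree_cover] for the fibre over th; P selects those of the given squares that count
    for this fibre. *)
Lemma divergent_point_avoiding (th : nat -> R) (P : pred nat) (z x rho : nat -> R) :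
  (forall j, 0 <= th j <= box_size) -> (forall i, 0 < rho i) ->
  (1 <= \sum_(i <oo) (if P i then potential w e d T0 0 (rho i) else 0)%:E)%E \/
  exists zx : R * R, [/\ chart_domain eta th zx,
    (forall i, P i -> ~~ ((`|zx.1 - z i| <= rho i) && (`|zx.2 - x i| <= rho i))) &
    exists h : \det (chart th zx.1 zx.2) = 1,
      divergent_set (1 - w) w (L3_proj (mkSL3 h))].
Proof.
move=> hth rho0.
have th_eta j : 0 <= th j <= eta.
  by have := hth j; rewrite le_min => /andP[-> /andP[->]].
have lev0 : level e T0 0 = T0 by rewrite /level expr0 mul1r.
have [c1 c2 c3 c4 c5] := initial_scales.
have [||st0 [g0 l0 pX pY]] := @initial_state R (scQ T0) (scX w e T0) (scY w e T0) (th 5%N) c1 c2 c3.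
- by case/andP: (hth 5%N).
- have /andP[_] := hth 5%N; rewrite le_min => /andP[_].
  by rewrite -[leRHS]mul1r ler_pdivlMr ?mulr_gt0 ?expR_gt0 ?ltr0n.
have a_le : aX w e T0 0 <= eta / 2.
  by apply: le_trans (aX_le_bY e0 hww T00 _) _; rewrite /bY lev0.
have b_le : bY w e T0 0 <= eta / 2 by rewrite /bY lev0.
(* a square outside P is moved so far that it meets nothing *)
pose z' i := if P i then z i else posX st0 + aX w e T0 0 + rho i + 1.
have g0' : good (scQ (level e T0 0)) (scX w e (level e T0 0)) (scY w e (level e T0 0)) st0.
  by rewrite lev0.
have [H|[st [zx [e_st0 gst cst nst av]]]] := @tree_cover R w e d T0 w0 e0 d1 he hw hww T00 Tbig st0 z' x rho g0' rho0.
  left; apply: le_trans H _; apply: lee_nneseries => [i _ _|i _].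
    by rewrite lee_fin; case: ifP => // _; exact: potential_ge0.
  rewrite lee_fin /z'; case: ifP => [|_]; last first.
    by case: ifP => // _; exact: potential_ge0.
  case: ifP => // _ /andP[+ _].
  rewrite !opprD !addrA subrr add0r ler_norml => /andP[h _]; exfalso.
  by move: h; rewrite leNgt => /negP; apply; lra.
right; exists zx.
have [n1 n2] := nst 0%N; rewrite e_st0 in n1 n2.
have XY : 2 * scX w e T0 / scQ T0 <= 2 * scY w e T0 / scQ T0.
  by rewrite ler_pM2r ?invr_gt0 ?expR_gt0 //; have := expR_gt0 ((w - e ^+ 2) * T0); rewrite -/(scX w e T0); lra.
have cd : chart_domain eta th zx.
  split => //.
    by move: n1; rewrite !ler_norml; lra.
  by move: n2; rewrite !ler_norml; lra.
split => //.
  by move=> i Pi; have := av i; rewrite /z' Pi.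
have /andP[t0 _] := hth 0%N; have /andP[t2 _] := hth 2%N.
exists (det_chart zx.1 zx.2 t0 t2).
apply: (divergent_chart w0 e0 hww T00 (st := st)) => //; last by rewrite e_st0.
by move=> j; have /andP[-> h] := th_eta j; apply: le_trans h eta1.
Qed.

End box.

(** * Hausdorff measure *)

Section null_sets.
Variables (R : realType) (T : Type) (dist : T -> T -> \bar R).

Lemma diameter_ge0 (A : set T) : (0 <= diameter dist A)%E.
Proof. by apply: ereal_sup_ubound; left. Qed.

Lemma le_diameter (A : set T) x y : A x -> A y -> (dist x y <= diameter dist A)%E.
Proof. by move=> Ax Ay; apply: ereal_sup_ubound; right; exists x => //; exists y. Qed.

(** A null set has covers of arbitrarily small weight. Strict radii r replace diameters,
    so that also the sets of diameter zero get a positive radius. *)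
Lemma null_cover (s eps : R) (A : set T) : 0 < s -> 0 < eps ->
  hausdorff_measure dist s A = 0%E ->
  exists (U : nat -> set T) (r : nat -> R),
    [/\ forall x, A x -> exists i, U i x, forall i, 0 < r i,
        forall i x y, U i x -> U i y -> (dist x y < (r i)%:E)%E &
        (\sum_(i <oo) (r i `^ s)%:E <= eps%:E)%E].
Proof.
move=> s0 eps0 hm.
have : (hausdorff_premeasure dist s 1 A < (eps / 2)%:E)%E.
  apply: (@le_lt_trans _ _ (hausdorff_measure dist s A)).
    by apply: ereal_sup_ubound; exists 1 => //=.
  by rewrite hm lte_fin divr_gt0.
move=> /ereal_inf_lt [_ [U [AU dU] <-] sU].
pose D i := fine (diameter dist (U i)).
have DE i : diameter dist (U i) = (D i)%:E.
  rewrite /D fineK // ge0_fin_numE ?diameter_ge0 //.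
  by apply: le_lt_trans (dU i) _; exact: ltry.
have D0 i : 0 <= D i by rewrite -lee_fin -DE diameter_ge0.
(* a summable margin makes the radii positive and larger than the diameters *)
pose g i : R := eps / 2 / (2 ^ i.+1)%:R.
have g0 i : 0 < g i by rewrite !divr_gt0 // ltr0n expn_gt0.
pose r i := (D i `^ s + g i) `^ s^-1.
have p0 i : 0 < D i `^ s + g i by rewrite ltr_wpDl ?powR_ge0.
have rs i : r i `^ s = D i `^ s + g i.
  by rewrite /r -powRrM mulVf ?gt_eqF // powRr1 // ltW.
exists U, r; split.
- by move=> x Ax; have [i _ Ux] := AU x Ax; exists i.
- by move=> i; exact: powR_gt0.
- move=> i x y Ux Uy; apply: le_lt_trans (le_diameter Ux Uy) _.
  rewrite DE lte_fin ltNge; apply/negP => h.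
  have : r i `^ s <= D i `^ s.
    by apply: ge0_ler_powR => //; rewrite ?nnegrE ?powR_ge0 // ltW.
  by rewrite rs leNgt ltrDl g0.
under eq_eseriesr do rewrite rs EFinD.
rewrite nneseriesD; last 2 first.
- by move=> i _ _; rewrite lee_fin powR_ge0.
- by move=> i _ _; rewrite lee_fin ltW.
rewrite [eps]splitr EFinD; apply: leeD.
  apply: le_trans (ltW sU); apply: lee_nneseries => i.
    by move=> _ _; rewrite lee_fin powR_ge0.
  by move=> _; rewrite DE poweR_EFin.
by apply: (epsilon_trick0 xpredT); rewrite divr_ge0 // ltW.
Qed.

Lemma le_nneseries_term (u : nat -> R) (M : R) i : (forall n, 0 <= u n) ->
  (\sum_(n <oo) (u n)%:E <= M%:E)%E -> u i <= M.
Proof.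
move=> u0; rewrite (@nneseriesD1 _ (fun n => (u n)%:E) i) // => [h|n _]; last by rewrite lee_fin.
rewrite -lee_fin.
apply: le_trans h; rewrite leeDl // nneseries_ge0 // => n _ _.
by rewrite lee_fin.
Qed.

Lemma powR_le_inv (x y s : R) : 0 < s -> 0 <= x -> 0 <= y -> x `^ s <= y `^ s -> x <= y.
Proof.
move=> s0 x0 y0; apply: contraTT; rewrite -!ltNge => h.
by apply: gt0_ltr_powR; rewrite ?nnegrE.
Qed.

End null_sets.

Section lower_bound.
Variables (R : realType) (Q : riemannian_metric R) (w s : R).
Hypotheses (w0 : 0 < w) (w12 : w < 1 - w) (s0 : 0 < s)
  (hs : s < 7 + (1 - w) / (2 - w)).

(** The eight coordinates contribute rho^6, rho^(1 - d) and rho^((1 - w) / (2 - w)); as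
    r <= 1, their product is at most r^s. *)
Lemma potential_power (e d T0 K r : R) : d <= 1 -> s <= 6 + (1 - d) + (1 - w) / (2 - w) ->
  0 < K -> 0 < r <= 1 ->
  (2 * (K * r)) ^+ 6 * potential w e d T0 0 (K * r) <=
  (2 * K) ^+ 6 * (K / bY w e T0 1) `^ (1 - d) *
    (K / aX w e T0 1) `^ ((1 - w) / (2 - w)) * r `^ s.
Proof.
move=> d1 hsd K0 /andP[r0 r1].
have a0 := aX_gt0 w e T0 1; have b0 := bY_gt0 w e T0 1.
set be := (1 - w) / (2 - w) in hsd *.
have hr : r ^+ 6 * (r `^ (1 - d) * r `^ be) <= r `^ s.
  have nz : r != 0 by rewrite gt_eqF.
  rewrite -powR_mulrn; last exact: ltW.
  rewrite -powRD ?nz ?implybT // -powRD ?nz ?implybT //.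
  by rewrite ger_powR ?r0 //; move: hsd; lra.
set A := (K / bY w e T0 1) `^ (1 - d); set B := (K / aX w e T0 1) `^ be.
have A0 : 0 <= A by exact: powR_ge0.
have B0 : 0 <= B by exact: powR_ge0.
have hp := potential_le w e d T0 0 (K * r).
have [K00 r00] := (ltW K0, ltW r0).
have eA : (K * r / bY w e T0 1) `^ (1 - d) = A * r `^ (1 - d).
  by rewrite mulrAC powRM // divr_ge0 // ltW.
have eB : (K * r / aX w e T0 1) `^ be = B * r `^ be.
  by rewrite mulrAC powRM // divr_ge0 // ltW.
rewrite -/be eA eB in hp.
have -> : (2 * (K * r)) ^+ 6 * potential w e d T0 0 (K * r) =
    (2 * K) ^+ 6 * (r ^+ 6 * potential w e d T0 0 (K * r)) by ring.
have X0 : 0 <= (2 * K) ^+ 6 by rewrite exprn_ge0 // mulr_ge0.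
have Y0 : 0 <= r ^+ 6 by rewrite exprn_ge0.
move: ((2 * K) ^+ 6) X0 (r ^+ 6) Y0 hr => X X0 Y Y0 hr.
have -> : X * A * B * r `^ s = X * (A * (B * r `^ s)) by rewrite -!mulrA.
apply: ler_wpM2l; first exact: X0.
apply: (@le_trans _ _ (Y * (A * r `^ (1 - d) * (B * r `^ be)))).
  by apply: ler_wpM2l; [exact: Y0|exact: hp].
have -> : Y * (A * r `^ (1 - d) * (B * r `^ be)) =
    A * (B * (Y * (r `^ (1 - d) * r `^ be))) by ring.
apply: ler_wpM2l; first exact: A0.
by apply: ler_wpM2l; [exact: B0|exact: hr].
Qed.

(** For d small the exponent 6 + (1 - d) + (1 - w) / (2 - w) is still at least s. In a
    cover of small weight, replace each set by a cube around a reference point. Every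
    fibre carries total potential at least one, since otherwise it would have a
    divergent point outside all the cubes; [slices] then bounds the weight below. *)
Lemma hausdorff_measure_neq0 :
  hausdorff_measure (riemannian_dist Q) s (divergent_set (1 - w) w) <> 0%E.
Proof.
move=> hm.
have [C [rho [C0 rho0 hC]]] := dist_lower_bound Q.
pose eta := Num.min 1 (rho / 5).
have eta0 : 0 < eta by rewrite lt_min ltr01 divr_gt0.
have eta1 : eta <= 1 by rewrite ge_min lexx.
have eta_rho : 5 * eta <= rho.
  by rewrite mulrC -ler_pdivlMr // ge_min lexx orbT.
pose d := Num.min 1 (7 + (1 - w) / (2 - w) - s).
have d1 : d <= 1 by rewrite ge_min lexx.
have d0 : 0 < d by rewrite lt_min ltr01 subr_gt0.
have hsd : s <= 6 + (1 - d) + (1 - w) / (2 - w).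
  have : d <= 7 + (1 - w) / (2 - w) - s by rewrite ge_min lexx orbT.
  by lra.
pose e := Num.min (d / 40) (Num.min (w / 8) (1 - w - w)).
have e0 : 0 < e by rewrite !lt_min !divr_gt0 ?ltr0n //=; move: w12; rewrite subr_gt0; lra.
have he : 40 * e <= d by rewrite mulrC -ler_pdivlMr // ge_min lexx.
have hw : 8 * e <= w by rewrite mulrC -ler_pdivlMr // !ge_min lexx orbT.
have hww : e <= 1 - w - w by rewrite !ge_min lexx !orbT.
have c0 : 0 < w * e ^+ 2 / 2 by rewrite divr_gt0 // mulr_gt0 // exprn_gt0.
have [T0 [T00 Teta Tbig]] := expR_beats_linear (4 / eta) c0.
clearbody eta d e.
have avoid := @divergent_point_avoiding R w e d T0 eta w0 e0 d1 he hw hww T00 Tbig eta0 eta1 Teta.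
have de0 := box_size_gt0 w e T0 eta0.
set de := box_size w e T0 eta in avoid de0.
pose K := 8 * C; have K0 : 0 < K by rewrite mulr_gt0.
pose M := (2 * K) ^+ 6 * (K / bY w e T0 1) `^ (1 - d) *
    (K / aX w e T0 1) `^ ((1 - w) / (2 - w)).
have M0 : 0 < M.
  by rewrite !mulr_gt0 ?exprn_gt0 ?mulr_gt0 ?powR_gt0 // divr_gt0 ?aX_gt0 ?bY_gt0.
pose eps := Num.min (Num.min 1 (rho `^ s)) (de ^+ 6 / (2 * M)).
have eps0 : 0 < eps by rewrite !lt_min ltr01 powR_gt0 //= divr_gt0 ?exprn_gt0 // mulr_gt0.
have [U [r [cU r0 hr sr]]] := null_cover s0 eps0 hm.
have rs i : r i `^ s <= eps by apply: (le_nneseries_term (u := fun i => r i `^ s)) => // n; exact: powR_ge0.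
have r_rho i : r i <= rho.
  apply: (powR_le_inv s0); [exact: ltW|exact: ltW|].
  by apply: le_trans (rs i) _; rewrite !ge_min lexx orbT.
have r1 i : r i <= 1.
  apply: (powR_le_inv s0); [exact: ltW|exact: ler01|].
  by apply: le_trans (rs i) _; rewrite powR1 !ge_min lexx.
(* q i is a reference point of the chart in U i, if there is one; all the points of
   the chart in U i have coordinates close to those of q i *)
pose V i (p : (nat -> R) * (R * R)) := chart_domain eta p.1 p.2 /\
  exists h : \det (chart p.1 p.2.1 p.2.2) = 1, U i (L3_proj (mkSL3 h)).
have /choice [q hq] : forall i, exists q, (exists p, V i p) -> V i q.
  move=> i; have [[p Vp]|nV] := pselect (exists p, V i p); first by exists p.
  by exists (fun=> 0, (0, 0)) => /nV.
have dom1 p : chart_domain eta p.1 p.2 -> chart_domain 1 p.1 p.2 :> Prop.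
  move=> [h1 h2 h3]; split => [j||]; [|exact: le_trans h2 eta1|exact: le_trans h3 eta1].
  by have /andP[-> h] := h1 j; exact: le_trans h eta1.
have close i p p' : V i p -> V i p' ->
    [/\ forall j, (j < 6)%N -> `|p.1 j - p'.1 j| <= K * r i,
      `|p.2.1 - p'.2.1| <= K * r i & `|p.2.2 - p'.2.2| <= K * r i].
  move=> [dp [h Uh]] [dp' [h' Uh']]; rewrite /K -mulrA.
  apply: chart_coordinates; [exact: dom1|exact: dom1|].
  have near p0 (dp0 : chart_domain eta p0.1 p0.2) : near_one rho (chart p0.1 p0.2.1 p0.2.2).
    by move=> a b; apply: le_trans (chart_near_one eta1 dp0 a b) eta_rho.
  exact: (hC (mkSL3 h) (mkSL3 h') (near _ dp) (near _ dp') _ (r_rho i) (hr _ _ _ Uh Uh')).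
have Kr0 i : 0 < K * r i by rewrite mulr_gt0.
pose P (th : nat -> R) i := all (fun j => `|th j - (q i).1 j| <= K * r i) (iota 0 6).
have key (th : nat -> R) : (forall j, 0 <= th j <= de) ->
    (1%:E <= \sum_(i <oo) (if P th i then potential w e d T0 0 (K * r i) else 0)%:E)%E.
  move=> hth.
  have [//|[zx [dzx av [h Dh]]]] := avoid th
    (P th)
    (fun i => (q i).2.1) (fun i => (q i).2.2) (fun i => K * r i) hth Kr0.
  exfalso; have [i Ui] := cU _ Dh.
  have Vi : V i (th, zx) by split => //; exists h.
  have [c1 c2 c3] := close i _ _ Vi (hq i (ex_intro _ _ Vi)).
  suff /av : P th i by rewrite c2 c3.
  by apply/allP => j; rewrite mem_iota => /andP[_ j6]; exact: c1.
have := @slices R 6 de 1 (fun i => (q i).1) (fun i => K * r i)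
  (fun i => potential w e d T0 0 (K * r i)) (ltW de0) (fun i => ltW (Kr0 i))
  (fun i => potential_ge0 _ _ _ _ _ _) key.
rewrite mul1r => h.
have : ((de ^+ 6)%:E <= (M * eps)%:E)%E.
  apply: le_trans h _; rewrite EFinM.
  apply: (@le_trans _ _ (\sum_(i <oo) (M%:E * (r i `^ s)%:E))%E).
    apply: lee_nneseries => i.
      by move=> _ _; rewrite lee_fin mulr_ge0 ?potential_ge0 // exprn_ge0 // mulr_ge0 // ltW.
    move=> _; rewrite -EFinM lee_fin.
    by apply: potential_power => //; rewrite r0 r1.
  rewrite nneseriesZl; last by move=> i _; rewrite lee_fin powR_ge0.
  by apply: lee_wpmul2l => //; rewrite lee_fin ltW.
rewrite lee_fin leNgt => /negP; apply.
apply: (@le_lt_trans _ _ (M * (de ^+ 6 / (2 * M)))).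
  by rewrite ler_pM2l // !ge_min lexx !orbT.
have -> : M * (de ^+ 6 / (2 * M)) = de ^+ 6 / 2 by field; rewrite gt_eqF.
by rewrite ltr_pdivrMr // ltr_pMr ?exprn_gt0 // ltr1n.
Qed.

End lower_bound.

Theorem corollary1p6 (R : realType) (w1 w2 : R) (hw12 : w2 < w1) (hw2 : 0 < w2)
    (hw : w1 + w2 = 1) (Q : riemannian_metric R) :
  ((8 - 1 / (1 + w1))%:E
     <= hausdorff_dim (riemannian_dist Q) (divergent_set w1 w2))%E.
Proof.
apply: le_ereal_inf_tmp => _ [s [s0 hm] <-].
rewrite lee_fin leNgt; apply/negP => hs.
have ew : w1 = 1 - w2 by rewrite -hw addrK.
rewrite ew in hw12 hm hs.
apply: (hausdorff_measure_neq0 hw2 hw12 s0 _ hm).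
apply: lt_le_trans hs _.
rewrite le_eqVlt; apply/orP; left; apply/eqP; field.
by rewrite gt_eqF //; lra.
Qed.
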